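(* For $2\le g\le4$, the set $\mathcal G(g)$ of canonical Weierstrass gap sequences of points on tropical curves of genus $g$ is as follows. (1) $\mathcal G(2)=\mathcal N(2)=\{(1,2),(1,3)\}$. (2) $\mathcal G(3)=\mathcal N(3)=\{(1,2,3),(1,2,4),(1,2,5),(1,3,5)\}$. (3) $\mathcal G(4)=\mathcal N(4)\cup\{(1,2,4,6),(1,2,5,6)\}$. Namely, \[ \mathcal G(4)=\{(1,2,3,4),(1,2,3,5),(1,2,3,6),(1,2,3,7),(1,2,4,5),(1,2,4,6),(1,2,4,7),(1,2,5,6),(1,3,5,7)\}. \]
   Context: A tropical curve (metric graph) $\Gamma$ is a compact connected metric space with the path metric in which every point $p$ has an open neighborhood isometric to a star with $m=\operatorname{val}(p)\ge 1$ branches of some radius $\varepsilon>0$ centered at $p$ (equivalently, it is obtained from a finite connected graph with positive edge lengths). Its genus is $\dim_{\mathbb R}H_1(\Gamma,\mathbb R)$. $T_p\Gamma$ is the set of outgoing tangent directions at $p$. $\operatorname{Div}(\Gamma)$ is the free abelian group on the points of $\Gamma$; $D=\sum_p D(p)(p)$, $\deg D=\sum_p D(p)$, and $D$ is effective if all $D(p)\ge 0$. A rational function is a continuous piecewise affine function $f:\Gamma\to\mathbb R$ with integer slopes; $\operatorname{sl}_{p,\nu}(f)$ is its outgoing slope at $p$ along $\nu\in T_p\Gamma$, and $\operatorname{div}(f)=\sum_p\bigl(-\sum_{\nu\in T_p\Gamma}\operatorname{sl}_{p,\nu}(f)\bigr)(p)$. $D\sim E$ means $D-E=\operatorname{div}(f)$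 for some rational function $f$. The (Baker–Norine) rank $\mathbf r(D)$ is the maximum among $-1$ and the integers $k\ge0$ such that for all $p_1,\dots,p_k\in\Gamma$ the divisor $D-(p_1)-\cdots-(p_k)$ is linearly equivalent to an effective divisor. The canonical divisor is $K=\sum_p(\operatorname{val}(p)-2)(p)$; it has degree $2g-2$ and rank $g-1$. For $p\in\Gamma$, $\underline n_K(p)=(n_1<\cdots<n_g)$ lists the positive integers $m$ with $\mathbf r(K-m(p))<\mathbf r(K-(m-1)(p))$ (exactly $g$ of them, all $\le 2g-1$). Let $\mathcal S(g)=\{(n_1,\dots,n_g)\in\mathbb Z^g\mid 1\le n_1<\cdots<n_g\le 2g-1\}$, $\mathcal G(g)=\{\underline n\in\mathcal S(g)\mid \underline n=\underline n_K(p)$ for some tropical curve $\Gamma$ of genus $g$ and some $p\in\Gamma\}$, and $\mathcal N(g)=\{\underline n\in\mathcal S(g)\mid$ the complement of $\{n_1,\dots,n_g\}$ in $\mathbb Z_{>0}$ is a numerical semigroup, i.e. closed under addition$\}$. *)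

(* Defs.v *)
From HB Require Import structures.
From mathcomp Require Import all_boot all_order all_algebra.
From mathcomp Require Import all_classical all_reals all_analysis.
From mathcomp Require Import freeg.

Set Implicit Arguments.
Unset Strict Implicit.
Unset Printing Implicit Defensive.

Import Order.TTheory GRing.Theory Num.Theory.
Import numFieldNormedType.Exports.

Local Open Scope classical_set_scope.
Local Open Scope ring_scope.

(* A metric graph is presented by a finite connected multigraph (loops and
   parallel edges allowed) with positive edge lengths.  The orientation from
   [src] to [tgt] only serves to coordinatize edges.  An edge is required, as
   every point of a tropical curve has valence at least 1. *)
Record tropical_curve (R : realType) := TropicalCurve {
  vertex : finType;
  edge : finType;
  src : edge -> vertex;
  tgt : edge -> vertex;
  len : edge -> R;
  len_gt0 : forall e, 0 < len e;
  edge_neq0 : (0 < #|edge|)%N;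
  vertex_connected : forall v w : vertex,
    connect (fun a b => [exists e, ((src e == a) && (tgt e == b))
                                || ((src e == b) && (tgt e == a))]) v w }.

Section TropicalCurve.
Variables (R : realType) (G : tropical_curve R).

Local Notation V := (vertex G).
Local Notation E := (edge G).

(* The cellular boundary map of the graph, acting on row vectors of 1-chains.
   There are no 2-cells, so H_1 is its kernel. *)
Definition boundary : 'M[R]_(#|E|, #|V|) :=
  \matrix_(i, j) ((tgt (enum_val i) == enum_val j)%:R
                - (src (enum_val i) == enum_val j)%:R).

Definition genus : nat := \rank (kermx boundary).

(* [inr] carries the points in the open edges, by edge and distance from the
   source. *)
Definition point := (V + {x : E * R | 0 < x.2 < len x.1})%type.

(* The point at distance [t] from the source of [e], for t in [0, len e]; other
   values of [t] are clamped. *)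
Definition edge_point (e : E) (t : R) : point :=
  match insub (e, t) with
  | Some x => inr x
  | None => if t <= 0 then inl (src e) else inl (tgt e)
  end.

(* A direction is an edge together with a sense of travel along it, [false]
   being from source to target.  A loop at a vertex gives two of them. *)
Definition direction := (E * bool)%type.

Definition tangent (p : point) : {set direction} :=
  match p with
  | inl v => [set d : direction | (if d.2 then tgt d.1 else src d.1) == v]
  | inr x => [set d : direction | d.1 == (val x).1]
  end.

Definition valence (p : point) : nat := #|tangent p|.

(* The point at small distance [s] from [p] in the direction [d], which should
   belong to [tangent p]. *)
Definition travel (p : point) (d : direction) (s : R) : point :=
  let start := match p with
               | inl v => if d.2 then len d.1 else 0
               | inr x => (val x).2
               end in
  edge_point d.1 (start + (-1) ^+ d.2 * s).

(* Asking for affineness on closed pieces covering each closed edge makes [f]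
   continuous. *)
Definition rational_function (f : point -> R) : Prop :=
  forall e : E, exists2 s : seq R, itv_partition 0 (len e) s &
    forall i, (i < size s)%N ->
    exists k : int, exists c : R,
      forall t, t \in `[nth 0 (0 :: s) i, nth 0 s i] ->
        f (edge_point e t) = k%:~R * t + c.

Definition outgoing_slope (f : point -> R) (p : point) (d : direction) : int :=
  xget 0 [set k : int |
    \forall s \near 0^'+, f (travel p d s) = f p + k%:~R * s].

Definition div_coeff (f : point -> R) (p : point) : int :=
  - \sum_(d in tangent p) outgoing_slope f p d.

Definition divisor := {freeg point / int}.

Definition effective (D : divisor) : Prop := forall p, 0 <= coeff p D.

Definition linearly_equivalent (D D' : divisor) : Prop :=
  exists2 f : point -> R, rational_function f &
    forall p, coeff p (D - D') = div_coeff f p.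

Definition rank_values (D : divisor) : set int :=
  [set -1] `|` [set k%:Z | k in [set k : nat |
    forall q : k.-tuple point, exists2 D' : divisor, effective D' &
      linearly_equivalent (D - \sum_(x <- q) << x >>) D']].

(* The maximum of [rank_values D]. *)
Definition rank (D : divisor) : int :=
  xget (-1) (rank_values D `&` ubound (rank_values D)).

(* Only vertices contribute: other points have valence 2. *)
Definition canonical_divisor : divisor :=
  \sum_(v : V) << (valence (inl v))%:Z - 2 *g (inl v : point) >>.

Definition is_gap (p : point) (m : nat) : Prop :=
  (0 < m)%N /\ rank (canonical_divisor - << p >> *+ m)
             < rank (canonical_divisor - << p >> *+ m.-1).

(* [n] lists the gaps at [p] in increasing order. *)
Definition gap_sequence (p : point) (n : seq nat) : Prop :=
  sorted ltn n /\ forall m, m \in n <-> is_gap p m.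

End TropicalCurve.

Definition candidate_sequences (g : nat) : set (g.-tuple nat) :=
  [set n | sorted ltn n /\ forall m, m \in n -> (1 <= m <= 2 * g - 1)%N].
Arguments candidate_sequences g : clear implicits.

Definition tropical_gap_sequences (R : realType) (g : nat) :
    set (g.-tuple nat) :=
  [set n | candidate_sequences g n /\
     exists G : tropical_curve R, genus G = g /\
       exists p : point G, gap_sequence p n].
Arguments tropical_gap_sequences R g : clear implicits.

Definition numerical_gap_sequences (g : nat) : set (g.-tuple nat) :=
  [set n | candidate_sequences g n /\
     forall a b : nat, (0 < a)%N -> (0 < b)%N ->
       a \notin n -> b \notin n -> (a + b)%N \notin n].
Arguments numerical_gap_sequences g : clear implicits.

(* Main.v *)
(* The rank of a divisor obeys the Riemann-Roch theorem, so [m] is a gap at [p] iff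
   [r(m p) = r((m - 1) p)], and [rho m = r(m p)] is determined by the gaps.  It is
   superadditive, and if [2g - 1] is a gap then [K ~ (2g - 2) p], which makes [rho]
   self-dual under [m <-> 2g - 2 - m].  For [g <= 4] these constraints leave exactly
   the listed sequences.  Each of them occurs at the end of a chain of circles joined
   by bridges: attaching a circle on which the two marked points differ by an element
   of prescribed order changes the function [k |-> min {m | r(m p) >= k}] in an
   explicit way.

   Riemann-Roch is proved by reduced divisors.  A divisor that is effective away from
   a base point [q] has a largest function moving its chips towards [q], because on
   every edge a supremum of such functions is a maximum of finitely many affine
   functions with integer slopes.  Dhar's burning algorithm turns the resulting
   reduced divisor into an acyclic orientation, hence into a divisor of degree
   [g - 1] that is not equivalent to an effective one and dominates it unless it is
   itself equivalent to an effective divisor. *)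

From HB Require Import structures.
From mathcomp Require Import all_boot all_order all_algebra.
From mathcomp Require Import all_classical all_reals all_analysis.
From mathcomp Require Import freeg ring lra zify.
Require Import Defs.

Set Implicit Arguments.
Unset Strict Implicit.
Unset Printing Implicit Defensive.

Import Order.TTheory GRing.Theory Num.Theory.
Import numFieldNormedType.Exports.

Local Open Scope classical_set_scope.
Local Open Scope ring_scope.

(** * Piecewise affine functions with integer slopes on the line *)

(** Gaps record where the rank of [m p] fails to grow, and tropically ranks only add up: two
    non-gaps need not sum to a non-gap. With gaps 1, 2, 4, 6 in genus 4 the ranks at 3, 5 and 6 are
    1, 2 and 2, so superadditivity holds although 3 + 3 = 6 is a gap. Superadditivity alone would
    still admit (1,2,5,7) and (1,2,6,7); the duality removes them. The obstacle before Riemann-Roch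
    is that points, functions and divisors are tied to one graph model, while firing and burning
    need divisors supported on vertices and graphs without loops. Hence models are refined, and
    equivalence, reducedness and moderators are transported between them. Slopes are handled by
    relations ([germ], [slope]), because [outgoing_slope] takes a default value where no slope
    exists. The supremum of firing functions keeps integer slopes because the degree of the divisor
    bounds the slopes of their supporting lines on every edge. *)

Section RealLine.
Variable R : realType.
Implicit Types (g : R -> R) (t s : R) (b : bool) (k : int).

Lemma near0_right (P : R -> Prop) :
  (\forall s \near 0^'+, P s) <->
  exists2 eps : R, 0 < eps & forall s, 0 < s < eps -> P s.
Proof.
split.
  rewrite near_withinE near_nbhs => -[e /= e0 H]; exists e => // s /andP[s0 se].
  by apply: H => //=; rewrite sub0r normrN gtr0_norm.
move=> [e e0 H]; near=> s; apply: H; apply/andP; split => //.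
Unshelve. all: by end_near.
Qed.

(** The supremum [m] of the [t] such that [P] holds on all of [0, t] satisfies [P] by the third
    hypothesis, and the second then pushes beyond [m]. This stands in for compactness of an edge. *)
Lemma real_induction (L : R) (P : R -> Prop) :
  P 0 ->
  (forall t, 0 <= t < L -> P t ->
    exists2 eps, 0 < eps & forall s, t < s < t + eps -> s <= L -> P s) ->
  (forall t, 0 < t <= L -> (forall s, 0 <= s < t -> P s) -> P t) ->
  forall t, 0 <= t <= L -> P t.
Proof.
move=> P0 Pr Pl t0 /andP[t00 t0L]; apply: contrapT => nPt0.
pose S := [set t | 0 <= t <= L /\ forall s, 0 <= s <= t -> P s].
have S0 : S 0.
  split; first by rewrite lexx (le_trans t00).
  by move=> s; rewrite -eq_le => /eqP <-.
have ubS : ubound S t0.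
  move=> t [_ tP]; rewrite leNgt; apply/negP => tt0.
  by apply: nPt0; apply: tP; rewrite t00 ltW.
have hS : has_sup S by split; [exists 0 | exists t0].
pose m := sup S.
have m0 : 0 <= m by exact: sup_upper_bound.
have mt0 : m <= t0 by apply: ge_sup => //; exists 0.
have Plt s : 0 <= s < m -> P s.
  move=> /andP[s0 sm].
  have [x [_ Sx] mx] := sup_adherent (eps := m - s) (E := S) ltac:(by rewrite subr_gt0) hS.
  by apply: Sx; rewrite s0 /=; move: mx; rewrite -/m; lra.
have Pm : P m.
  move: m0; rewrite le_eqVlt => /orP[/eqP <- //|m0].
  by apply: Pl => //; rewrite m0 /=; lra.
have mL : m < L.
  rewrite lt_neqAle (le_trans mt0 t0L) andbT; apply/eqP => mL.
  by apply: nPt0; have -> : t0 = m by lra.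
have [e e0 He] := Pr m ltac:(by rewrite m0) Pm.
pose x := m + Num.min (e / 2) (L - m).
have [me mLx] : x - m <= e / 2 /\ x <= L.
  have h1 := ge_min (e / 2) (e / 2) (L - m); have h2 := ge_min (L - m) (e / 2) (L - m).
  rewrite lexx in h1; rewrite lexx orbT in h2; split; move: h1 h2; rewrite /x; lra.
have xm : m < x.
  by rewrite /x ltrDl lt_min; apply/andP; split; lra.
have : S x.
  split; first by apply/andP; split; lra.
  move=> s /andP[s0 sx]; case: (ltgtP s m) => sm; last by rewrite sm.
  - by apply: Plt; rewrite s0.
  - by apply: He; [apply/andP; split|]; lra.
by move=> /(sup_upper_bound hS); rewrite -/m; lra.
Qed.

(* [germ g t b k]: near [t], to the right of [t] if [b] is false and to its left
   otherwise, [g] is affine with slope [k] measured away from [t]. *)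
Definition germ g t b k := exists2 eps, 0 < eps &
  forall s, 0 <= s < eps -> g (t + (-1) ^+ b * s) = g t + k%:~R * s.

Definition piecewise_linear g := forall t b, exists k, germ g t b k.

Lemma germ_near g t b k (u : R) : 0 < u ->
  (forall s, 0 < s < u -> g (t + (-1) ^+ b * s) = g t + k%:~R * s) ->
  germ g t b k.
Proof.
move=> u0 H; exists u => // s; rewrite le_eqVlt => /andP[/orP[/eqP <-|s0] su].
  by rewrite !mulr0 !addr0.
by apply: H; rewrite s0.
Qed.

Lemma germ_le g1 g2 t b k1 k2 : germ g1 t b k1 -> germ g2 t b k2 ->
  g1 t = g2 t ->
  (exists2 eps, 0 < eps & forall s, 0 < s < eps ->
     g1 (t + (-1) ^+ b * s) <= g2 (t + (-1) ^+ b * s)) -> k1 <= k2.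
Proof.
move=> [e1 e10 H1] [e2 e20 H2] E [e3 e30 H3].
pose s := Num.min (Num.min e1 e2) e3 / 2.
have m0 : 0 < Num.min (Num.min e1 e2) e3 by rewrite !lt_min e10 e20.
have s0 : 0 < s by rewrite divr_gt0.
have : s < Num.min (Num.min e1 e2) e3 by rewrite /s; lra.
rewrite !lt_min => /andP[/andP[s1 s2] s3].
have := H3 s ltac:(by rewrite s0); rewrite H1 ?H2 ?(ltW s0) // E lerD2l.
by rewrite ler_pM2r // ler_int.
Qed.

Lemma germ_uniq g t b k1 k2 : germ g t b k1 -> germ g t b k2 -> k1 = k2.
Proof.
move=> h1 h2; apply/eqP; rewrite eq_le.
by rewrite !(germ_le (t := t) (b := b) (g1 := g) (g2 := g)) //; exists 1.
Qed.

Lemma eq_germ g1 g2 t b k (u : R) : 0 < u ->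
  (forall s, 0 <= s < u -> g1 (t + (-1) ^+ b * s) = g2 (t + (-1) ^+ b * s)) ->
  germ g1 t b k -> germ g2 t b k.
Proof.
move=> u0 E [e e0 H]; exists (Num.min u e); first by rewrite lt_min u0.
move=> s; rewrite lt_min => /and3P[s0 su se].
have := E 0 ltac:(by rewrite lexx); rewrite mulr0 addr0 => <-.
by rewrite -E ?s0 // H ?s0.
Qed.

Lemma germ_affine (k : int) (c t : R) b :
  germ (fun t => k%:~R * t + c) t b ((-1) ^+ b * k).
Proof. by exists 1 => // s _; rewrite intrM rmorphXn /= rmorphN rmorph1; ring. Qed.

Lemma germN g t b k : germ g t b k -> germ (\- g) t b (- k).
Proof. by move=> [e e0 H]; exists e => // s /H /= ->; rewrite intrN; ring. Qed.

(** Where the values at [t] differ, the larger function wins nearby; where they agree, the one with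
    the larger slope does. *)
Lemma germ_max g1 g2 t b k1 k2 : germ g1 t b k1 -> germ g2 t b k2 ->
  exists k, germ (fun t => Num.max (g1 t) (g2 t)) t b k.
Proof.
wlog le12 : g1 g2 k1 k2 / g1 t < g2 t \/ g1 t = g2 t /\ k1 <= k2.
  have maxE : (fun t => Num.max (g1 t) (g2 t)) = (fun t => Num.max (g2 t) (g1 t)).
    by apply/funext => x; rewrite maxC.
  move=> H h1 h2; case: (ltgtP (g1 t) (g2 t)) => c.
  - by apply: (H g1 g2 k1 k2) => //; left.
  - by rewrite maxE; apply: (H g2 g1 k2 k1) => //; left.
  - case: (leP k1 k2) => k12; first by apply: (H g1 g2 k1 k2) => //; right.
    by rewrite maxE; apply: (H g2 g1 k2 k1) => //; right; rewrite ltW.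
move=> [e1 e10 H1] [e2 e20 H2]; exists k2.
suff [e e0 He] : exists2 e, 0 < e & forall s, 0 <= s < e ->
    g1 t + k1%:~R * s <= g2 t + k2%:~R * s.
  exists (Num.min e (Num.min e1 e2)); first by rewrite !lt_min e10 e20 e0.
  move=> s; rewrite !lt_min => /and4P[s0 se s1 s2].
  rewrite H1 ?s0 // H2 ?s0 // (max_idPr _) ?He ?s0 //.
  by have := He 0; rewrite lexx e0 !mulr0 !addr0 => /(_ isT) /max_idPr ->.
case: le12 => [lt12|[-> k12]]; last first.
  by exists 1 => // s /andP[s0 _]; rewrite lerD2l ler_wpM2r // ler_int.
have K0 : 0 < `|k1%:~R - k2%:~R : R| + 1 by rewrite ltr_wpDl.
(* The two affine germs cannot cross before the gap in value divided by the difference of slopes;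
   [+ 1] keeps the denominator positive. *)
exists ((g2 t - g1 t) / (`|k1%:~R - k2%:~R| + 1)).
  by rewrite divr_gt0 // subr_gt0.
move=> s; rewrite ltr_pdivlMr // mulrDr mulr1 => /andP[s0 se].
have : (k1%:~R - k2%:~R) * s <= s * `|k1%:~R - k2%:~R|.
  by rewrite mulrC ler_wpM2l // ler_norm.
by lra.
Qed.

Lemma germ_shift g t b u b' k :
  germ (fun s => g (t + (-1) ^+ b * s)) u b' k <->
  germ g (t + (-1) ^+ b * u) (b (+) b') k.
Proof.
split=> -[e e0 H]; exists e => // s /H.
  by rewrite signr_addb mulrDr addrA mulrA.
by rewrite signr_addb mulrDr addrA mulrA.
Qed.

Definition pl_on (L : R) g := forall t b,
  (if b then 0 < t <= L else 0 <= t < L) -> exists k, germ g t b k.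

Definition convex_on (L : R) g := forall t kl kr, 0 < t < L ->
  germ g t true kl -> germ g t false kr -> 0 <= kl + kr.

(** Real induction, strengthened by a bound on the slope to the left of [t]: measured away from [t]
    it is at most [- k], so by convexity the slope to the right is at least [k]. *)
Lemma convex_tangent0 (L : R) g k : pl_on L g -> convex_on L g -> germ g 0 false k ->
  forall t, 0 <= t <= L -> g 0 + k%:~R * t <= g t.
Proof.
move=> gpl gcvx g0.
suff H t : 0 <= t <= L -> g 0 + k%:~R * t <= g t /\
    (forall kl, 0 < t -> germ g t true kl -> kl <= - k) by move=> t /H[].
move: t; apply: real_induction => [|t tL [gt kt]|t tL IH].
- by rewrite mulr0 addr0; split=> // kl; rewrite ltxx.
- have [kr [e e0 Hr]] := gpl t false tL.
  have kkr : k <= kr.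
    move: Hr; have [->|tn0] := eqVneq t 0 => Hr.
      by rewrite (germ_uniq g0 (k2 := kr)) //; exists e.
    have t0 : 0 < t by case/andP: tL; rewrite le_eqVlt eq_sym (negPf tn0).
    have tltL : t < L by case/andP: tL.
    have [|kl hl] := gpl t true; first by rewrite t0 ltW.
    have := kt _ t0 hl; have := gcvx t kl kr _ hl (ex_intro2 _ _ e e0 Hr).
    by rewrite t0 tltL => /(_ isT); lia.
  exists e => // s /andP[ts se] sL.
  have gs : g s = g t + kr%:~R * (s - t).
    by rewrite -Hr ?expr0 ?mul1r; [congr g; ring|apply/andP; split; lra].
  split.
    rewrite gs; have : k%:~R * (s - t) <= kr%:~R * (s - t).
      by rewrite ler_wpM2r ?ler_int // subr_ge0 ltW.
    by move: gt; lra.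
  move=> kl s0 hl.
  suff : germ g s true (- kr) by move=> /(germ_uniq hl) ->; rewrite lerN2.
  apply: (@germ_near _ _ _ _ (s - t)); first by rewrite subr_gt0.
  move=> u /andP[u0 us]; rewrite gs expr1.
  have -> : s + -1 * u = t + (-1) ^+ false * (s - t - u) by rewrite expr0; ring.
  by rewrite Hr ?intrN; [ring|apply/andP; split; lra].
- have [kl [e e0 Hl]] := gpl t true tL.
  pose u := Num.min (e / 2) (t / 2).
  have t0 : 0 < t by case/andP: tL.
  have [u0 ue ut] : [/\ 0 < u, u <= e / 2 & u <= t / 2].
    by rewrite /u lt_min !ge_min !lexx orbT !divr_gt0.
  have gtu : g (t - u) = g t + kl%:~R * u.
    by rewrite -Hl ?expr1 ?mulN1r //; apply/andP; split; lra.
  have hu : germ g (t - u) true kl.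
    apply: (@germ_near _ _ _ _ (e / 2)); first by rewrite divr_gt0.
    move=> s /andP[s0 se]; rewrite gtu.
    have -> : t - u + (-1) ^+ true * s = t + (-1) ^+ true * (u + s) by rewrite expr1; ring.
    by rewrite Hl; [ring|apply/andP; split; lra].
  have [gu ku] := IH (t - u) ltac:(apply/andP; split; lra).
  have klk : kl <= - k by apply: ku => //; lra.
  split=> [|k' _ /(germ_uniq (ex_intro2 _ _ e e0 Hl)) <- //].
  have : kl%:~R * u <= (- k)%:~R * u by rewrite ler_wpM2r ?ler_int // ltW.
  by rewrite intrN; move: gu gtu; lra.
Qed.

(** Reparametrising by the distance from [t] in the sense [b] reduces to the tangent at the left
    end; reversing the line swaps the two germs in the convexity hypothesis. *)
Lemma convex_tangent (L : R) g t b k : pl_on L g -> convex_on L g -> germ g t b k ->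
  0 <= t <= L ->
  forall s, 0 <= s -> 0 <= t + (-1) ^+ b * s <= L ->
  g t + k%:~R * s <= g (t + (-1) ^+ b * s).
Proof.
move=> gpl gcvx gt tL s s0 sL.
have gE : g t = (fun s => g (t + (-1) ^+ b * s)) 0 by rewrite mulr0 addr0.
rewrite gE; apply: (@convex_tangent0 (if b then t else L - t)
    (fun s => g (t + (-1) ^+ b * s))).
- move=> u b' Hu; have [|k' Hk'] := gpl (t + (-1) ^+ b * u) (b (+) b').
    case: b b' Hu {gt sL gE} => [] [] /= /andP[]; rewrite ?expr1 ?expr0;
      case/andP: tL; move=> *; apply/andP; split; lra.
  by exists k'; apply/germ_shift.
- move=> u kl kr Hu /germ_shift hl /germ_shift hr.
  have tuL : 0 < t + (-1) ^+ b * u < L.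
    case: b Hu {gt sL hl hr gE} => /andP[]; rewrite ?expr1 ?expr0;
      case/andP: tL; move=> *; apply/andP; split; lra.
  case: b gt sL Hu hl hr tuL gE => /= gt sL Hu hl hr tuL _; last exact: gcvx hl hr.
  by rewrite addrC; exact: gcvx hr hl.
- by apply/germ_shift; rewrite mulr0 addr0 addbF.
- case: b gt sL gE => gt sL _; move: s0 sL; rewrite ?expr1 ?expr0 => s0 /andP[? ?];
    apply/andP; split; lra.
Qed.

(** Recursive form of the indexed condition in [rational_function], so that a partition can be
    extended by one piece at its end. *)
Fixpoint affine_pieces g (a : R) (s : seq R) : Prop :=
  if s is b :: s' then
    (exists k : int, exists c : R, forall t, t \in `[a, b] -> g t = k%:~R * t + c) /\
    affine_pieces g b s'
  else True.

Lemma affine_piecesP g a (s : seq R) : affine_pieces g a s <->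
  forall i, (i < size s)%N -> exists k : int, exists c : R,
    forall t, t \in `[nth 0 (a :: s) i, nth 0 s i] -> g t = k%:~R * t + c.
Proof.
elim: s a => [|b s IH] a; first by [].
split=> [[H0 /IH H]|H]; first by case=> [//|i]; exact: H.
by split; [exact: (H 0%N)|apply/IH => i; exact: (H i.+1)].
Qed.

Lemma affine_pieces_cat g a (s1 s2 : seq R) : affine_pieces g a (s1 ++ s2) <->
  affine_pieces g a s1 /\ affine_pieces g (last a s1) s2.
Proof. by elim: s1 a => [|b s1 IH] a /=; [tauto|rewrite IH; tauto]. Qed.

Lemma affine_germ g (a c d : R) k t b :
  (forall t, t \in `[a, c] -> g t = k%:~R * t + d) ->
  (if b then a < t <= c else a <= t < c) -> germ g t b ((-1) ^+ b * k).
Proof.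
move=> H tac.
apply: (@eq_germ (fun t => k%:~R * t + d) _ _ _ _ (if b then t - a else c - t)).
- by case: b tac => /andP[? ?]; rewrite subr_gt0.
- move=> s Hs; rewrite H // in_itv /=.
  by case: b tac Hs => /andP[? ?] /andP[? ?]; rewrite ?expr1 ?expr0; apply/andP; split; lra.
- exact: germ_affine.
Qed.

Lemma affine_pieces_germ g a (s : seq R) : path <%R a s -> affine_pieces g a s ->
  forall t b, (if b then a < t <= last a s else a <= t < last a s) ->
  exists k, germ g t b k.
Proof.
elim: s a => [|c s IH] a /=.
  by move=> _ _ t [] /andP[]; [move=> /lt_le_trans h /h|move=> /le_lt_trans h /h]; rewrite ltxx.
move=> /andP[ac pcs] [[k [d H]] Hs] t b Ht.
case: (boolP (if b then a < t <= c else a <= t < c)) => tac.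
  by exists ((-1) ^+ b * k); exact: (affine_germ H).
apply: (IH _ pcs Hs).
by case: b Ht tac => /andP[-> ->] /=; rewrite ?andbT -?leNgt -?ltNge.
Qed.

(** Germs at every point give finitely many pieces by real induction: a germ to the right extends a
    partition beyond [t], and a germ to the left joins [t] to a partition ending shortly before
    it. *)
Lemma pl_onP (L : R) g : 0 < L ->
  pl_on L g <-> exists2 s, itv_partition 0 L s & affine_pieces g 0 s.
Proof.
move=> L0; split=> [gpl|[s [ps /eqP sL] gs]]; last first.
  by move=> t b; rewrite -sL; exact: affine_pieces_germ.
suff H t : 0 <= t <= L -> exists2 s, itv_partition 0 t s & affine_pieces g 0 s.
  by apply: H; rewrite lexx ltW.
move: t; apply: real_induction => [|t tL [s [ps /eqP st] gs]|t tL IH].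
- by exists [::] => //; split => /=.
- have [k [e e0 Hk]] := gpl t false tL; exists e => // u /andP[tu ue] uL.
  exists (rcons s u).
    by split; rewrite ?rcons_path ?last_rcons // ps st.
  rewrite -cats1 affine_pieces_cat; split => //=; split=> //.
  exists k, (g t - k%:~R * t) => x; rewrite in_itv /= st => /andP[x1 x2].
  have -> : x = t + (-1) ^+ false * (x - t) by rewrite expr0; ring.
  by rewrite Hk ?expr0; [ring|apply/andP; split; lra].
- have [k [e e0 Hk]] := gpl t true tL.
  pose u := Num.min (e / 2) (t / 2).
  have t0 : 0 < t by case/andP: tL.
  have [u0 ue ut] : [/\ 0 < u, u <= e / 2 & u <= t / 2].
    by rewrite /u lt_min !ge_min !lexx orbT !divr_gt0.
  have [s [ps /eqP st] gs] := IH (t - u) ltac:(apply/andP; split; lra).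
  exists (rcons s t).
    by split; rewrite ?rcons_path ?last_rcons // ps st ltrBlDr ltrDl.
  rewrite -cats1 affine_pieces_cat; split => //=; split=> //.
  exists (- k), (g t + k%:~R * t) => x; rewrite in_itv /= st => /andP[x1 x2].
  have -> : x = t + (-1) ^+ true * (t - x) by rewrite expr1; ring.
  by rewrite Hk ?expr1 ?intrN; [ring|apply/andP; split; lra].
Qed.

End RealLine.

(** * Points, directions and slopes *)

Section Points.
Variables (R : realType) (G : tropical_curve R).
Implicit Types (d : direction G) (p : point G) (f : point G -> R) (s t : R).

Definition origin d : vertex G := if d.2 then tgt d.1 else src d.1.
Definition opposite d : direction G := (d.1, ~~ d.2).
(** Measuring from the origin of the direction treats both senses of an edge alike. *)
Definition arc d s : point G := edge_point d.1 (if d.2 then len d.1 - s else s).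

Lemma oppositeK : involutive opposite.
Proof. by case=> e b; rewrite /opposite /= negbK. Qed.

Lemma opposite_neq d : opposite d != d.
Proof. by case: d => e b; rewrite xpair_eqE eqxx eq_sym; case: b. Qed.

Lemma arc_opposite d s : arc (opposite d) s = arc d (len d.1 - s).
Proof. by case: d => e [] //; rewrite /arc /=; congr edge_point; ring. Qed.

Lemma arc0 d : arc d 0 = inl (origin d).
Proof.
case: d => e b; rewrite /arc /edge_point /origin /=.
have e0 := len_gt0 e; case: b; rewrite ?subr0 insubN /= ?ltxx ?andbF //.
  by rewrite leNgt e0.
by rewrite lexx.
Qed.

Lemma arc_len d : arc d (len d.1) = inl (origin (opposite d)).
Proof. by rewrite -arc0 arc_opposite subr0. Qed.

Lemma arc_interior d s (H : 0 < s < len d.1) :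
  exists x, [/\ arc d s = inr x, (val x).1 = d.1 &
               (val x).2 = if d.2 then len d.1 - s else s].
Proof.
have Ht : 0 < (if d.2 then len d.1 - s else s) < len d.1.
  by case: d.2 => //; case/andP: H => ? ?; apply/andP; split; lra.
rewrite /arc /edge_point insubT /=.
by exists (exist _ (d.1, if d.2 then len d.1 - s else s) Ht).
Qed.

Lemma point_arc p : (exists v, p = inl v) \/
  exists d s, [/\ 0 < s < len d.1, d.2 = false & p = arc d s].
Proof.
case: p => [v|x]; first by left; exists v.
right; exists ((val x).1, false), (val x).2; split => //; first exact: (valP x).
rewrite /arc /edge_point /=; have := valP x; case: insubP => [y _ ey _|/negP//].
by congr inr; apply/val_inj; rewrite /= ey; case: (val x).
Qed.

Lemma travel_arc d s u : 0 <= s < len d.1 -> travel (arc d s) d u = arc d (s + u).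
Proof.
move=> /andP[]; rewrite le_eqVlt => /orP[/eqP <- _|s0 sl].
  by rewrite arc0 /travel add0r /arc; case: d => e [] /=; congr edge_point; ring.
have [|x [-> E1 E2]] := @arc_interior d s; first by rewrite s0.
by rewrite /travel E2 /arc; case: d {E1 E2 sl} => e [] /=; congr edge_point; ring.
Qed.

Lemma travel_arcN d s u : 0 < s <= len d.1 ->
  travel (arc d s) (opposite d) u = arc d (s - u).
Proof.
move=> Hs; have -> : arc d s = arc (opposite d) (len d.1 - s).
  by rewrite arc_opposite; congr arc; ring.
rewrite travel_arc /= ?arc_opposite; last by case/andP: Hs => ? ?; apply/andP; split; lra.
by congr arc; ring.
Qed.

Lemma tangent_vertex v d : (d \in tangent (inl v : point G)) = (origin d == v).
Proof. by rewrite inE. Qed.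

Lemma tangent_arc d s : 0 < s < len d.1 ->
  tangent (arc d s) = [set d; opposite d]%SET.
Proof.
move=> /arc_interior[x [-> E1 _]]; apply/setP => -[e b].
rewrite !inE /= E1 /opposite; case: d {E1} => e' b' /=.
by rewrite !xpair_eqE; case: eqP => //= _; case: b b' => [] [].
Qed.

(** Relational counterpart of [outgoing_slope], whose [xget] returns 0 where no slope exists; on
    tame functions the two agree. *)
Definition slope f p d (k : int) := exists2 eps, 0 < eps &
  forall s, 0 < s < eps -> f (travel p d s) = f p + k%:~R * s.

Lemma slope_arc f d s k : 0 <= s < len d.1 ->
  slope f (arc d s) d k <-> germ (f \o arc d) s false k.
Proof.
move=> Hs; split=> -[e e0 H].
  by apply: (germ_near e0) => u Hu; rewrite /= -H // travel_arc // expr0 mul1r.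
by exists e => // u /andP[u0 ue]; rewrite travel_arc // -H ?expr0 ?mul1r // ltW.
Qed.

Lemma slope_arcN f d s k : 0 < s <= len d.1 ->
  slope f (arc d s) (opposite d) k <-> germ (f \o arc d) s true k.
Proof.
move=> Hs; split=> -[e e0 H].
  by apply: (germ_near e0) => u Hu; rewrite /= -H // travel_arcN // expr1 mulN1r.
by exists e => // u /andP[u0 ue]; rewrite travel_arcN // -H ?expr1 ?mulN1r // ltW.
Qed.

Lemma slope_origin f d k : slope f (inl (origin d)) d k <-> germ (f \o arc d) 0 false k.
Proof. by rewrite -arc0 slope_arc // lexx len_gt0. Qed.

Lemma slope_uniq f p d k1 k2 : slope f p d k1 -> slope f p d k2 -> k1 = k2.
Proof.
move=> [e1 e10 H1] [e2 e20 H2]; pose s := Num.min e1 e2 / 2.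
have m0 : 0 < Num.min e1 e2 by rewrite lt_min e10.
have s0 : 0 < s by rewrite divr_gt0.
have : s < Num.min e1 e2 by rewrite /s; lra.
rewrite lt_min => /andP[s1 s2].
have := H1 s; rewrite H2 ?s0 // s1 => /(_ isT) /addrI /mulIf.
by rewrite gt_eqF // => /(_ isT) /eqP; rewrite eqr_int => /eqP.
Qed.

Lemma outgoing_slopeE f p d k : slope f p d k -> outgoing_slope f p d = k.
Proof.
move=> fk; rewrite /outgoing_slope; case: xgetP => [j _ /near0_right jk|/(_ k)[]].
  exact: slope_uniq fk.
exact/near0_right.
Qed.

(** Purely local form of [rational_function], stable under sums without common refinements of
    partitions. *)
Definition tame f := forall d, pl_on (len d.1) (f \o arc d).

Lemma rational_functionP f : rational_function f <-> tame f.
Proof.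
have K e := pl_onP (f \o arc (e, false)) (len_gt0 e).
split=> [Hf [e b]|Hf e].
  have [s ps Hs] := Hf e.
  have fe : pl_on (len e) (f \o arc (e, false)).
    by apply/K; exists s => //; apply/affine_piecesP.
  case: b => // t b /= Ht.
  have [|k [eps eps0 Hk]] := fe (len e - t) (~~ b).
    by case: b Ht => /andP[? ?]; apply/andP; split; lra.
  exists k, eps => // u Hu.
  have E x : (f \o arc (e, true)) x = (f \o arc (e, false)) (len e - x) by [].
  by rewrite !E -Hk //; congr (_ _); case: b {Hk Ht} => /=; rewrite ?expr0 ?expr1; ring.
have /K[s ps /affine_piecesP Hs] := Hf (e, false).
by exists s.
Qed.

Lemma tame_slope f p d : tame f -> d \in tangent p -> slope f p d (outgoing_slope f p d).
Proof.
move=> Hf dp; suff [k fk] : exists k, slope f p d k by rewrite (outgoing_slopeE fk).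
have [[v E]|[d' [s [Hs _ E]]]] := point_arc p; move: dp; rewrite E.
  rewrite tangent_vertex => /eqP <-.
  have [|k Hk] := Hf d 0 false; first by rewrite lexx len_gt0.
  by exists k; apply/slope_origin.
rewrite tangent_arc // !inE => /orP[]/eqP->; case/andP: Hs => s0 sl.
  have [|k Hk] := Hf d' s false; first by rewrite ltW.
  by exists k; apply/slope_arc => //; rewrite ltW.
have [|k Hk] := Hf d' s true; first by rewrite s0 ltW.
by exists k; apply/slope_arcN => //; rewrite s0 ltW.
Qed.

Lemma arcN_tame f : (forall e, pl_on (len e) (f \o arc (e, false))) -> tame f.
Proof.
move=> H; apply/rational_functionP => e.
by have /(pl_onP _ (len_gt0 e))[s ps /affine_piecesP Hs] := H e; exists s.
Qed.

Lemma slope_tame f :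
  (forall p d, d \in tangent p -> exists k, slope f p d k) -> tame f.
Proof.
move=> H; apply: arcN_tame => e t b; set d := (e, false) => Ht.
case: b Ht => Ht.
  have [|k /slope_arcN Hk] := H (arc d t) (opposite d); last by exists k; exact: Hk.
  case/andP: (Ht) => t0; rewrite le_eqVlt => /orP[/eqP ->|tl].
    by rewrite arc_len tangent_vertex.
  by rewrite tangent_arc ?t0 // !inE eqxx orbT.
have [|k /slope_arc Hk] := H (arc d t) d; last by exists k; exact: Hk.
case/andP: (Ht); rewrite le_eqVlt => /orP[/eqP <- _|t0 tl].
  by rewrite arc0 tangent_vertex.
by rewrite tangent_arc ?t0 // !inE eqxx.
Qed.

Lemma slopeD f1 f2 p d k1 k2 : slope f1 p d k1 -> slope f2 p d k2 ->
  slope (f1 \+ f2) p d (k1 + k2).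
Proof.
move=> [e1 e10 H1] [e2 e20 H2]; exists (Num.min e1 e2); first by rewrite lt_min e10.
by move=> s; rewrite lt_min => /and3P[s0 s1 s2] /=; rewrite H1 ?s0 // H2 ?s0 // intrD; ring.
Qed.

Lemma slopeN f p d k : slope f p d k -> slope (\- f) p d (- k).
Proof. by move=> [e e0 H]; exists e => // s /H /= ->; rewrite intrN; ring. Qed.

Lemma slope_cst (c : R) p d : slope (fun _ => c) p d 0.
Proof. by exists 1 => // s _; rewrite mul0r addr0. Qed.

Lemma tameD f1 f2 : tame f1 -> tame f2 -> tame (f1 \+ f2).
Proof.
by move=> H1 H2; apply: slope_tame => p d dp; eexists; apply: slopeD; apply: tame_slope dp.
Qed.

Lemma tameN f : tame f -> tame (\- f).
Proof. by move=> H1; apply: slope_tame => p d dp; eexists; apply: slopeN; apply: tame_slope dp. Qed.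

Lemma tame_cst (c : R) : tame (fun _ => c).
Proof. by apply: slope_tame => p d dp; eexists; exact: slope_cst. Qed.

Lemma div_coeffE f p (k : direction G -> int) :
  (forall d, d \in tangent p -> slope f p d (k d)) ->
  div_coeff f p = - \sum_(d in tangent p) k d.
Proof. by move=> H; congr (- _); apply: eq_bigr => d /H /outgoing_slopeE. Qed.

Lemma div_coeffD f1 f2 p : tame f1 -> tame f2 ->
  div_coeff (f1 \+ f2) p = div_coeff f1 p + div_coeff f2 p.
Proof.
move=> H1 H2; rewrite -opprD -big_split; apply: div_coeffE => d dp.
by apply: slopeD; exact: tame_slope.
Qed.

Lemma div_coeffN f p : tame f -> div_coeff (\- f) p = - div_coeff f p.
Proof.
move=> H; rewrite /(div_coeff f) -sumrN; apply: div_coeffE => d dp.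
by apply: slopeN; exact: tame_slope.
Qed.

Lemma div_coeff_cst (c : R) p : div_coeff (fun _ => c) p = 0.
Proof. by rewrite (@div_coeffE _ _ (fun=> 0)) ?big1 ?oppr0 // => d _; exact: slope_cst. Qed.

Lemma div_coeff_arc f d s kl kr : 0 < s < len d.1 ->
  germ (f \o arc d) s true kl -> germ (f \o arc d) s false kr ->
  div_coeff f (arc d s) = - (kl + kr).
Proof.
move=> Hs hl hr; have /andP[s0 sl] := Hs.
have ns : d \notin [set opposite d]%SET by rewrite inE eq_sym opposite_neq.
rewrite /div_coeff tangent_arc // big_setU1 //= big_set1 addrC; congr (- (_ + _)).
  by apply/outgoing_slopeE/slope_arcN => //; rewrite s0 ltW.
by apply/outgoing_slopeE/slope_arc => //; rewrite ltW.
Qed.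

Lemma div_coeff_vertex f v :
  div_coeff f (inl v) = - \sum_(d | origin d == v) outgoing_slope f (inl v) d.
Proof. by rewrite /div_coeff; congr (- _); apply: eq_bigl => d; rewrite tangent_vertex. Qed.

(** A [divisor] has finite support by its type, so [div_coeff] must be seen to vanish away from the
    vertices and the breakpoints of finite partitions. Only then can the principal divisor of [f] be
    subtracted from a divisor. *)
Lemma div_coeff_finite f : tame f ->
  exists D : divisor G, forall p, coeff p D = div_coeff f p.
Proof.
move=> Hf.
have /choice[s Hs] : forall e, exists s : seq R,
    itv_partition 0 (len e) s /\ affine_pieces (f \o arc (e, false)) 0 s.
  by move=> e; have /(pl_onP _ (len_gt0 e))[s ? ?] := Hf (e, false); exists s.
pose W : seq (point G) := undup ([seq inl v | v <- enum (vertex G)] ++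
  flatten [seq [seq edge_point e t | t <- s e] | e <- enum (edge G)]).
have W0 p : p \notin W -> div_coeff f p = 0.
  have [[v ->]|[[e b] [t [Ht /= b0 ->]]]] := point_arc p; rewrite mem_undup mem_cat.
    by rewrite map_f ?mem_enum.
  rewrite {}b0 {b} in Ht *; move=> /norP[_ /flattenP nW].
  have {nW}ts : t \notin s e.
    apply/negP => ts; apply: nW; exists [seq edge_point e t | t <- s e].
      by rewrite (map_f (fun e => [seq edge_point e t | t <- s e])) ?mem_enum.
    exact: (map_f (edge_point e)).
  have [[ps /eqP sl] fs] := Hs e.
  suff [k H] : exists k, germ (f \o arc (e, false)) t true (- k) /\
                      germ (f \o arc (e, false)) t false k.
    by case: H => h1 h2; rewrite (div_coeff_arc Ht h1 h2) addNr oppr0.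
  move: ts ps fs Ht; rewrite -sl; move: (s e) (0 : R) => s' a.
  elim: s' a {sl} => [|c s' IH] a /=.
    by move=> _ _ _ /andP[/lt_trans h /h]; rewrite ltxx.
  rewrite inE => /norP[tc ts] /andP[ac pc] [[k [c' H]] fs] /andP[at_ tl].
  have [lc|lc|/eqP] := ltgtP t c; last by rewrite (negPf tc).
    have h1 := affine_germ (t := t) (b := true) H; have h2 := affine_germ (t := t) (b := false) H.
    exists k; split.
      by rewrite -mulN1r -[-1]expr1; apply: h1; rewrite at_ ltW.
    by rewrite -[k]mul1r -[1](expr0 (-1)); apply: h2; rewrite lc ltW.
  by apply: (IH c ts pc fs); rewrite lc.
exists (\sum_(x <- W) << div_coeff f x *g x >>) => p.
rewrite raddf_sum /=; under eq_bigr => x _ do rewrite coeffU.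
have [pW|pW] := boolP (p \in W); last first.
  rewrite W0 // big_seq big1 // => x xW; case: eqP => [xp|_]; last by rewrite mulr0.
  by rewrite xp (negPf pW) in xW.
rewrite (bigD1_seq p) ?undup_uniq //= eqxx mulr1 big1 ?addr0 // => x.
by move=> /negPf ->; rewrite mulr0.
Qed.

End Points.

Section MorePoints.
Variables (R : realType) (G : tropical_curve R).
Implicit Types (d : direction G) (p : point G) (s t : R).

Lemma edge_point_inr x : edge_point (val x).1 (val x).2 = inr x :> point G.
Proof.
rewrite /edge_point; have := valP x; case: insubP => [y _ ey _|/negP//].
have -> : y = x by apply/val_inj; rewrite ey -surjective_pairing.
by []. Qed.

Lemma edge_pointP p : (exists v, p = inl v) \/
  exists e t, [/\ 0 < t < len e & p = edge_point e t].
Proof.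
case: p => [v|x]; [by left; exists v|right].
exists (val x).1, (val x).2; split; [exact: (valP x)|by rewrite edge_point_inr].
Qed.

Lemma edge_point0 e : edge_point e 0 = inl (src e) :> point G.
Proof. exact: (arc0 (e, false)). Qed.

Lemma edge_point_len e : edge_point e (len e) = inl (tgt e) :> point G.
Proof. exact: (arc_len (e, false)). Qed.

Lemma tangentP d p : d \in tangent p <-> exists2 s, 0 <= s < len d.1 & p = arc d s.
Proof.
split=> [|[s]]; last first.
  move=> /andP[]; rewrite le_eqVlt => /orP[/eqP <- _ ->|s0 sl ->].
    by rewrite arc0 tangent_vertex.
  by rewrite tangent_arc ?s0 // !inE eqxx.
have [[v ->]|[d' [s [Hs _ ->]]]] := point_arc p.
  by rewrite tangent_vertex => /eqP <-; exists 0; rewrite ?arc0 // lexx len_gt0.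
rewrite tangent_arc // !inE; case/andP: Hs => s0 sl.
move=> /orP[]/eqP->; first by exists s; rewrite // ltW.
exists (len d'.1 - s); last by rewrite arc_opposite; congr arc; ring.
by apply/andP; split => /=; lra.
Qed.

Definition adjacent (v w : vertex G) :=
  [exists e : edge G, ((src e == v) && (tgt e == w)) || ((src e == w) && (tgt e == v))].

Lemma adjacentP v w :
  reflect (exists2 d, origin d = v & origin (opposite d) = w) (adjacent v w).
Proof.
apply: (iffP existsP) => [[e /orP[]/andP[/eqP <- /eqP <-]]|[[e [] <- <-]]].
- by exists (e, false).
- by exists (e, true).
- by exists e; rewrite /origin /= !eqxx orbT.
- by exists e; rewrite /origin /= !eqxx.
Qed.

Lemma adjacent_connect v w : connect adjacent v w.
Proof. exact: vertex_connected. Qed.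

Lemma curve_ind (P : vertex G -> Prop) v0 : P v0 ->
  (forall d, P (origin d) -> P (origin (opposite d))) -> forall v, P v.
Proof.
move=> P0 IH v; have /connectP[s ps ->] := adjacent_connect v0 v.
elim: s v0 P0 ps => [//|w s IHs] v0 P0 /= /andP[/adjacentP[d d0 dw] ps].
by apply: IHs => //; rewrite -dw; apply: IH; rewrite d0.
Qed.

Lemma vertex_inhabited : exists v : vertex G, True.
Proof. by have /card_gt0P[e _] := edge_neq0 G; exists (src e). Qed.

(** The Euler characteristic: a vector killed by the transpose of [boundary] takes equal values at
    the two ends of every edge, hence is constant by connectedness, so [boundary] has rank one less
    than the number of vertices. *)
Lemma genusE : (genus G + #|vertex G| = #|edge G| + 1)%N.
Proof.
set B := boundary G.
have BE : genus G = (#|edge G| - \rank B)%N by rewrite /genus mxrank_ker.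
have rB : (\rank B <= #|edge G|)%N by exact: rank_leq_row.
suff : (\rank B + 1 = #|vertex G|)%N by lia.
have : (\rank (kermx B^T) = #|vertex G| - \rank B)%N by rewrite mxrank_ker mxrank_tr.
have rB' : (\rank B <= #|vertex G|)%N by exact: rank_leq_col.
suff : \rank (kermx B^T) = 1%N by lia.
pose u : 'rV[R]_#|vertex G| := const_mx 1.
have [v0 _] := vertex_inhabited.
have u0 : u != 0.
  by apply/eqP => /rowP /(_ (enum_rank v0)); rewrite !mxE => /eqP; rewrite oner_eq0.
have uker : (u <= kermx B^T)%MS.
  apply/sub_kermxP/rowP => i; rewrite !mxE.
  under eq_bigr => j _ do rewrite !mxE mul1r.
  rewrite sumrB.
  have S (v : vertex G) : \sum_(j < #|vertex G|) (v == enum_val j)%:R = 1 :> R.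
    rewrite (bigD1 (enum_rank v)) //= enum_rankK eqxx big1 ?addr0 // => j jv.
    by case: eqP => // vj; rewrite vj enum_valK eqxx in jv.
  by rewrite !S subrr.
suff keru : (kermx B^T <= u)%MS.
  have := mxrankS keru; have := mxrankS uker; rewrite !rank_rV u0; lia.
apply/row_subP => i; move: (row i _) (row_sub i (kermx B^T)) => w /sub_kermxP wB.
have wE e : w 0 (enum_rank (tgt e)) = w 0 (enum_rank (src e)).
  have H : (w *m B^T) 0 (enum_rank e) = 0 by rewrite wB mxE.
  rewrite mxE in H.
  have S (v : vertex G) : \sum_(j < #|vertex G|) w 0 j * (v == enum_val j)%:R =
      w 0 (enum_rank v).
    rewrite (bigD1 (enum_rank v)) //= enum_rankK eqxx mulr1 big1 ?addr0 // => j jv.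
    by case: eqP => [vj|]; rewrite ?mulr0 // vj enum_valK eqxx in jv *.
  apply/eqP; rewrite -subr_eq0  -!S -sumrB -[X in _ == X]H; apply/eqP.
  by apply: eq_bigr => j _; rewrite mxE !mxE enum_rankK mulrBr.
have wc v : w 0 (enum_rank v) = w 0 (enum_rank v0).
  apply: (@curve_ind (fun v => w 0 (enum_rank v) = _) v0) => // -[e []] <-;
    by rewrite /origin /= wE.
apply/submxP; exists (w 0 (enum_rank v0))%:M; apply/rowP => j.
by rewrite mul_scalar_mx mxE [u _ _]mxE mulr1 -(wc (enum_val j)) enum_valK.
Qed.

End MorePoints.

(** * Subdivisions *)

Section Isometry.
Variable R : realType.

(* Only what an isometry of metric graphs preserves in divisor theory is recorded. *)
Definition isometry (G H : tropical_curve R) (phi : point G -> point H)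
    (psi : point H -> point G) :=
  [/\ cancel phi psi, cancel psi phi,
      forall f, tame (f \o phi) <-> tame f,
      forall f p, tame f -> div_coeff (f \o phi) p = div_coeff f (phi p) &
      forall p, valence (phi p) = valence p].

Lemma isometry_id (G : tropical_curve R) : isometry (@id (point G)) id.
Proof. by split. Qed.

Lemma isometry_sym (G H : tropical_curve R) (phi : point G -> point H) psi :
  isometry phi psi -> isometry psi phi.
Proof.
move=> [K1 K2 T D V].
have E (f : point G -> R) : (f \o psi) \o phi = f.
  by apply/funext => p /=; rewrite K1.
have T' f : tame (f \o psi) <-> tame f by rewrite -T E.
split=> //.
  by move=> f q /T' Tf; rewrite -{1}[q]K2 -(D (f \o psi)) // E.
by move=> q; rewrite -{2}[q]K2 V.
Qed.

Lemma isometry_comp (G H I : tropical_curve R) (phi : point G -> point H) psi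
    (phi' : point H -> point I) psi' :
  isometry phi psi -> isometry phi' psi' -> isometry (phi' \o phi) (psi \o psi').
Proof.
move=> [K1 K2 T D V] [K1' K2' T' D' V']; split.
- exact: can_comp.
- exact: can_comp.
- by move=> f; rewrite compA T T'.
- by move=> f p Tf; rewrite compA D ?D' // T'.
- by move=> p /=; rewrite V' V.
Qed.

(** Tangent directions correspond and short travel commutes with [phi], so slopes agree, and with
    them tameness, principal divisors and valences. *)
Lemma local_isometry (G H : tropical_curve R) (phi : point G -> point H)
    (psi : point H -> point G) (tau : direction G -> direction H) :
  cancel phi psi -> cancel psi phi ->
  (forall p, {in tangent p &, injective tau}) ->
  (forall p, tau @: tangent p = tangent (phi p))%SET ->
  (forall p d, d \in tangent p -> exists2 eps, 0 < eps & forall s, 0 < s < eps ->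
     phi (travel p d s) = travel (phi p) (tau d) s) ->
  isometry phi psi.
Proof.
move=> K1 K2 inj im loc.
have S f p d k : d \in tangent p -> slope (f \o phi) p d k <-> slope f (phi p) (tau d) k.
  move=> /loc[e e0 He]; split=> -[u u0 Hu]; exists (Num.min u e); rewrite ?lt_min ?u0 //;
    move=> s; rewrite lt_min => /and3P[s0 su se].
    by rewrite -He ?s0 // -Hu ?s0.
  by rewrite /= He ?s0 // Hu ?s0.
have T f : tame (f \o phi) <-> tame f.
  split=> Hf; apply: slope_tame.
    move=> q d; rewrite -[q]K2 -im => /imsetP[d' dp ->].
    by eexists; apply/S => //; exact: tame_slope.
  move=> p d dp; eexists; apply/S => //; apply: tame_slope => //.
  by rewrite -im imset_f.
split=> // [f p Hf|p]; last by rewrite /valence -im card_in_imset.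
rewrite /(div_coeff f) -im big_imset //=; apply: div_coeffE => d dp.
by apply/S => //; apply: tame_slope => //; rewrite -im imset_f.
Qed.

End Isometry.

Section Subdivision.
Variables (R : realType) (G : tropical_curve R) (e0 : edge G) (t0 : R).
Hypothesis t0_int : 0 < t0 < len e0.

(** The edge [e0] is cut at distance [t0]: [Some e0] keeps the part before the cut, the edge [None]
    is the part after it, and the vertex [None] is the new point. *)
Definition sub_src (e : option (edge G)) : option (vertex G) := omap (@src R G) e.
Definition sub_tgt (e : option (edge G)) : option (vertex G) :=
  if e is Some e then if e == e0 then None else Some (tgt e) else Some (tgt e0).
Definition sub_len (e : option (edge G)) : R :=
  if e is Some e then if e == e0 then t0 else len e else len e0 - t0.

Lemma sub_len_gt0 e : 0 < sub_len e.
Proof.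
case/andP: t0_int => a0 al; case: e => [e|] /=; last by rewrite subr_gt0.
by case: eqP => // _; exact: len_gt0.
Qed.

Lemma sub_edge_neq0 : (0 < #|{: option (edge G)}|)%N.
Proof. by rewrite card_option. Qed.

Lemma sub_connected v w :
  connect (fun a b => [exists e, ((sub_src e == a) && (sub_tgt e == b))
                              || ((sub_src e == b) && (sub_tgt e == a))]) v w.
Proof.
set r := (X in connect X).
have rsym : connect_sym r.
  apply: sym_connect_sym => a b; apply: eq_existsb => e; exact: orbC.
have r1 e : r (sub_src e) (sub_tgt e) by apply/existsP; exists e; rewrite !eqxx.
have c1 e : connect r (sub_src e) (sub_tgt e) by exact: connect1.
have Hd d : connect r (Some (origin d)) (Some (origin (opposite d))).
  have H e : connect r (Some (src e)) (Some (tgt e)).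
    have := c1 (Some e) => /=; case: eqP => [->|//] h.
    exact: connect_trans h (c1 None).
  by case: d => e []; rewrite /origin //= rsym.
have HS a b : connect r (Some a) (Some b).
  apply: (@curve_ind _ _ (fun b => connect r (Some a) (Some b)) a) => [|d ad].
    exact: connect0.
  exact: connect_trans ad (Hd d).
have HN a : connect r None (Some a).
  exact: connect_trans (c1 None) (HS _ _).
by case: v w => [a|] [b|] //; rewrite rsym.
Qed.

Definition subdivision : tropical_curve R :=
  TropicalCurve sub_len_gt0 sub_edge_neq0 sub_connected.

Let G' := subdivision.

Definition sub_edge (e : edge G') : edge G := odflt e0 e.
Definition sub_offset (e : edge G') : R := if e is Some _ then 0 else t0.

Definition sub_phi (p : point G') : point G :=
  match p with
  | inl (Some v) => inl v
  | inl None => edge_point e0 t0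
  | inr x => edge_point (sub_edge (val x).1) (sub_offset (val x).1 + (val x).2)
  end.

Definition sub_psi (p : point G) : point G' :=
  match p with
  | inl v => inl (Some v)
  | inr x => if (val x).1 == e0 then
               if (val x).2 < t0 then @edge_point _ G' (Some e0) (val x).2
               else @edge_point _ G' None ((val x).2 - t0)
             else @edge_point _ G' (Some (val x).1) (val x).2
  end.

Lemma sub_phiE (e : edge G') t : 0 <= t <= len e ->
  sub_phi (edge_point e t) = edge_point (sub_edge e) (sub_offset e + t).
Proof.
move=> /andP[]; rewrite le_eqVlt => /orP[/eqP <- _|t1].
  by rewrite edge_point0 addr0; case: e => [e|] //=; rewrite edge_point0.
rewrite le_eqVlt => /orP[/eqP ->|t2].
  rewrite edge_point_len; case: e {t1} => [e|] /=.
    by rewrite add0r; case: eqP => [->|_] //=; rewrite edge_point_len.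
  by rewrite addrC subrK edge_point_len.
have [|x [Ex E1 E2]] := @arc_interior _ G' (e, false) t; first by rewrite t1.
by move: Ex E1 E2; rewrite /arc /= => -> /= -> ->.
Qed.

Lemma sub_psiE (e : edge G) t : 0 <= t <= len e ->
  sub_psi (edge_point e t) =
  if e == e0 then
    if t < t0 then @edge_point _ G' (Some e0) t else @edge_point _ G' None (t - t0)
  else @edge_point _ G' (Some e) t.
Proof.
have /andP[a0 al] := t0_int.
move=> /andP[]; rewrite le_eqVlt => /orP[/eqP <- _|t1].
  by rewrite edge_point0 /= a0 !edge_point0 /=; case: eqP => [->|].
rewrite le_eqVlt => /orP[/eqP ->|t2].
  rewrite edge_point_len /=; case: eqP => [->|/eqP/negPf ne].
    rewrite ltNge ltW //=.
    by have := @edge_point_len _ G' None; rewrite /= => ->.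
  by have := @edge_point_len _ G' (Some e); rewrite /= ne => ->.
have [|x [Ex E1 E2]] := @arc_interior _ G (e, false) t; first by rewrite t1.
by move: Ex E1 E2; rewrite /arc /= => -> /= -> ->.
Qed.

Lemma sub_phiK : cancel sub_phi sub_psi.
Proof.
have /andP[a0 al] := t0_int.
move=> p; have [[[v|] ->]|[[e|] [t [Ht ->]]]] := edge_pointP p => //.
- rewrite /= sub_psiE ?(ltW a0) ?(ltW al) // eqxx ltxx subrr.
  by have := @edge_point0 _ G' None; rewrite /= => ->.
- case/andP: (Ht) => t1 t2.
  rewrite sub_phiE ?(ltW t1) ?(ltW t2) //= add0r; move: t2 => /=.
  case: eqP => [->|/eqP/negPf ne] t2.
    by rewrite sub_psiE ?eqxx ?t2 //; apply/andP; split; lra.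
  by rewrite sub_psiE ?ne //; apply/andP; split; lra.
- case/andP: (Ht) => t1 t2.
  rewrite sub_phiE ?(ltW t1) ?(ltW t2) //=; move: t2 => /= t2.
  rewrite sub_psiE ?eqxx; last by apply/andP; split; lra.
  by rewrite ltNge lerDl ltW //= [_ + t]addrC addrK.
Qed.

Lemma sub_psiK : cancel sub_psi sub_phi.
Proof.
have /andP[a0 al] := t0_int.
move=> p; have [[v ->]|[e [t [Ht ->]]]] := edge_pointP p => //.
case/andP: (Ht) => t1 t2.
rewrite sub_psiE ?(ltW t1) ?(ltW t2) //.
case: eqP => [ee|/eqP/negPf ne].
  rewrite ee in Ht t2 *; case: ltP => tt.
    by rewrite sub_phiE /= ?add0r // ?eqxx ltW //= ltW.
  by rewrite sub_phiE /= ?[t0 + _]addrC ?subrK //; apply/andP; split; lra.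
by rewrite sub_phiE /= ?add0r // ?ne ltW //= ltW.
Qed.

Definition sub_direction (d : direction G') : direction G := (sub_edge d.1, d.2).

(** Distance, in the sense of [d], from the origin of the containing edge to the origin of the
    piece. *)
Definition sub_shift (d : direction G') : R :=
  if d.2 then len (sub_edge d.1) - sub_offset d.1 - len d.1 else sub_offset d.1.

Lemma sub_shift_bounds d : 0 <= sub_shift d /\ sub_shift d + len d.1 <= len (sub_edge d.1).
Proof.
have /andP[a0 al] := t0_int.
by case: d => -[e|] []; rewrite /sub_shift /=; try (case: eqP => [->|_]); split; lra.
Qed.

Lemma sub_phi_arc (d : direction G') s : 0 <= s <= len d.1 ->
  sub_phi (arc d s) = arc (sub_direction d) (sub_shift d + s).
Proof.
move=> /andP[s0 sl]; rewrite /arc sub_phiE; last first.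
  by case: ifP => _; apply/andP; split; lra.
by rewrite /sub_shift /=; case: d.2 => //; congr edge_point; ring.
Qed.

Lemma sub_isometry : isometry sub_phi sub_psi.
Proof.
have /andP[a0 al] := t0_int.
apply: (local_isometry (tau := sub_direction) sub_phiK sub_psiK).
- move=> p [e1 b1] [e2 b2] h1 h2 [E1 E2]; rewrite -{}E2 in h2 *; congr pair.
  have [[v pv]|[d [s [Hs _ ps]]]] := point_arc p; last first.
    have F x : x \in tangent p -> x.1 = d.1.
      by rewrite ps tangent_arc // !inE => /orP[]/eqP->.
    by rewrite [e1](F _ h1) [e2](F _ h2).
  move: h1 h2; rewrite pv !tangent_vertex /origin /= => /eqP h1 /eqP h2.
  have {pv p} h : (if b1 then sub_tgt e1 else sub_src e1) = (if b1 then sub_tgt e2 else sub_src e2).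
    by rewrite [LHS]h1 [RHS]h2.
  by case: e1 e2 E1 {h1 h2} h => [e1|] [e2|] //= E; case: b1; rewrite ?E ?eqxx // -?E ?eqxx.
- move=> p; apply/setP => d; apply/imsetP/idP => [[d' /tangentP[s Hs ->] ->]|].
    have [? ?] := sub_shift_bounds d'; case/andP: Hs => s0 sl.
    rewrite sub_phi_arc ?s0 ?ltW //; apply/tangentP; exists (sub_shift d' + s) => //.
    by apply/andP; split => /=; lra.
  case: d => e b; have [[[v|] ->]|[d' [s [Hs _ ->]]]] := point_arc p.
  + rewrite [sub_phi _]/= tangent_vertex /origin /= => /eqP ev.
    have [ee|ne] := eqVneq e e0.
      exists (if b then None else Some e, b); last by case: b {ev}; rewrite /sub_direction //= ee.
      by rewrite inE /=; case: b ev => /= <- //=; rewrite ee.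
    exists (Some e, b) => //; rewrite inE /= (negPf ne).
    by case: b ev => /= <-.
  + rewrite [sub_phi _]/= (_ : edge_point _ _ = arc (e0, false) t0) // tangent_arc // !inE.
    move=> /orP[]/eqP[-> ->].
      by exists (None, false) => //; rewrite inE.
    by exists (Some e0, true) => //; rewrite inE /= eqxx.
  + have [? ?] := sub_shift_bounds d'; case/andP: (Hs) => s0 sl.
    rewrite sub_phi_arc ?(ltW s0) ?(ltW sl) // tangent_arc ?inE; last first.
      by apply/andP; split => /=; lra.
    move=> /orP[]/eqP ->; [exists d'|exists (opposite d')] => //;
      by rewrite tangent_arc // !inE eqxx ?orbT.
- move=> p d /tangentP[s /andP[s0 sl] ->]; exists (len d.1 - s); first by rewrite subr_gt0.
  have [? ?] := sub_shift_bounds d.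
  move=> u /andP[u0 ul]; rewrite travel_arc ?s0 // !sub_phi_arc; last 2 first.
  + by apply/andP; split; lra.
  + by apply/andP; split; lra.
  by rewrite travel_arc ?addrA //; apply/andP; split => /=; lra.
Qed.

End Subdivision.

(** * Refined models: prescribed points as vertices, no loops *)

Section Models.
Variable R : realType.

Lemma genus_subdivision (G : tropical_curve R) (e0 : edge G) (t0 : R)
  (t0_int : 0 < t0 < len e0) : genus (subdivision t0_int) = genus G.
Proof.
have cV : #|vertex (subdivision t0_int)| = #|vertex G|.+1 by exact: card_option.
have cE : #|edge (subdivision t0_int)| = #|edge G|.+1 by exact: card_option.
by have := genusE (subdivision t0_int); have := genusE G; rewrite cV cE; lia.
Qed.

Definition loop_edges (G : tropical_curve R) := [set e : edge G | src e == tgt e]%SET.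

Lemma loops_subdivision (G : tropical_curve R) (e0 : edge G) (t0 : R)
  (t0_int : 0 < t0 < len e0) :
  loop_edges (subdivision t0_int) = (Some @: (loop_edges G :\ e0))%SET.
Proof.
apply/setP => -[e|]; rewrite !inE /=.
  rewrite mem_imset ?inE; last by move=> ? ? [].
  by have [->|ne] := eqVneq e e0.
by apply/esym/imsetP => -[].
Qed.

(** Vertices remain vertices, so that later refinements keep what earlier ones achieved. *)
Definition refinement (G H : tropical_curve R) (phi : point H -> point G)
    (psi : point G -> point H) :=
  [/\ isometry phi psi, genus H = genus G &
      forall v, exists w, psi (inl v) = inl w].

Lemma refinement_id (G : tropical_curve R) : refinement (@id (point G)) id.
Proof. by split=> [||v]; [exact: isometry_id| |exists v]. Qed.

Lemma refinement_comp (G H I : tropical_curve R) (phi : point H -> point G) psi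
    (phi' : point I -> point H) psi' :
  refinement phi psi -> refinement phi' psi' -> refinement (phi \o phi') (psi' \o psi).
Proof.
move=> [h1 h2 h3] [h1' h2' h3']; split; first exact: isometry_comp.
  by rewrite h2'.
by move=> v; have [w /= ->] := h3 v; exact: h3'.
Qed.

Lemma subdivision_refinement (G : tropical_curve R) (e0 : edge G) (t0 : R)
  (t0_int : 0 < t0 < len e0) :
  refinement (sub_phi (t0_int := t0_int)) (sub_psi t0_int).
Proof.
by split=> [||v]; [exact: sub_isometry|exact: genus_subdivision|exists (Some v)].
Qed.

Lemma refine_at (G : tropical_curve R) (W : seq (point G)) :
  exists (H : tropical_curve R) (phi : point H -> point G) psi,
    refinement phi psi /\ forall p, p \in W -> exists v, psi p = inl v.
Proof.
elim: W => [|p W [H [phi [psi [r HW]]]]].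
  by exists G, id, id; split => //; exact: refinement_id.
have [[v pv]|[e [t [Ht pt]]]] := edge_pointP (psi p).
  exists H, phi, psi; split=> // q; rewrite inE => /orP[/eqP ->|/HW //].
  by exists v.
exists (subdivision Ht), (phi \o sub_phi (t0_int := Ht)), (sub_psi Ht \o psi).
have r' := subdivision_refinement Ht.
split=> [|q]; first exact: refinement_comp.
rewrite inE => /orP[/eqP ->|/HW[v /= ->]]; last by exists (Some v).
exists None => /=; rewrite pt sub_psiE; last by case/andP: (Ht) => *; rewrite !ltW.
by rewrite eqxx ltxx subrr edge_point0.
Qed.

Definition loopless (G : tropical_curve R) :=
  forall d : direction G, origin d != origin (opposite d).

(** Cutting a loop in the middle replaces it by two edges that are not loops, so the number of loops
    decreases. *)
Lemma refine_loopless (G : tropical_curve R) :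
  exists (H : tropical_curve R) (phi : point H -> point G) psi,
    refinement phi psi /\ loopless H.
Proof.
have [n] := ubnP #|loop_edges G|; elim: n G => // n IH G.
have [E|[e0 le0]] := set_0Vmem (loop_edges G).
  move=> _; exists G, id, id; split; first exact: refinement_id.
  move=> [e b]; have : e \notin loop_edges G by rewrite E inE.
  by rewrite inE /origin; case: b => /=; rewrite 1?eq_sym.
have He : 0 < len e0 / 2 < len e0 by have := len_gt0 e0 => ?; apply/andP; split; lra.
move=> cn; have [|H [phi [psi [r lH]]]] := IH (subdivision He).
  rewrite loops_subdivision card_imset; last by move=> ? ? [].
  by move: cn; rewrite (cardsD1 e0) le0; lia.
exists H, (sub_phi (t0_int := He) \o phi), (psi \o sub_psi He).
by split=> //; exact: refinement_comp (subdivision_refinement He) r.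
Qed.

Lemma good_model (G : tropical_curve R) (W : seq (point G)) :
  exists (H : tropical_curve R) (phi : point H -> point G) psi,
    [/\ refinement phi psi, loopless H & forall p, p \in W -> exists v, psi p = inl v].
Proof.
have [H [phi [psi [r HW]]]] := refine_at W.
have [H' [phi' [psi' [r' l']]]] := refine_loopless H.
exists H', (phi \o phi'), (psi' \o psi); split=> //; first exact: refinement_comp.
by move=> p /HW[v /= ->]; case: r' => _ _ H0; exact: H0.
Qed.

End Models.

(** * Linear equivalence *)

Section Divisors.
Variables (R : realType) (G : tropical_curve R).
Implicit Types (D E F : divisor G) (p : point G) (f : point G -> R).

Lemma eq_divisor D E : (forall p, coeff p D = coeff p E) -> D = E.
Proof. by move=> H; apply/eqP/freeg_eqP. Qed.

Lemma coeff_point p q : coeff q (<< p >> : divisor G) = (p == q)%:R.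
Proof. by rewrite coeffU mul1r. Qed.

Lemma effective0 : effective (0 : divisor G).
Proof. by move=> p; rewrite coeff0. Qed.

Lemma effectiveD D E : effective D -> effective E -> effective (D + E).
Proof. by move=> hD hE p; rewrite coeffD addr_ge0. Qed.

Lemma effective_point p : effective (<< p >> : divisor G).
Proof. by move=> q; rewrite coeff_point. Qed.

Lemma effectiveMn D n : effective D -> effective (D *+ n).
Proof. by move=> h p; rewrite coeffMn mulrn_wge0. Qed.

Lemma effective_deg_ge0 D : effective D -> 0 <= deg D.
Proof.
move=> hD; rewrite -(freeg_sumE D) raddf_sum /=.
by apply: sumr_ge0 => x _; rewrite degU.
Qed.

Lemma effective_split D n : effective D -> deg D = n.+1%:Z ->
  exists p E, [/\ effective E, deg E = n%:Z & D = << p >> + E].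
Proof.
move=> hD dD; case: (dom D) (freeg_sumE D) (mem_dom D) => [|p s] DE md.
  by move: dD; rewrite -DE big_nil deg0.
have p1 : 1 <= coeff p D.
  by have := hD p; have := md p; rewrite inE eqxx /= => /esym; lia.
exists p, (D - << p >>); split; last by rewrite addrC subrK.
  move=> q; rewrite coeffB coeff_point; case: eqP => [<-|_]; first by rewrite subr_ge0.
  by rewrite subr0.
by rewrite degB degU dD; lia.
Qed.

Lemma effective_tuple D k : effective D -> deg D = k%:Z ->
  exists q : k.-tuple (point G), D = \sum_(x <- q) << x >>.
Proof.
elim: k D => [|k IH] D hD dD.
  exists [tuple]; rewrite big_nil; apply: fgpos_eq0P => //.
  by apply/fgposP.
have [p [E [hE dE ->]]] := effective_split hD dD.
by have [q ->] := IH _ hE dE; exists [tuple of p :: q]; rewrite big_cons.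
Qed.

Lemma effective_sum (s : seq (point G)) :
  effective (\sum_(x <- s) << x >> : divisor G) /\
  deg (\sum_(x <- s) << x >> : divisor G) = (size s)%:Z.
Proof.
elim: s => [|p s [h1 h2]]; first by rewrite big_nil deg0; split=> //; exact: effective0.
rewrite big_cons degD h2 degU; split; last by rewrite /=; lia.
by apply: effectiveD => //; exact: effective_point.
Qed.

Lemma linear_equivP D E : linearly_equivalent D E <->
  exists2 f, tame f & forall p, coeff p E = coeff p D - div_coeff f p.
Proof.
split=> -[f tf H]; exists f.
- exact/rational_functionP.
- by move=> p; rewrite -H coeffB; ring.
- exact/rational_functionP.
- by move=> p; rewrite coeffB H; ring.
Qed.

Lemma linear_equiv_refl D : linearly_equivalent D D.
Proof.
apply/linear_equivP; exists (fun=> 0); first exact: tame_cst.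
by move=> p; rewrite div_coeff_cst subr0.
Qed.

Lemma linear_equivD D E D' E' : linearly_equivalent D E ->
  linearly_equivalent D' E' -> linearly_equivalent (D + D') (E + E').
Proof.
move=> /linear_equivP[f tf H] /linear_equivP[f' tf' H']; apply/linear_equivP.
exists (f \+ f'); first exact: tameD.
by move=> p; rewrite div_coeffD // !coeffD H H'; ring.
Qed.

Lemma linear_equivN D E : linearly_equivalent D E -> linearly_equivalent (- D) (- E).
Proof.
move=> /linear_equivP[f tf H]; apply/linear_equivP.
exists (\- f); first exact: tameN.
by move=> p; rewrite div_coeffN // !coeffN H; ring.
Qed.

Lemma linear_equiv_sub0 D E : linearly_equivalent D E <-> linearly_equivalent (D - E) 0.
Proof.
split=> H; first by have := linear_equivD H (linear_equiv_refl (- E)); rewrite subrr.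
by have := linear_equivD H (linear_equiv_refl E); rewrite subrK add0r.
Qed.

Lemma linear_equiv_sym D E : linearly_equivalent D E -> linearly_equivalent E D.
Proof.
move=> /(proj1 (linear_equiv_sub0 _ _))/linear_equivN; rewrite opprB oppr0.
by move=> /(proj2 (linear_equiv_sub0 _ _)).
Qed.

Lemma linear_equiv_trans D E F : linearly_equivalent D E -> linearly_equivalent E F ->
  linearly_equivalent D F.
Proof.
move=> H H'; have /(proj1 (linear_equiv_sub0 _ _)) := linear_equivD H H'.
by rewrite opprD addrA addrK => /(proj2 (linear_equiv_sub0 _ _)).
Qed.

Lemma linear_equivMn D E n : linearly_equivalent D E -> linearly_equivalent (D *+ n) (E *+ n).
Proof.
move=> H; elim: n => [|n IH]; first by rewrite !mulr0n; exact: linear_equiv_refl.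
by rewrite !mulrS; exact: linear_equivD.
Qed.

(** In the chip-firing game, the divisors whose debts can be cleared; by [rank_ge0], those of
    nonnegative rank. *)
Definition winnable D := exists2 E, effective E & linearly_equivalent D E.

Lemma effective_winnable D : effective D -> winnable D.
Proof. by move=> h; exists D => //; exact: linear_equiv_refl. Qed.

Lemma winnable_equiv D E : linearly_equivalent D E -> winnable D -> winnable E.
Proof.
move=> DE [F hF DF]; exists F => //; apply: linear_equiv_trans DF.
exact: linear_equiv_sym.
Qed.

Lemma winnableD D E : winnable D -> winnable E -> winnable (D + E).
Proof.
by move=> [D' h1 h2] [E' h1' h2']; exists (D' + E'); [exact: effectiveD|exact: linear_equivD].
Qed.

Lemma winnableMn D n : winnable D -> winnable (D *+ n).
Proof.
by move=> [D' h1 h2]; exists (D' *+ n); [exact: effectiveMn|exact: linear_equivMn].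
Qed.

Lemma coeff_canonical p : coeff p (canonical_divisor G) = (valence p)%:Z - 2.
Proof.
rewrite /canonical_divisor raddf_sum /=.
under eq_bigr => v _ do rewrite coeffU.
have [[v ->]|[d [s [Hs _ ->]]]] := point_arc p.
  rewrite (bigD1 v) //= eqxx mulr1 big1 ?addr0 // => w wv.
  by rewrite (inj_eq (@inl_inj _ _)) (negPf wv) mulr0.
have [x [Ex _ _]] := arc_interior Hs.
rewrite [X in _ = X - 2](_ : _ = 2) ?subrr; last first.
  by rewrite /valence tangent_arc // cards2 eq_sym opposite_neq.
by rewrite Ex big1 // => v _; rewrite mulr0.
Qed.
End Divisors.

Section Transport.
Variables (R : realType) (G H : tropical_curve R).
Variables (phi : point H -> point G) (psi : point G -> point H).
Hypothesis iso : isometry phi psi.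
Implicit Types D E : divisor G.

Definition transport D : divisor H := \sum_(x <- dom D) << coeff x D *g psi x >>.

Lemma coeff_transport D p : coeff p (transport D) = coeff (phi p) D.
Proof.
have [K1 K2 _ _ _] := iso.
rewrite /transport raddf_sum /=; under eq_bigr => x _ do rewrite coeffU.
have [pD|pD] := boolP (phi p \in dom D); last first.
  rewrite (coeff_outdom pD) big_seq big1 // => x xD; case: eqP => [E|_]; last by rewrite mulr0.
  by rewrite -E K2 xD in pD.
rewrite (bigD1_seq (phi p)) ?uniq_dom //= K1 eqxx mulr1 big1 ?addr0 // => x xp.
by case: eqP => [E|_]; rewrite ?mulr0 //; rewrite -E K2 eqxx in xp.
Qed.

Lemma deg_transport D : deg (transport D) = deg D.
Proof.
rewrite /transport -[in RHS](freeg_sumE D) !raddf_sum /=.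
by apply: eq_bigr => x _; rewrite !degU.
Qed.

Lemma transportD D E : transport (D + E) = transport D + transport E.
Proof. by apply/eq_divisor => p; rewrite coeffD !coeff_transport coeffD. Qed.

Lemma transportN D : transport (- D) = - transport D.
Proof. by apply/eq_divisor => p; rewrite coeffN !coeff_transport coeffN. Qed.

Lemma transport_canonical : transport (canonical_divisor G) = canonical_divisor H.
Proof.
have [_ _ _ _ V] := iso.
by apply/eq_divisor => p; rewrite coeff_transport !coeff_canonical V.
Qed.

Lemma effective_transport D : effective (transport D) <-> effective D.
Proof.
have [_ K2 _ _ _] := iso.
split=> h p; last by rewrite coeff_transport.
by rewrite -[p]K2 -coeff_transport.
Qed.

Lemma linear_equiv_transport D E :
  linearly_equivalent D E -> linearly_equivalent (transport D) (transport E).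
Proof.
have [_ _ T V _] := iso.
move=> /linear_equivP[f tf Hf]; apply/linear_equivP; exists (f \o phi); first exact/T.
by move=> p; rewrite !coeff_transport V.
Qed.

Lemma winnable_transport D : winnable D -> winnable (transport D).
Proof.
move=> [E hE DE]; exists (transport E); first exact/effective_transport.
exact: linear_equiv_transport.
Qed.

End Transport.

Lemma transportK (R : realType) (G H : tropical_curve R) (phi : point H -> point G)
  (psi : point G -> point H) : isometry phi psi ->
  cancel (transport psi) (transport phi).
Proof.
move=> iso D; apply/eq_divisor => p.
have [_ K2 _ _ _] := iso.
by rewrite (coeff_transport (isometry_sym iso)) (coeff_transport iso) K2.
Qed.

(** * Slopes at vertices and invariance of the degree *)

Section Degree.
Variable R : realType.

Definition vertex_supported (G : tropical_curve R) (D : divisor G) :=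
  forall p, coeff p D != 0 -> exists v, p = inl v.

Lemma vertex_model (G : tropical_curve R) (D : divisor G) (W : seq (point G)) :
  exists (H : tropical_curve R) (phi : point H -> point G) psi,
    [/\ refinement phi psi, loopless H, vertex_supported (transport psi D) &
        forall p, p \in W -> exists v, psi p = inl v].
Proof.
have [H [phi [psi [r lH HW]]]] := good_model (dom D ++ W).
exists H, phi, psi; split=> //; last by move=> p pW; apply: HW; rewrite mem_cat pW orbT.
move=> p; have [iso _ _] := r; have [K1 _ _ _ _] := iso.
rewrite (coeff_transport iso) -mem_dom => pD.
by have [|v] := HW (phi p); [rewrite mem_cat pD|rewrite K1 => ->; exists v].
Qed.

Section Curve.
Variable G : tropical_curve R.
Implicit Types (D E : divisor G) (f : point G -> R) (d : direction G).

Lemma vertex_supported_arc D d s : vertex_supported D -> 0 < s < len d.1 ->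
  coeff (arc d s) D = 0.
Proof.
move=> sD Hs; apply/eqP/negPn/negP => /sD[v].
by have [x [-> _ _]] := arc_interior Hs.
Qed.

Lemma deg_vertex_supported D : vertex_supported D ->
  deg D = \sum_(v : vertex G) coeff (inl v) D.
Proof.
move=> sD; have {1}-> : D = \sum_v << coeff (inl v) D *g inl v >>.
  apply/eq_divisor => p; rewrite raddf_sum /=; under eq_bigr => v _ do rewrite coeffU.
  have [[v ->]|[d [s [Hs _ ->]]]] := point_arc p.
    rewrite (bigD1 v) //= eqxx mulr1 big1 ?addr0 // => w wv.
    by rewrite (inj_eq (@inl_inj _ _)) (negPf wv) mulr0.
  rewrite vertex_supported_arc //; have [x [-> _ _]] := arc_interior Hs.
  by rewrite big1 // => v _; rewrite mulr0.
by rewrite raddf_sum /=; apply: eq_bigr => v _; rewrite degU.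
Qed.

Definition initial_slope f d := outgoing_slope f (inl (origin d)) d.

Lemma initial_slopeP f d : tame f -> germ (f \o arc d) 0 false (initial_slope f d).
Proof.
by move=> tf; apply/slope_origin; apply: tame_slope => //; rewrite tangent_vertex.
Qed.

Lemma initial_slopeE f d k : germ (f \o arc d) 0 false k -> initial_slope f d = k.
Proof. by move/slope_origin/outgoing_slopeE. Qed.

Lemma initial_slopeN f d : tame f -> initial_slope (\- f) d = - initial_slope f d.
Proof. by move=> tf; apply: initial_slopeE; exact: germN (initial_slopeP d tf). Qed.

Lemma div_coeff_initial f v :
  div_coeff f (inl v) = - \sum_(d | origin d == v) initial_slope f d.
Proof.
by rewrite div_coeff_vertex; congr (- _); apply: eq_bigr => d /eqP <-.
Qed.

Lemma edge_convex f d : tame f ->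
  (forall s, 0 < s < len d.1 -> div_coeff f (arc d s) <= 0) ->
  convex_on (len d.1) (f \o arc d).
Proof.
by move=> tf H s kl kr Hs hl hr; rewrite -oppr_le0 -(div_coeff_arc Hs hl hr) H.
Qed.

(** A nonpositive divisor inside the edge means convexity there, and a convex function lies above
    its initial tangent. *)
Lemma edge_tangent f d : tame f ->
  (forall s, 0 < s < len d.1 -> div_coeff f (arc d s) <= 0) ->
  forall s, 0 <= s <= len d.1 ->
  f (inl (origin d)) + (initial_slope f d)%:~R * s <= f (arc d s).
Proof.
move=> tf H s Hs; rewrite -arc0.
exact: (convex_tangent0 (tf d) (edge_convex tf H) (initial_slopeP d tf)).
Qed.

(** Both [f] and its negative are convex along the edge. *)
Lemma edge_affine f d : tame f ->
  (forall s, 0 < s < len d.1 -> div_coeff f (arc d s) = 0) ->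
  forall s, 0 <= s <= len d.1 ->
  f (arc d s) = f (inl (origin d)) + (initial_slope f d)%:~R * s.
Proof.
move=> tf H s Hs; apply/eqP; rewrite eq_le edge_tangent ?andbT //; last first.
  by move=> u Hu; rewrite H.
have : (\- f) (inl (origin d)) + (initial_slope (\- f) d)%:~R * s <= (\- f) (arc d s).
  apply: edge_tangent => //; first exact: tameN.
  by move=> u Hu; rewrite div_coeffN // H // oppr0.
by rewrite initial_slopeN // intrN /=; lra.
Qed.

Lemma edge_slope_opposite f d : tame f ->
  (forall s, 0 < s < len d.1 -> div_coeff f (arc d s) = 0) ->
  initial_slope f (opposite d) = - initial_slope f d.
Proof.
move=> tf H; have L0 := len_gt0 d.1.
have := edge_affine tf H (s := len d.1); rewrite lexx ltW // arc_len => /(_ isT) E1.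
have := @edge_affine f (opposite d) tf _ (len d.1).
rewrite /= lexx ltW // arc_opposite subrr arc0 E1 => E2.
have /eqP : ((initial_slope f d)%:~R + (initial_slope f (opposite d))%:~R) * len d.1 = 0.
  apply: (addrI (f (inl (origin d)))); rewrite addr0 [RHS]E2 //; first by ring.
  move=> s /andP[s0 sl]; rewrite arc_opposite H //=; apply/andP; split; lra.
by rewrite mulf_eq0 [len _ == 0]gt_eqF // orbF -intrD intr_eq0 addrC addr_eq0 => /eqP.
Qed.

Lemma sum_origin (F : direction G -> int) (P : pred (vertex G)) :
  \sum_(v | P v) \sum_(d | origin d == v) F d = \sum_(d | P (origin d)) F d.
Proof.
rewrite [RHS](partition_big (@origin _ _) P) //=; apply: eq_bigr => v Pv.
by apply: eq_bigl => d; case: eqP => [->|_]; rewrite ?Pv ?andbF.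
Qed.

Lemma sum_direction (F : direction G -> int) :
  \sum_d F d = \sum_(e : edge G) (F (e, false) + F (e, true)).
Proof.
under [RHS]eq_bigr => e _ do rewrite addrC -(big_bool _ (fun b => F (e, b))).
by rewrite pair_bigA; apply: eq_bigr => -[].
Qed.

(** On each edge [f] is affine, so the outgoing slopes at its two ends cancel in the sum over all
    directions. *)
Lemma deg_div_vertex f D : tame f -> vertex_supported D ->
  (forall p, coeff p D = div_coeff f p) -> deg D = 0.
Proof.
move=> tf sD Df; rewrite deg_vertex_supported //.
under eq_bigr => v _ do rewrite Df div_coeff_initial.
rewrite sumrN sum_origin sum_direction big1 ?oppr0 // => e _.
rewrite -[(e, true)]/(opposite (e, false)) edge_slope_opposite ?subrr // => s Hs.
by rewrite -Df vertex_supported_arc.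
Qed.

End Curve.

Lemma deg_linear_equiv (G : tropical_curve R) (D E : divisor G) :
  linearly_equivalent D E -> deg D = deg E.
Proof.
move=> [f /rational_functionP tf Df]; apply/eqP; rewrite -subr_eq0 -degB.
have [H [phi [psi [[iso _ _] _ sD _]]]] := vertex_model (D - E) [::].
have [_ _ T V _] := iso.
rewrite -(deg_transport psi (D - E)).
rewrite (deg_div_vertex (f := f \o phi) _ sD) //; first exact/T.
by move=> p; rewrite (coeff_transport iso) Df V.
Qed.

Lemma winnable_deg_ge0 (G : tropical_curve R) (D : divisor G) : winnable D -> 0 <= deg D.
Proof. by move=> [E hE /deg_linear_equiv ->]; exact: effective_deg_ge0. Qed.

Lemma winnable_deg0 (G : tropical_curve R) (D : divisor G) :
  winnable D -> deg D = 0 -> linearly_equivalent D 0.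
Proof.
move=> [E hE DE]; rewrite (deg_linear_equiv DE) => dE.
suff <- : E = 0 by [].
by apply: fgpos_eq0P => //; apply/fgposP.
Qed.

Lemma deg_canonical (G : tropical_curve R) :
  deg (canonical_divisor G) = 2 * (genus G)%:Z - 2.
Proof.
rewrite /canonical_divisor raddf_sum /=; under eq_bigr => v _ do rewrite degU.
rewrite sumrB sumr_const.
have -> : \sum_v (valence (inl v : point G))%:Z = \sum_(d : direction G) 1.
  rewrite -(sum_origin (fun=> 1) predT); apply: eq_bigr => v _.
  by rewrite /valence -sum1_card raddf_sum; apply: eq_bigl => d; rewrite tangent_vertex.
rewrite sum_direction sumr_const; have := genusE G.
by rewrite -!cardsT /= => H; rewrite -!(mulr_natr 2); lia.
Qed.

End Degree.

(** * Rank *)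

Section Rank.
Variables (R : realType) (G : tropical_curve R).
Implicit Types (D E F : divisor G) (p : point G).

Definition rank_at_least D (k : nat) :=
  forall E, effective E -> deg E = k%:Z -> winnable (D - E).

Lemma rank_at_leastS D k : rank_at_least D k.+1 -> rank_at_least D k.
Proof.
move=> H E hE dE; have [v _] := vertex_inhabited G; pose p : point G := inl v.
have [||F hF DF] := H (E + << p >>).
- by apply: effectiveD => //; exact: effective_point.
- by rewrite degD dE degU; lia.
have -> : D - E = (D - (E + << p >>)) + << p >> by rewrite opprD addrA subrK.
by apply: winnableD; [exists F|apply: effective_winnable; exact: effective_point].
Qed.

Lemma rank_at_least_le D k l : (k <= l)%N -> rank_at_least D l -> rank_at_least D k.
Proof.
move=> /subnK <-; elim: (l - k)%N => [//|n IH].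
by rewrite addSn => /rank_at_leastS.
Qed.

Lemma rank_at_least_deg D k : rank_at_least D k -> k%:Z <= deg D.
Proof.
move=> H; have [v _] := vertex_inhabited G; pose p : point G := inl v.
have := winnable_deg_ge0 (H (<< p >> *+ k) _ _); rewrite degB degMn degU.
rewrite natz subr_ge0; apply => //.
by apply: effectiveMn; exact: effective_point.
Qed.

Lemma rank_valuesP D (z : int) :
  rank_values D z <-> z = -1 \/ exists2 k, rank_at_least D k & z = k%:Z.
Proof.
split=> [[->|[k H <-]]|[->|[k H ->]]]; [by left| right|by left|right].
- exists k => // E hE dE; have [q ->] := effective_tuple hE dE.
  by have [F hF DF] := H q; exists F.
- exists k => // q; have [h1 h2] := effective_sum q.
  by have [|F hF DF] := H _ h1; [rewrite h2 size_tuple|exists F].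
Qed.

(** The degree bounds the [k] with [rank_at_least D k], so a maximum exists and the [xget] in [rank]
    does not fall back on its default. *)
Lemma rankP D (k : nat) : k%:Z <= rank D <-> rank_at_least D k.
Proof.
have [r [Vr Ur]] : exists r, (rank_values D `&` ubound (rank_values D)) r.
  have [H0|H0] := pselect (rank_at_least D 0); last first.
    exists (-1); split; first by apply/rank_valuesP; left.
    move=> z /rank_valuesP[-> //|[i Hi _]].
    by case: H0; exact: rank_at_least_le (leq0n i) Hi.
  pose P j := `[< rank_at_least D j >].
  have exP : exists j, P j by exists 0%N; apply/asboolP.
  have ubP j : P j -> (j <= absz (deg D))%N.
    by move=> /asboolP/rank_at_least_deg; lia.
  have [j /asboolP Hj jmax] := ex_maxnP exP ubP.
  exists j%:Z; split; first by apply/rank_valuesP; right; exists j.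
  move=> z /rank_valuesP[->|[i Hi ->]]; first by lia.
  by rewrite lez_nat; apply: jmax; apply/asboolP.
have [Vm Um] : (rank_values D `&` ubound (rank_values D)) (rank D).
  by rewrite /rank; case: xgetP => [x _ //|/(_ r)[]].
split=> [kr|H]; last by apply: Um; apply/rank_valuesP; right; exists k.
have /rank_valuesP[rE|[l Hl rE]] := Vm; first by rewrite rE in kr.
by apply: rank_at_least_le Hl; rewrite rE lez_nat in kr.
Qed.

Lemma rank_geN1 D : -1 <= rank D.
Proof.
rewrite /rank; case: xgetP => [x -> [_]|_] //.
by apply; apply/rank_valuesP; left.
Qed.

Lemma rank_ge0 D : 0 <= rank D <-> winnable D.
Proof.
rewrite (rankP D 0); split=> [H|h E hE dE].
  by have := H 0 (@effective0 _ _) (deg0 _); rewrite subr0.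
suff -> : E = 0 by rewrite subr0.
by apply: fgpos_eq0P => //; apply/fgposP.
Qed.

Lemma rank_equiv D E : linearly_equivalent D E -> rank D = rank E.
Proof.
have H D' E' k : linearly_equivalent D' E' -> rank_at_least D' k -> rank_at_least E' k.
  move=> DE Hk F hF dF; apply: winnable_equiv (Hk F hF dF).
  by apply: linear_equivD => //; exact: linear_equiv_refl.
have L D' E' : linearly_equivalent D' E' -> rank D' <= rank E'.
  move=> DE; have := rank_geN1 E'; case: (rank D') (fun k => proj1 (rankP D' k)) => [k|n _].
    by move=> /(_ k (lexx _)) Hk _; apply/rankP; exact: H Hk.
  by apply: le_trans; rewrite NegzE; lia.
by move=> DE; apply/eqP; rewrite eq_le !L //; exact: linear_equiv_sym.
Qed.

(** An effective divisor of degree [k + l] splits into effective parts of degrees [k] and [l], each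
    removed from one summand. *)
Lemma rankD D E : 0 <= rank D -> 0 <= rank E -> rank D + rank E <= rank (D + E).
Proof.
case DE : (rank D) (rankP D) => [k|//] /(_ k) [/(_ (lexx _)) Hk _] _.
case EE : (rank E) (rankP E) => [l|//] /(_ l) [/(_ (lexx _)) Hl _] _.
rewrite -PoszD; apply/rankP => F hF dF.
have [F1 [F2 [h1 h2 d1 d2 ->]]] : exists F1 F2 : divisor G,
    [/\ effective F1, effective F2, deg F1 = k%:Z, deg F2 = l%:Z & F = F1 + F2].
  elim: k F hF dF {DE Hk EE Hl} => [|k IH] F hF dF.
    exists 0, F; split => //; [exact: effective0|exact: deg0|by rewrite add0r].
  have [p [F' [hF' dF' ->]]] := effective_split hF dF.
  have [F1 [F2 [h1 h2 d1 d2 ->]]] := IH _ hF' dF'.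
  exists (<< p >> + F1), F2; split=> //; last by rewrite addrA.
    by apply: effectiveD => //; exact: effective_point.
  by rewrite degD degU d1; lia.
have -> : D + E - (F1 + F2) = (D - F1) + (E - F2) by rewrite opprD addrACA.
by apply: winnableD; [exact: Hk|exact: Hl].
Qed.

Lemma rank_le_deg D : rank D <= Num.max (-1) (deg D).
Proof.
rewrite le_max; case rD : (rank D) (rank_geN1 D) (rankP D) => [k|n] N H.
  by have [/(_ (lexx _))/rank_at_least_deg -> _] := H k; rewrite orbT.
by rewrite NegzE; apply/orP; left; lia.
Qed.

Lemma rank_deg_lt0 D : deg D < 0 -> rank D = -1.
Proof. by have := rank_geN1 D; have := rank_le_deg D; case: ltP; lia. Qed.

Lemma rank_sub_point D p : rank D - 1 <= rank (D - << p >>).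
Proof.
have := rank_geN1 (D - << p >>); case rD : (rank D) (rankP D) => [[|k]|n] H.
- by lia.
- move=> _; have [/(_ (lexx _)) Hk _] := H k.+1.
  suff : k%:Z <= rank (D - << p >>) by lia.
  apply/rankP => E hE dE; rewrite -addrA -opprD; apply: Hk.
    by apply: effectiveD => //; exact: effective_point.
  by rewrite degD degU dE; lia.
- by rewrite NegzE; lia.
Qed.

Lemma rank_sub_point_le D p : rank (D - << p >>) <= rank D.
Proof.
case rD : (rank (D - << p >>)) (rankP (D - << p >>)) => [k|n] H.
  have [/(_ (lexx _)) Hk _] := H k; apply/rankP => E hE dE.
  rewrite -[D](subrK << p >>) addrAC; apply: winnableD; first exact: Hk.
  by apply: effective_winnable; exact: effective_point.
by have := rank_geN1 D; rewrite NegzE; lia.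
Qed.

Lemma rank_at_leastPn D k : ~ rank_at_least D k ->
  exists E, [/\ effective E, deg E = k%:Z & ~ winnable (D - E)].
Proof.
move=> H; apply: contrapT => nE; apply: H => E hE dE; apply: contrapT => nw.
by apply: nE; exists E.
Qed.

(* The divisors of degree [g - 1] attached to acyclic orientations are such
   moderators: [nu] and [K - nu] correspond to opposite orientations. *)
Definition moderator (nu : divisor G) :=
  [/\ deg nu = (genus G)%:Z - 1, ~ winnable nu & ~ winnable (canonical_divisor G - nu)].

Hypothesis dichotomy : forall D, winnable D \/
  exists2 nu, moderator nu & winnable (nu - D).

(** Some effective [E] of degree one more than the rank of [K - D] makes [K - D - E] unwinnable, so
    a moderator [nu] exceeds it, up to equivalence, by an effective [E']. Were [D - E'] winnable, so
    would be [K - nu], which is equivalent to [D - E' + E]; hence the rank of [D] is below the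
    degree of [E']. *)
Lemma riemann_roch_le D :
  rank D <= rank (canonical_divisor G - D) + deg D - (genus G)%:Z + 1.
Proof.
set K := canonical_divisor G; set g := genus G.
have r1 := rank_geN1 (K - D).
have [k rk] : exists k : nat, rank (K - D) + 1 = k%:Z.
  by exists (absz (rank (K - D) + 1)); lia.
have [|E [hE dE nE]] := @rank_at_leastPn (K - D) k; first by move=> /rankP; lia.
have [//|[nu [dnu nnu nKnu] [E' hE' nE']]] := dichotomy (K - D - E).
have dE' : deg E' = deg D - g%:Z + 1 + k%:Z.
  by rewrite -(deg_linear_equiv nE') !degB dnu dE deg_canonical -/g; lia.
have E'0 := effective_deg_ge0 hE'.
rewrite leNgt; apply/negP => lt.
have /rankP/(_ _ hE') : (absz (deg E'))%:Z <= rank D by lia.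
move=> /(_ ltac:(lia)) wDE'; apply: nKnu.
rewrite -[K - nu](subrK E); apply: winnableD; last exact: effective_winnable.
apply: winnable_equiv wDE'.
have -> : K - nu - E = D - (nu - (K - D - E)).
  by apply/eq_divisor => q; rewrite !(coeffD, coeffN, coeffB); ring.
apply: linear_equivD; first exact: linear_equiv_refl.
exact/linear_equivN/linear_equiv_sym.
Qed.

(** The inequalities for [D] and for [K - D] are opposite, because [K] has degree [2 g - 2]. *)
Lemma riemann_roch_of_dichotomy D :
  rank D = rank (canonical_divisor G - D) + deg D - (genus G)%:Z + 1.
Proof.
have h1 := riemann_roch_le D; have := riemann_roch_le (canonical_divisor G - D).
by rewrite subKr degB deg_canonical; lia.
Qed.

End Rank.

(** * Reduced divisors *)

Section Convex.
Variable R : realType.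
Implicit Types (g : R -> R) (k : int).

(** Convexity is phrased through one-sided slopes because minus their sum is the coefficient of the
    principal divisor at an interior point of an edge. *)
Definition pl_convex g := piecewise_linear g /\
  forall t kl kr, germ g t true kl -> germ g t false kr -> 0 <= kl + kr.

Lemma pl_convex_affine k (c : R) : pl_convex (fun s => k%:~R * s + c).
Proof.
split=> [t b|t kl kr /germ_uniq hl /germ_uniq hr].
  by exists ((-1) ^+ b * k); exact: germ_affine.
by rewrite (hl _ (germ_affine _ _ _ _)) (hr _ (germ_affine _ _ _ _)) expr1 expr0; lia.
Qed.

Lemma pl_convex_cst (c : R) : pl_convex (fun=> c).
Proof.
have -> : (fun=> c) = (fun s => 0%:~R * s + c) by apply/funext => s; rewrite mul0r add0r.
exact: pl_convex_affine.
Qed.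

Lemma germ_le_max g1 g2 t b k1 k : g2 t <= g1 t ->
  germ g1 t b k1 -> germ (fun s => Num.max (g1 s) (g2 s)) t b k -> k1 <= k.
Proof.
move=> h h1 h2; apply: germ_le h1 h2 _ _; first by rewrite (max_idPl h).
by exists 1 => // s _; rewrite le_max lexx.
Qed.

Lemma pl_convex_max g1 g2 : pl_convex g1 -> pl_convex g2 ->
  pl_convex (fun s => Num.max (g1 s) (g2 s)).
Proof.
move=> [p1 c1] [p2 c2]; split=> [t b|t kl kr].
  by have [k1 h1] := p1 t b; have [k2 h2] := p2 t b; exact: germ_max h1 h2.
wlog h : g1 g2 p1 c1 p2 c2 / g2 t <= g1 t.
  move=> W; case: (leP (g2 t) (g1 t)) => [h|/ltW h]; first exact: W.
  have -> : (fun s => Num.max (g1 s) (g2 s)) = (fun s => Num.max (g2 s) (g1 s)).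
    by apply/funext => s; rewrite maxC.
  exact: W.
have [k1 h1] := p1 t true; have [k2 h2] := p1 t false.
move=> /(germ_le_max h h1) l1 /(germ_le_max h h2) l2.
by have := c1 _ _ _ h1 h2; lia.
Qed.

End Convex.

Section Gluing.
Variables (R : realType) (G : tropical_curve R).
Implicit Types (d : direction G) (f : point G -> R).

(** Each edge is described twice, once per direction, so the two descriptions must agree under
    reversal; tents can then be written uniformly from either end. *)
Lemma gluing (a : vertex G -> R) (g : direction G -> R -> R) :
  (forall d s, g (opposite d) s = g d (len d.1 - s)) ->
  (forall d, g d 0 = a (origin d)) ->
  exists f, (forall v, f (inl v) = a v) /\
    forall d s, 0 <= s <= len d.1 -> f (arc d s) = g d s.
Proof.
move=> gopp g0.
pose f (p : point G) := match p with
  | inl v => a v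
  | inr x => g ((val x).1, false) (val x).2
  end.
exists f; split=> // d s /andP[]; rewrite le_eqVlt => /orP[/eqP <- _|s0].
  by rewrite arc0 /= g0.
rewrite le_eqVlt => /orP[/eqP ->|sl].
  by rewrite arc_len /= -g0 gopp subr0.
have [|x [-> E1 E2]] := @arc_interior _ _ d s; first by rewrite s0.
rewrite /f E1 E2; case: d {s0 sl E1 E2} => e [] //=.
by rewrite -[(e, false)]/(opposite (e, true)) gopp /=; congr g; ring.
Qed.

Section Glued.
Variables (f : point G -> R) (g : direction G -> R -> R).
Hypothesis fg : forall d s, 0 <= s <= len d.1 -> f (arc d s) = g d s.

Lemma glued_germ d t b k : (if b then 0 < t <= len d.1 else 0 <= t < len d.1) ->
  germ (g d) t b k -> germ (f \o arc d) t b k.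
Proof.
move=> Ht; apply: (@eq_germ _ _ _ _ _ _ (if b then t else len d.1 - t)).
  by case: b Ht => /andP[? ?]; rewrite ?subr_gt0.
move=> s Hs; rewrite /= fg //.
by case: b Ht Hs => /andP[? ?] /andP[? ?]; rewrite ?expr1 ?expr0; apply/andP; split; lra.
Qed.

Lemma glued_tame : (forall d, piecewise_linear (g d)) -> tame f.
Proof.
by move=> gpl d t b Ht; have [k hk] := gpl d t b; exists k; exact: glued_germ.
Qed.

Lemma glued_initial_slope d k : germ (g d) 0 false k -> initial_slope f d = k.
Proof.
by move=> h; apply: initial_slopeE; apply: glued_germ => //; rewrite lexx len_gt0.
Qed.

Lemma glued_div_le0 d s : (forall d, pl_convex (g d)) -> 0 < s < len d.1 ->
  div_coeff f (arc d s) <= 0.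
Proof.
move=> gc Hs; have [gpl cvx] := gc d; have /andP[s0 sl] := Hs.
have [kl hl] := gpl s true; have [kr hr] := gpl s false.
rewrite (div_coeff_arc Hs (kl := kl) (kr := kr)); first by rewrite oppr_le0 (cvx s).
  by apply: glued_germ => //; rewrite s0 ltW.
by apply: glued_germ => //; rewrite sl ltW.
Qed.

End Glued.

Lemma initial_slope_ge0 f d : tame f ->
  (forall s, 0 < s < len d.1 -> f (inl (origin d)) <= f (arc d s)) ->
  0 <= initial_slope f d.
Proof.
move=> tf H; have h0 := germ_affine 0 (f (inl (origin d))) 0 false.
rewrite mulr0 in h0; apply: germ_le h0 (initial_slopeP d tf) _ _.
  by rewrite /= mul0r add0r arc0.
exists (len d.1); first exact: len_gt0.
by move=> s Hs; rewrite mul0r !add0r expr0 mul1r /=; exact: H.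
Qed.

End Gluing.

(** * Multiples of one point dominate every divisor *)

Section Domination.
Variable R : realType.

(* Fire a tent centred at [u], of height [len d0.1]: its slope is [1] along [d0] and
   steep enough on the other edges for it to vanish before their far end. *)
Lemma adjacent_dominates (G : tropical_curve R) (d0 : direction G) : loopless G ->
  exists m, winnable ((<< inl (origin d0) >> : divisor G) *+ m - << inl (origin (opposite d0)) >>).
Proof.
move=> ll; set u := origin d0; set w := origin (opposite d0).
have uw : u != w := ll d0.
set L := len d0.1; have L0 : 0 < L := len_gt0 _.
(* One integer slope steep enough to descend from height [L] to 0 within every edge. *)
have [N HN] : exists N : nat, forall d : direction G, L <= N%:R * len d.1.
  have /choice[N HN] : forall d : direction G, exists N : nat, L <= N%:R * len d.1.
    move=> d; exists (Num.truncn (L / len d.1)).+1.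
    by rewrite -ler_pdivrMr ?len_gt0 // ltW // truncnS_gt.
  exists (\max_d N d) => d; apply: le_trans (HN d) _.
  by apply: ler_wpM2r; [exact/ltW/len_gt0|rewrite ler_nat leq_bigmax].
pose n (d : direction G) : int := if d.1 == d0.1 then 1 else N%:Z.
have nopp d : n (opposite d) = n d by [].
have Ln d : L <= (n d)%:~R * len d.1.
  by rewrite /n; case: eqP => [->|_]; rewrite ?mul1r // HN.
pose a v := if v == u then L else 0.
pose g d : R -> R :=
  if origin d == u then fun s => Num.max 0 ((- n d)%:~R * s + L)
  else if origin (opposite d) == u then
    fun s => Num.max 0 ((n d)%:~R * s + (L - (n d)%:~R * len d.1))
  else fun=> 0.
have [|d|f [fv fg]] := @gluing _ _ a g.
- move=> d s; rewrite /g nopp oppositeK /=.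
  have := ll d; case: (eqVneq (origin d) u) => [->|du].
    by rewrite eq_sym => /negPf ->; congr Num.max; rewrite intrN; ring.
  by case: ifP => // _ _; congr Num.max; rewrite intrN; ring.
- rewrite /g /a; case: ifP => // _; first by rewrite mulr0 add0r (max_idPr (ltW L0)).
  case: ifP => // _; rewrite mulr0 add0r; apply/max_idPl.
  by rewrite subr_le0.
have gc d : pl_convex (g d).
  rewrite /g; case: ifP => _.
    by apply: pl_convex_max; [exact: pl_convex_cst|exact: pl_convex_affine].
  case: ifP => _; last exact: pl_convex_cst.
  by apply: pl_convex_max; [exact: pl_convex_cst|exact: pl_convex_affine].
have tf : tame f by apply: (glued_tame fg) => d; case: (gc d).
have f0 d s : 0 <= s <= len d.1 -> 0 <= f (arc d s).
  move=> /fg ->; rewrite /g; case: ifP => _; first by rewrite le_max lexx.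
  by case: ifP => _; rewrite ?le_max lexx.
have sl0 d : origin d != u -> 0 <= initial_slope f d.
  move=> du; apply: initial_slope_ge0 => // s /andP[s0 sl].
  by rewrite fv /a (negPf du) f0 // !ltW.
have sw : initial_slope f (opposite d0) = 1.
  apply: initial_slopeE; apply: (@eq_germ _ (fun s => 1%:~R * s + 0) _ _ _ _ L) => //.
    move=> s /andP[s0 sl]; rewrite /= expr0 mul1r add0r fg; last first.
      by apply/andP; split=> //; exact: ltW.
    rewrite /g oppositeK eqxx -/w eq_sym (negPf uw) nopp /n eqxx /= -/L !mul1r subrr addr0.
    by apply/esym/max_idPr.
  by have := germ_affine (1 : int) 0 0 false; rewrite expr0 mulr1.
have [D HD] := div_coeff_finite tf.
(* The principal divisor has coefficient [- S] at [u], so [absz S] chips there suffice whatever the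
   sign of [S]. *)
pose S := \sum_(d | origin d == u) initial_slope f d.
exists (absz S).
exists ((<< inl u >> : divisor G) *+ `|S|%N - << inl w >> - D); last first.
  by exists f; [exact/rational_functionP|move=> p; rewrite subKr HD].
move=> p; rewrite !coeffB coeffMn !coeff_point HD.
have [[v ->]|[d [s [Hs _ ->]]]] := point_arc p; last first.
  have [x [Ex _ _]] := arc_interior Hs; rewrite Ex /= mul0rn -Ex.
  by have := glued_div_le0 fg gc Hs; lia.
rewrite !(inj_eq (@inl_inj _ _)) div_coeff_initial.
have [<-|uv] := eqVneq u v.
  by rewrite eq_sym (negPf uw) -/S mulr1n; lia.
rewrite mul0rn [w == v]eq_sym; have [->|wv] := eqVneq v w; last first.
  have : 0 <= \sum_(d | origin d == v) initial_slope f d.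
    by apply: sumr_ge0 => d /eqP dv; apply: sl0; rewrite dv eq_sym.
  by lia.
rewrite (bigD1 (opposite d0)) //= sw.
have : 0 <= \sum_(d | (origin d == w) && (d != opposite d0)) initial_slope f d.
  by apply: sumr_ge0 => d /andP[/eqP dv _]; apply: sl0; rewrite dv eq_sym.
by rewrite sub0r opprK addKr.
Qed.

(** Dominations compose along a path: if [m] chips at [q] cover one at [v], and [k] chips at [v]
    cover one at [w], then [m k] chips at [q] cover one at [w]. *)
Lemma vertex_dominates (G : tropical_curve R) (q v : vertex G) : loopless G ->
  exists m, winnable ((<< inl q >> : divisor G) *+ m - << inl v >>).
Proof.
move=> ll; apply: (@curve_ind _ _ (fun v =>
  exists m, winnable ((<< inl q >> : divisor G) *+ m - << inl v >>)) q).
  by exists 1%N; rewrite mulr1n subrr; apply: effective_winnable; exact: effective0.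
move=> d [m Hm]; have [k Hk] := adjacent_dominates d ll.
exists (m * k)%N; have := winnableD (winnableMn k Hm) Hk.
by rewrite mulrnBl addrA subrK -mulrnA.
Qed.

Lemma transport_point (G H : tropical_curve R) (phi : point H -> point G) psi :
  isometry phi psi -> forall p, transport psi << p >> = << psi p >>.
Proof.
move=> iso p; apply/eq_divisor => q; rewrite (coeff_transport iso) !coeff_point.
have [K1 K2 _ _ _] := iso.
by rewrite -(can_eq K2) K1.
Qed.

Lemma transportMn (G H : tropical_curve R) (phi : point H -> point G) psi :
  isometry phi psi -> forall D n, transport psi (D *+ n) = transport psi D *+ n.
Proof.
by move=> iso D n; apply/eq_divisor => q; rewrite coeffMn !(coeff_transport iso) coeffMn.
Qed.

(** Each negative coefficient is paid for by a multiple of [q], so that reduction can start from an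
    effective divisor. *)
Lemma dominates (G : tropical_curve R) (D : divisor G) (q : point G) :
  exists n, winnable (D + << q >> *+ n).
Proof.
have [H [phi [psi [[iso _ _] ll sD]]]] := vertex_model D [:: q].
move=> /(_ q); rewrite inE eqxx => /(_ isT)[w qw].
suff [n Hn] : exists n, winnable (transport psi D + << inl w >> *+ n).
  exists n; have := winnable_transport (isometry_sym iso) Hn.
  rewrite (transportD (isometry_sym iso)) (transportMn (isometry_sym iso)).
  rewrite (transport_point (isometry_sym iso)) (transportK iso) -qw.
  by have [K1 K2 _ _ _] := iso; rewrite K2.
move: (transport psi D) sD => {D q qw} D sD.
rewrite -(freeg_sumE D) big_seq.
apply: (big_ind (fun D : divisor H => exists n, winnable (D + << inl w >> *+ n))).
- by exists 0%N; rewrite mulr0n addr0; apply: effective_winnable; exact: effective0.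
- move=> D1 D2 [n1 h1] [n2 h2]; exists (n1 + n2)%N.
  by rewrite mulrnDr addrACA; exact: winnableD.
- move=> p; rewrite mem_dom => /sD[v ->].
  have [c0|c0] := leP 0 (coeff (inl v) D).
    exists 0%N; rewrite mulr0n addr0; apply: effective_winnable => x.
    by rewrite coeffU; case: eqP; rewrite ?mulr1 ?mulr0.
  have [m Hm] := vertex_dominates w v ll.
  exists (m * `|coeff (inl v) D|)%N; rewrite mulrnA addrC.
  have -> : << coeff (inl v) D *g inl v >> = - ((<< inl v >> : divisor H) *+ `|coeff (inl v) D|).
    by rewrite freegU_muln freegUN; congr Freeg; congr [:: (_, _)]; rewrite natz; lia.
  by rewrite -mulrnBl; exact: winnableMn.
Qed.

End Domination.

Lemma finite_positive_min (R : realType) (I : finType) (e : I -> R) :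
  (forall i, 0 < e i) -> exists2 delta, 0 < delta & forall i, delta < e i.
Proof.
move=> e0.
suff [x x0 xe] : exists2 x, 0 < x & forall i, i \in enum I -> x < e i.
  by exists x => // i; apply: xe; rewrite mem_enum.
elim: (enum I) => [|i s [x x0 xs]]; first by exists 1.
exists (Num.min x (e i / 2)); first by rewrite lt_min x0 divr_gt0.
move=> j; rewrite inE gt_min => /orP[/eqP ->|/xs -> //].
by apply/orP; right; have := e0 i; lra.
Qed.

Section MaxAffine.
Variables (R : realType) (c : int -> R).

Definition max_affine (k0 : int) (ks : seq int) (s : R) :=
  foldr (fun k m => Num.max (k%:~R * s + c k) m) (k0%:~R * s + c k0) ks.

Lemma max_affine_ge k0 ks s k : k \in k0 :: ks -> k%:~R * s + c k <= max_affine k0 ks s.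
Proof.
elim: ks => [|k1 ks IH]; first by rewrite inE => /eqP ->.
rewrite !inE /= le_max => /or3P[kk|/eqP ->|kk]; last 2 first.
- by rewrite lexx.
- by rewrite IH ?orbT // inE kk orbT.
by rewrite IH ?orbT // inE kk.
Qed.

Lemma max_affine_attained k0 ks s : exists2 k, k \in k0 :: ks &
  max_affine k0 ks s = k%:~R * s + c k.
Proof.
elim: ks => [|k1 ks [k kks IH]] /=; first by exists k0; rewrite ?mem_head.
rewrite IH; case: leP => _; last by exists k1; rewrite // !inE eqxx orbT.
by exists k => //; move: kks; rewrite !inE => /orP[->|->]; rewrite ?orbT.
Qed.

Lemma max_affine_convex k0 ks : pl_convex (max_affine k0 ks).
Proof.
elim: ks => [|k1 ks IH] /=; first exact: pl_convex_affine.
exact: pl_convex_max (pl_convex_affine _ _) IH.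
Qed.

End MaxAffine.

(** * The largest firing function towards a base point *)

Section Reduction.
Variables (R : realType) (G : tropical_curve R) (E : divisor G) (q : vertex G).
Hypotheses (E0 : effective E) (sE : vertex_supported E).
Implicit Types (f h : point G -> R) (d : direction G).

(* The functions [f] moving chips of [E] towards [q]; the largest one produces
   the [q]-reduced divisor. *)
Definition firing f := [/\ tame f, f (inl q) = 0, forall p, 0 <= f p &
  forall p, p != inl q -> div_coeff f p <= coeff p E].

Let B := absz (deg E).

Lemma firing_edge f d : firing f -> forall s, 0 < s < len d.1 -> div_coeff f (arc d s) <= 0.
Proof.
move=> [_ _ _ Hf] s Hs; rewrite -(vertex_supported_arc sE Hs); apply: Hf.
by have [x [-> _ _]] := arc_interior Hs.
Qed.

Lemma firing_tangent f d : firing f -> forall s, 0 <= s <= len d.1 ->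
  f (inl (origin d)) + (initial_slope f d)%:~R * s <= f (arc d s).
Proof. by move=> Hf; have [tf _ _ _] := Hf; apply: edge_tangent => //; exact: firing_edge. Qed.

Lemma firing_end f d : firing f ->
  f (inl (origin d)) + (initial_slope f d)%:~R * len d.1 <= f (inl (origin (opposite d))).
Proof. by move=> Hf; rewrite -arc_len; apply: firing_tangent; rewrite // lexx ltW ?len_gt0. Qed.

(* The chips leaving the superlevel set of [f] through the origin of [d] cannot
   outnumber those of [E]. *)
Lemma firing_slope f d : firing f -> - B%:Z <= initial_slope f d.
Proof.
move=> Hf; have [tf fq f0 Ef] := Hf.
have [fd|fd] := eqVneq (f (inl (origin d))) 0.
  suff : 0 <= initial_slope f d by lia.
  by apply: initial_slope_ge0 => // s _; rewrite fd.
pose A v := f (inl (origin d)) <= f (inl v).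
have nqA : ~~ A q by rewrite /A fq -ltNge lt_neqAle eq_sym fd f0.
have H1 : - B%:Z <= \sum_(v | A v) \sum_(d | origin d == v) initial_slope f d.
  have : deg E >= \sum_(v | A v) coeff (inl v) E.
    rewrite deg_vertex_supported // [X in _ <= X](bigID A) /= lerDl.
    by apply: sumr_ge0 => v _; exact: E0.
  have := effective_deg_ge0 E0; move=> dE0 le1.
  have : - \sum_(v | A v) coeff (inl v) E <=
      \sum_(v | A v) \sum_(d | origin d == v) initial_slope f d.
    rewrite -sumrN; apply: ler_sum => v Av.
    have : inl v != inl q :> point G.
      by apply/eqP => -[vq]; rewrite vq (negPf nqA) in Av.
    by move=> /Ef; rewrite div_coeff_initial lerNl.
  by apply: le_trans; rewrite lerN2 /B gez0_abs.
(* Summed over all directions, [tau] is at least [- B]. By convexity no edge contributes a positive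
   amount, whether one or both of its ends lie in [A], and neither does the reverse of [d]; so the
   slope along [d] alone is at least [- B]. *)
pose tau d := if A (origin d) then initial_slope f d else 0.
have tau_le d' : tau d' + tau (opposite d') <= 0.
  have L0 := len_gt0 d'.1; have e1 := firing_end d' Hf; have := firing_end (opposite d') Hf.
  rewrite /= oppositeK => e2; rewrite /tau /A.
  case: (leP (f (inl (origin d))) (f (inl (origin d')))) => a1;
    case: (leP (f (inl (origin d))) (f (inl (origin (opposite d'))))) => a2 //.
  - rewrite -(ler_int R) intrD -(ler_pM2r L0) mul0r mulrDl; lra.
  - rewrite addr0 -(ler_int R) -(ler_pM2r L0) mul0r; lra.
  - rewrite add0r -(ler_int R) -(ler_pM2r L0) mul0r; lra.
have Ad : A (origin d) by rewrite /A lexx.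
have tauN : tau (opposite d) <= 0.
  rewrite /tau; case: ifP => // a2.
  have L0 := len_gt0 d.1; have := firing_end (opposite d) Hf; rewrite oppositeK /= => e2.
  rewrite -(ler_int R) -(ler_pM2r L0) mul0r.
  by move: a2; rewrite /A; lra.
have taud : tau d = initial_slope f d by rewrite /tau Ad.
move: H1; rewrite sum_origin big_mkcond -/tau sum_direction (bigD1 d.1) //=.
have : \sum_(e | e != d.1) (tau (e, false) + tau (e, true)) <= 0.
  by apply: sumr_le0 => e _; exact: (tau_le (e, false)).
have -> : tau (d.1, false) + tau (d.1, true) = tau d + tau (opposite d).
  by case: (d) => e [] //=; rewrite addrC.
by rewrite taud => r h; apply: le_trans h _; rewrite -addrA gerDl -[leRHS]addr0 lerD.
Qed.

(** The slope bound controls the growth along a path from [q]; inside an edge, convexity bounds the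
    value by the larger end value. *)
Lemma firing_bounded p : exists C, forall f, firing f -> f p <= C.
Proof.
have Hv v : exists C, forall f, firing f -> f (inl v) <= C.
  apply: (@curve_ind _ _ (fun v => exists C, forall f, firing f -> f (inl v) <= C) q).
    by exists 0 => f [_ -> _ _].
  move=> d [C HC]; exists (C + B%:R * len d.1) => f Hf.
  have := HC f Hf; have := firing_end (opposite d) Hf; rewrite oppositeK /=.
  have : (- B%:Z)%:~R * len d.1 <= (initial_slope f (opposite d))%:~R * len d.1.
    by apply: ler_wpM2r; [exact/ltW/len_gt0|rewrite ler_int firing_slope].
  by rewrite intrN; lra.
have [[v ->]|[d [s [Hs _ ->]]]] := point_arc p; first exact: Hv.
have [C1 H1] := Hv (origin d); have [C2 H2] := Hv (origin (opposite d)).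
have /andP[s0 sl] := Hs.
exists (Num.max C1 C2) => f Hf; have [tf _ _ _] := Hf.
have cf := edge_convex tf (firing_edge (d := d) Hf).
have [kr hr] := tf d s false ltac:(by rewrite sl ltW).
have [kl hl] := tf d s true ltac:(by rewrite s0 ltW).
have := cf _ _ _ Hs hl hr => klr.
have Hs' : 0 <= s <= len d.1 by rewrite !ltW.
have := convex_tangent (tf d) cf hl Hs' (s := s).
rewrite expr1 mulN1r subrr lexx (ltW s0) (ltW (len_gt0 _)) /= arc0 => /(_ isT isT) e1.
have := convex_tangent (tf d) cf hr Hs' (s := len d.1 - s).
rewrite expr0 mul1r subrKC lexx (ltW (len_gt0 _)) subr_ge0 (ltW sl) /= arc_len => /(_ isT isT) e2.
have := H1 f Hf; have := H2 f Hf; rewrite le_max => h2 h1.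
have [k0|k0] := leP 0 kl.
  have : 0 <= kl%:~R * s by rewrite mulr_ge0 ?ler0z // ltW.
  by move=> ?; apply/orP; left; lra.
have : 0 <= kr%:~R * (len d.1 - s) by rewrite mulr_ge0 ?ler0z ?subr_ge0 ?ltW //; lia.
by move=> ?; apply/orP; right; lra.
Qed.

(** The supporting line at [s] has the slope of [f] to the right of [s]; by convexity it lies
    between the initial slopes seen from the two ends of the edge, which [firing_slope] bounds. At
    the far end the edge is reversed. *)
Lemma firing_support f d s : firing f -> 0 <= s <= len d.1 ->
  exists2 k : int, `|k| <= B%:Z & forall u, 0 <= u <= len d.1 ->
    f (arc d s) + k%:~R * (u - s) <= f (arc d u).
Proof.
move=> Hf.
wlog sl : d s / s < len d.1.
  move=> W Hs; have [sl|sl] := ltP s (len d.1); first exact: W.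
  have -> : s = len d.1 by case/andP: Hs => _ h; apply/eqP; rewrite eq_le h.
  have [||k Bk Hk] := W (opposite d) 0; [exact: len_gt0|by rewrite lexx ltW ?len_gt0|].
  exists (- k); first by rewrite normrN.
  move=> u Hu; have := Hk (len d.1 - u).
  rewrite !arc_opposite subr0 subKr => /(_ ltac:(case/andP: Hu => *; apply/andP; split => /=; lra)).
  by rewrite intrN; lra.
move=> Hs; have /andP[s0 _] := Hs; have [tf _ _ _] := Hf.
have cf := edge_convex tf (firing_edge (d := d) Hf).
have [k hk] := tf d s false ltac:(by rewrite s0).
have Hk u : 0 <= u <= len d.1 -> f (arc d s) + k%:~R * (u - s) <= f (arc d u).
  move=> Hu; have /andP[u0 ul] := Hu; have [su|us] := leP s u.
    have := convex_tangent (tf d) cf hk Hs (s := u - s).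
    by rewrite expr0 mul1r subrKC Hu subr_ge0 su => /(_ isT isT).
  have s1 : 0 < s by exact: le_lt_trans us.
  have [l hl] := tf d s true ltac:(by rewrite s1 ltW).
  have := convex_tangent (tf d) cf hl Hs (s := s - u).
  rewrite expr1 mulN1r opprB subrKC Hu subr_ge0 ltW // => /(_ isT isT) /=.
  have lk : 0 <= l + k by apply: (cf s) => //; rewrite s1.
  have : (- k)%:~R * (s - u) <= l%:~R * (s - u).
    by apply: ler_wpM2r; [rewrite subr_ge0 ltW|rewrite ler_int; lia].
  by rewrite intrN; lra.
exists k => //; rewrite ler_norml; apply/andP; split.
  have [s0'|s0'] := eqVneq s 0.
    have -> : k = initial_slope f d.
      by apply/esym/initial_slopeE; rewrite -[X in germ _ X]s0'.
    exact: firing_slope.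
  have s1 : 0 < s by rewrite lt_neqAle eq_sym s0'.
  apply: le_trans (@firing_slope f d Hf) _; rewrite -(ler_int R) -(ler_pM2r s1).
  have := firing_tangent Hf Hs; have := Hk 0; rewrite lexx ltW ?len_gt0 // arc0 => /(_ isT).
  by lra.
have := @firing_slope f (opposite d) Hf.
suff : k <= - initial_slope f (opposite d) by lia.
have ls : 0 < len d.1 - s by rewrite subr_gt0.
rewrite -(ler_int R) -(ler_pM2r ls).
have := firing_tangent Hf (d := opposite d) (s := len d.1 - s).
rewrite /= arc_opposite subKr => /(_ ltac:(apply/andP; split; lra)).
have := Hk (len d.1); rewrite lexx ltW ?len_gt0 // arc_len => /(_ isT).
by rewrite intrN; lra.
Qed.

Lemma firing0 : firing (fun=> 0).
Proof.
split=> //; first exact: tame_cst.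
by move=> p _; rewrite div_coeff_cst; exact: E0.
Qed.

Definition largest_firing p := sup [set f p | f in firing].

Lemma has_sup_firing p : has_sup [set f p | f in firing].
Proof.
split; first by exists 0, (fun=> 0); [exact: firing0|].
by have [C HC] := firing_bounded p; exists C => _ [f Hf <-]; exact: HC.
Qed.

Lemma le_largest_firing f p : firing f -> f p <= largest_firing p.
Proof. by move=> Hf; apply: (sup_upper_bound (has_sup_firing p)); exists f. Qed.

Lemma largest_firing_ge0 p : 0 <= largest_firing p.
Proof. exact: (@le_largest_firing (fun=> 0) p firing0). Qed.

Lemma largest_firing_le p C : (forall f, firing f -> f p <= C) -> largest_firing p <= C.
Proof.
move=> H; apply: ge_sup; first by case: (has_sup_firing p).
by move=> _ [f Hf <-]; exact: H.
Qed.

Local Notation F := largest_firing.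

(* On an edge the supremum is the maximum of the affine functions below it whose
   slope is an integer in [-B, B]. *)
Lemma largest_firing_arc d : exists2 g, pl_convex g &
  forall s, 0 <= s <= len d.1 -> F (arc d s) = g s.
Proof.
have L0 := len_gt0 d.1.
pose ks := [seq i%:Z - B%:Z | i <- iota 0 (2 * B).+1].
have ksB (k : int) : `|k| <= B%:Z -> k \in ks.
  move=> kB; apply/mapP; exists (absz (k + B%:Z)); last by lia.
  by rewrite mem_iota; lia.
pose I := [set u | 0 <= u <= len d.1].
(* The largest constant for which the line of slope [k] stays below the supremum on the edge. *)
pose c (k : int) := inf [set F (arc d u) - k%:~R * u | u in I].
have lbc k : has_lbound [set F (arc d u) - k%:~R * u | u in I].
  exists (- (`|k%:~R| * len d.1)) => _ [u /andP[u0 ul] <-].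
  have : 0 <= F (arc d u) by exact: largest_firing_ge0.
  have : k%:~R * u <= `|k%:~R| * len d.1.
    by apply: le_trans (ler_norm _) _; rewrite normrM ler_wpM2l // ger0_norm.
  by lra.
have ck k s : 0 <= s <= len d.1 -> k%:~R * s + c k <= F (arc d s).
  move=> Hs; rewrite addrC -lerBrDr; apply: (ge_inf (lbc k)).
  by exists s.
exists (max_affine c 0 ks) => [|s Hs]; first exact: max_affine_convex.
apply/eqP; rewrite eq_le; apply/andP; split; last first.
  by have [k _ ->] := max_affine_attained c 0 ks s; exact: ck.
apply: largest_firing_le => f Hf.
have [k Bk Hk] := firing_support Hf Hs.
apply: le_trans (max_affine_ge c s (k := k) _); last by rewrite inE ksB ?orbT.
rewrite addrC -lerBlDr; apply: lb_le_inf.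
  by exists (F (arc d 0) - k%:~R * 0), 0 => //; rewrite /I /= lexx ltW.
move=> _ [u Hu <-]; have := Hk u Hu; have := le_largest_firing (arc d u) Hf.
by lra.
Qed.

(** At a vertex [v], a single firing [f] within [delta] of the supremum suffices, where [F] is
    affine up to [delta] on every edge at [v]. Comparing the tangent of [f] with [F] at distance
    [delta] shows that the slope of [f] exceeds that of [F] by less than 1, hence not at all, as
    both are integers. *)
Lemma largest_firingP : firing F.
Proof.
have /choice[g Hg] : forall d, exists g, pl_convex g /\
    forall s, 0 <= s <= len d.1 -> F (arc d s) = g s.
  by move=> d; have [g g1 g2] := largest_firing_arc d; exists g.
have Fg d s : 0 <= s <= len d.1 -> F (arc d s) = g d s by case: (Hg d) => _; apply.
have gc d : pl_convex (g d) by case: (Hg d).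
have tF : tame F by apply: (glued_tame Fg) => d; case: (gc d).
have F0 p : 0 <= F p by exact: largest_firing_ge0.
split=> //.
  apply/eqP; rewrite eq_le F0 andbT; apply: largest_firing_le => f [_ -> _ _].
  exact: lexx.
move=> p; have [[v ->] vq|[d [s [Hs _ ->]]] _] := point_arc p; last first.
  by apply: le_trans (E0 _); exact: (glued_div_le0 Fg).
have /choice[e He] : forall d, exists e, 0 < e /\ forall s, 0 <= s < e ->
    F (arc d s) = F (inl (origin d)) + (initial_slope F d)%:~R * s.
  move=> d; have [e e0 He] := initial_slopeP d tF; exists e; split=> // s /He /=.
  by rewrite expr0 mul1r add0r arc0.
have [|delta d0 Hd] := @finite_positive_min _ _ (fun d => Num.min (e d) (len d.1)).
  by move=> d; rewrite lt_min len_gt0 andbT; case: (He d).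
have [_ [f Hf <-]] := sup_adherent d0 (has_sup_firing (inl v)).
rewrite -/(F _) => fv; have [_ _ _ Ef] := Hf; apply: le_trans (Ef _ vq).
rewrite !div_coeff_initial lerN2; apply: ler_sum => d /eqP dv.
have := Hd d; rewrite lt_min => /andP[de dl].
have : F (arc d delta) = F (inl (origin d)) + (initial_slope F d)%:~R * delta.
  by case: (He d) => _; apply; rewrite ltW.
have Hdelta : 0 <= delta <= len d.1 by rewrite !ltW.
have := le_largest_firing (arc d delta) Hf; have := firing_tangent Hf Hdelta.
rewrite dv => h1 h2 h3.
suff : initial_slope f d - initial_slope F d < 1 by lia.
rewrite -(ltr_int R) intrB -(ltr_pM2r d0) mul1r mulrBl.
by lra.
Qed.

End Reduction.

Section Reduced.
Variable R : realType.

(** The second clause says that no nonzero function can move chips towards [q] without creating debt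
    elsewhere; it replaces the usual condition on sets fired at unit rate. *)
Definition reduced_at (G : tropical_curve R) (q : point G) (D : divisor G) :=
  (forall p, p != q -> 0 <= coeff p D) /\
  forall h, tame h -> h q = 0 -> (forall p, 0 <= h p) ->
    (forall p, p != q -> div_coeff h p <= coeff p D) -> forall p, h p = 0.

Lemma reduced_transport (G H : tropical_curve R) (phi : point H -> point G) psi q D :
  isometry phi psi -> reduced_at q D -> reduced_at (psi q) (transport psi D).
Proof.
move=> iso [D0 Hmax]; have [K1 K2 T V _] := iso.
have [_ _ T' V' _] := isometry_sym iso.
have nq p : p != psi q -> phi p != q by apply: contraNneq => <-; rewrite K1.
split=> [p pq|h th hq h0 hD p]; first by rewrite (coeff_transport iso) D0 ?nq.
rewrite -[p]K1 -[LHS]/((h \o psi) (phi p)); apply: Hmax => //; [exact/T'|by move=> p'; exact: h0|].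
move=> p' p'q; rewrite V' // -[X in coeff X _]K2 -(coeff_transport iso); apply: hD.
by rewrite (can_eq K2).
Qed.

(** Adding multiples of [q] changes no coefficient away from [q], so [D] may be taken effective.
    After firing the largest [F], any further admissible [h] would make [F + h] a larger firing
    function. *)
Lemma reduced_exists (G : tropical_curve R) (q : point G) (D : divisor G) :
  exists2 D', linearly_equivalent D D' & reduced_at q D'.
Proof.
have [n [E E0 DE]] := dominates D q.
suff [E' EE' red] : exists2 E', linearly_equivalent E E' & reduced_at q E'.
  exists (E' - << q >> *+ n).
    rewrite -[D](addrK (<< q >> *+ n)); apply: linear_equivD; last exact: linear_equiv_refl.
    exact: linear_equiv_trans DE EE'.
  have cq p : p != q -> coeff p (E' - << q >> *+ n) = coeff p E'.
    by move=> pq; rewrite coeffB coeffMn coeff_point eq_sym (negPf pq) mul0rn subr0.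
  case: red => red1 red2; split=> [p pq|h th hq h0 hD]; first by rewrite cq // red1.
  by apply: red2 => // p pq; rewrite -cq // hD.
move: E E0 {DE} => E E0.
have [H [phi [psi [[iso _ _] _ sE]]]] := vertex_model E [:: q].
move=> /(_ q); rewrite inE eqxx => /(_ isT)[w qw].
have iso' := isometry_sym iso.
suff [E' EE' red] : exists2 E', linearly_equivalent (transport psi E) E' & reduced_at (inl w) E'.
  exists (transport phi E').
    by rewrite -[E](transportK iso); exact: linear_equiv_transport iso' _ _ EE'.
  have := reduced_transport iso' red; rewrite -qw.
  by have [_ -> _ _ _] := iso.
have {}E0 : effective (transport psi E) by apply/(effective_transport iso).
move: (transport psi E) E0 sE => {E iso iso' qw q phi psi} E E0 sE.
have FP := largest_firingP w E0 sE; set F := largest_firing E w in FP.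
have [tF Fq F0 FE] := FP; have [D' HD'] := div_coeff_finite tF.
exists (E - D').
  by apply/linear_equivP; exists F => // p; rewrite coeffB HD'.
split=> [p pq|h th hq h0 hD p]; first by rewrite coeffB HD' subr_ge0 FE.
apply/eqP; rewrite eq_le h0 andbT.
suff : (F \+ h) p <= F p by rewrite /= gerDl.
apply: le_largest_firing => //; split.
- exact: tameD.
- by rewrite /= Fq hq addr0.
- by move=> p' /=; rewrite addr_ge0.
- move=> p' p'q; rewrite div_coeffD //.
  by have := hD p' p'q; rewrite coeffB HD'; lra.
Qed.

End Reduced.

(** * Acyclic orientations and the Riemann-Roch theorem *)

Section Orientation.
Variables (R : realType) (G : tropical_curve R).
Hypothesis ll : loopless G.
Implicit Types (r : vertex G -> int) (v w : vertex G) (d : direction G).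

(* An injective ranking of the vertices orients every edge, without directed cycles. *)
Definition lower_degree r v := #|[set d | (origin d == v) && (r (origin (opposite d)) < r v)]%SET|.

(** Indegree minus 1, for the orientation of every edge from lower to higher rank. *)
Definition orientation_divisor r : divisor G :=
  \sum_v << (lower_degree r v)%:Z - 1 *g inl v >>.

Lemma coeff_orientation r v : coeff (inl v) (orientation_divisor r) = (lower_degree r v)%:Z - 1.
Proof.
rewrite /orientation_divisor raddf_sum /=; under eq_bigr => w _ do rewrite coeffU.
rewrite (bigD1 v) //= eqxx mulr1 big1 ?addr0 // => w wv.
by rewrite (inj_eq (@inl_inj _ _)) (negPf wv) mulr0.
Qed.

Lemma orientation_vertex_supported r : vertex_supported (orientation_divisor r).
Proof.
move=> p; have [[v ->]|[d [s [Hs _ ->]]]] := point_arc p; first by exists v.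
have [x [-> _ _]] := arc_interior Hs.
rewrite /orientation_divisor raddf_sum /=; under eq_bigr => w _ do rewrite coeffU.
by rewrite big1 ?eqxx // => v _; rewrite mulr0.
Qed.

Lemma lower_degreeE r v : (lower_degree r v)%:Z =
  \sum_(d | origin d == v) (r (origin (opposite d)) < r (origin d))%R%:Z.
Proof.
rewrite /lower_degree -sum1dep_card big_mkcondr /= raddf_sum /=.
by apply: eq_bigr => d /eqP ->; case: ifP.
Qed.

Lemma deg_orientation r : injective r -> deg (orientation_divisor r) = (genus G)%:Z - 1.
Proof.
move=> ri; rewrite deg_vertex_supported; last exact: orientation_vertex_supported.
under eq_bigr => v _ do rewrite coeff_orientation.
rewrite sumrB; under eq_bigr => v _ do rewrite lower_degreeE.
rewrite (sum_origin _ predT) sum_direction (eq_bigr (fun=> 1)).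
  by rewrite !sumr_const; have := genusE G; rewrite !cardE; lia.
move=> e _; have := ll (e, false); rewrite /origin /= => st.
have : r (src e) != r (tgt e) by rewrite (inj_eq ri).
by case: ltgtP.
Qed.

(** Every direction at [v] leads to a lower or to a higher vertex, so the two lower degrees add up
    to the valence. *)
Lemma orientation_opposite r : injective r ->
  canonical_divisor G - orientation_divisor r = orientation_divisor (fun v => - r v).
Proof.
move=> ri; apply/eq_divisor => p; rewrite coeffB coeff_canonical.
have [[v ->]|[d [s [Hs _ ->]]]] := point_arc p; last first.
  rewrite !vertex_supported_arc //; try exact: orientation_vertex_supported.
  by rewrite /valence tangent_arc // cards2 eq_sym opposite_neq.
rewrite !coeff_orientation.
suff : (valence (inl v : point G))%:Z =
    (lower_degree r v)%:Z + (lower_degree (fun v => - r v) v)%:Z.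
  by move=> ->; ring.
rewrite !lower_degreeE -big_split /= /valence -sum1_card raddf_sum /=.
rewrite (eq_bigl (fun d => origin d == v)); last by move=> d; rewrite tangent_vertex.
apply: eq_bigr => d _; rewrite ltrN2.
have : r (origin d) != r (origin (opposite d)) by rewrite (inj_eq ri) ll.
by case: ltgtP.
Qed.

(* At the lowest vertex where [f] is maximal, [f] descends along every edge to a
   lower vertex, so firing [f] leaves a debt there. *)
Lemma orientation_not_winnable r : ~ winnable (orientation_divisor r).
Proof.
move=> [F F0 /linear_equivP[f tf HF]].
have fi d s : 0 < s < len d.1 -> div_coeff f (arc d s) <= 0.
  move=> Hs; have := F0 (arc d s); rewrite HF vertex_supported_arc ?sub0r ?oppr_ge0 //.
  exact: orientation_vertex_supported.
have [v0 _] := vertex_inhabited G.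
have [v1 _ v1max] := @arg_maxP _ R _ v0 predT (fun v => f (inl v)) isT.
have [v] := @arg_minP _ _ _ v1 (fun v => f (inl v) == f (inl v1)) r (eqxx _).
move=> /eqP fv vmin.
have vmax w : f (inl w) <= f (inl v) by rewrite fv; exact: v1max.
have := F0 (inl v); rewrite HF coeff_orientation lower_degreeE div_coeff_initial opprK.
apply/negP; rewrite -ltNge.
suff : \sum_(d | origin d == v) (r (origin (opposite d)) < r (origin d))%R%:Z +
       \sum_(d | origin d == v) initial_slope f d <= 0.
  by move=> h; rewrite addrAC -ltrBrDr; apply: le_lt_trans h _.
rewrite -big_split /=; apply: sumr_le0 => d /eqP dv.
have L0 := len_gt0 d.1.
have := edge_tangent tf (@fi d) (s := len d.1); rewrite lexx (ltW L0) => /(_ isT).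
rewrite arc_len dv => hd; case: ltP => rd; last first.
  rewrite add0r -(ler_int R) -(ler_pM2r L0) mul0r.
  by have := vmax (origin (opposite d)); lra.
suff : initial_slope f d < 0 by lia.
rewrite -(ltr_int R) -(ltr_pM2r L0) mul0r.
suff : f (inl (origin (opposite d))) < f (inl v) by lra.
rewrite lt_neqAle vmax andbT; apply/negP => /eqP E.
by have := vmin (origin (opposite d)); rewrite E fv eqxx => /(_ isT); rewrite leNgt rd.
Qed.

Lemma orientation_moderator r : injective r -> moderator (orientation_divisor r).
Proof.
move=> ri; split; [exact: deg_orientation|exact: orientation_not_winnable|].
by rewrite orientation_opposite //; exact: orientation_not_winnable.
Qed.

(** * Dhar's burning algorithm *)

Section Burning.
Variables (q : vertex G) (D : divisor G).
Hypotheses (sD : vertex_supported D) (redD : reduced_at (inl q) D).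
Hypothesis Dq : coeff (inl q) D < 0.

Definition burnt_degree (s : seq (vertex G)) v :=
  #|[set d | (origin d == v) && (origin (opposite d) \in s)]%SET|.

(* Otherwise the unburnt vertices could fire together without debt. *)
Lemma fire_spreads (s : seq (vertex G)) x : q \in s -> x \notin s ->
  exists2 v, v \notin s & coeff (inl v) D < (burnt_degree s v)%:Z.
Proof.
move=> qs xs; apply: contrapT => nv.
have Hv v : v \notin s -> (burnt_degree s v)%:Z <= coeff (inl v) D.
  by move=> vs; rewrite leNgt; apply/negP => ?; apply: nv; exists v.
have [redD1 redD2] := redD.
(* As [eps] is less than every edge length, a function equal to [eps] at the unburnt vertices can
   fall with slope 1 to 0 before reaching a burnt neighbour. *)
have [eps e0 He] := finite_positive_min (fun d : direction G => len_gt0 d.1).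
pose a v : R := if v \in s then 0 else eps.
pose g d : R -> R :=
  if origin d \in s then
    if origin (opposite d) \in s then fun=> 0
    else fun u => Num.max 0 (1%:~R * u + (eps - len d.1))
  else if origin (opposite d) \in s then fun u => Num.max 0 ((-1)%:~R * u + eps)
  else fun=> eps.
have gc d : pl_convex (g d).
  rewrite /g; case: ifP => _; case: ifP => _; try exact: pl_convex_cst;
    by apply: pl_convex_max; [exact: pl_convex_cst|exact: pl_convex_affine].
have [||h [hv hg]] := @gluing _ _ a g.
- move=> d u; rewrite /g oppositeK; case: ifP => _; case: ifP => _ //;
    by congr Num.max; rewrite intrN /=; ring.
- move=> d; rewrite /g /a; case: ifP => _; case: ifP => _ //.
    by rewrite mulr0 add0r; apply/max_idPl; rewrite subr_le0 ltW.
  by rewrite mulr0 add0r; apply/max_idPr; exact: ltW.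
have h0 p : 0 <= h p.
  have [[v ->]|[d [u [Hu _ ->]]]] := point_arc p.
    by rewrite hv /a; case: ifP => // _; exact: ltW.
  rewrite hg; last by case/andP: Hu => *; rewrite !ltW.
  by rewrite /g; case: ifP => _; case: ifP => _; rewrite ?le_max ?lexx // ltW.
have th : tame h by apply: (glued_tame hg) => d; case: (gc d).
suff : h (inl x) = 0 by rewrite hv /a (negPf xs) => E; rewrite E ltxx in e0.
apply: redD2 => //; first by rewrite hv /a qs.
move=> p; have [[v ->] vq|[d [u [Hu _ ->]]] _] := point_arc p; last first.
  by rewrite (vertex_supported_arc sD Hu); exact: (glued_div_le0 hg).
rewrite div_coeff_initial; have [vs|vs] := boolP (v \in s).
  apply: le_trans (redD1 _ vq); rewrite oppr_le0; apply: sumr_ge0 => d /eqP dv.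
  by apply: initial_slope_ge0 => // u _; rewrite dv hv /a vs.
apply: le_trans (Hv v vs); rewrite lerNl /burnt_degree -sum1dep_card raddf_sum /= -sumrN.
rewrite big_mkcondr /=; apply: ler_sum => d /eqP dv.
case: ifP => ds.
  rewrite (@glued_initial_slope _ _ _ _ hg d (-1)) //.
  have := germ_affine (-1) eps 0 false; rewrite expr0 mul1r; apply: (eq_germ e0).
  move=> u /andP[u0 ue]; rewrite expr0 mul1r add0r /g dv (negPf vs) ds.
  by apply/esym/max_idPr; rewrite intrN; lra.
rewrite (@glued_initial_slope _ _ _ _ hg d 0) //.
have := germ_affine 0 eps 0 false; rewrite mulr0; apply: (eq_germ e0) => u _.
by rewrite /g dv (negPf vs) ds mul0r add0r.
Qed.

(** Vertices are ranked in the order in which they burn: a vertex burns only when its edges to burnt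
    vertices outnumber its chips, and [q] can start because its coefficient is negative. *)
Lemma burning_order : exists2 r, injective r &
  forall v, coeff (inl v) D <= (lower_degree r v)%:Z - 1.
Proof.
pose deg_in (s : seq (vertex G)) v :=
  #|[set d | (origin d == v) && (index (origin (opposite d)) s < index v s)%N]%SET|.
pose burning s := [/\ uniq s, q \in s &
  forall v, v \in s -> coeff (inl v) D <= (deg_in s v)%:Z - 1].
suff [s [us _ Hs] alls] : exists2 s, burning s & forall v, v \in s.
  exists (fun v => (index v s)%:Z) => [v w [E]|v]; last first.
    apply: le_trans (Hs v (alls v)) _; rewrite lerD2r lez_nat.
    by apply: subset_leq_card; apply/fintype.subsetP => d; rewrite !inE.
  by rewrite -(nth_index v (alls v)) E nth_index.
have : burning [:: q].
  split=> // [|v]; first by rewrite inE.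
  by rewrite inE => /eqP ->; lia.
(* The first summand is the fuel of the induction, a bound on the number of unburnt vertices. *)
have : (#|vertex G| <= #|vertex G| + size [:: q])%N by rewrite leq_addr.
elim: {2}#|vertex G| [:: q] => [|n IH] s sn bs; have [us qs Hs] := bs.
  exists s => // v; apply/negPn/negP => vs.
  have : (size (v :: s) <= size (enum (vertex G)))%N.
    by apply: uniq_leq_size => [|w _]; rewrite ?mem_enum //= vs.
  by rewrite -cardE ltnNge -[X in (_ <= X)%N]add0n sn.
have [alls|/existsNP[x /negP xs]] := pselect (forall v, v \in s); first by exists s.
have [v vs Hv] := fire_spreads qs xs.
apply: (IH (rcons s v)); first by rewrite size_rcons; lia.
have idx w : w \in s -> index w (rcons s v) = index w s.
  by move=> ws; rewrite -cats1 index_cat ws.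
have idxv : index v (rcons s v) = size s by rewrite -cats1 index_cat (negPf vs) /= eqxx addn0.
split; [by rewrite rcons_uniq vs|by rewrite mem_rcons inE qs orbT|].
move=> w; rewrite mem_rcons inE => /orP[/eqP ->|ws].
  suff : (burnt_degree s v <= deg_in (rcons s v) v)%N.
    by move=> le_deg; rewrite lerBrDr lezD1; apply: lt_le_trans Hv _; rewrite lez_nat.
  apply: subset_leq_card; apply/fintype.subsetP => d; rewrite !inE => /andP[-> ds] /=.
  by rewrite idxv idx // index_mem.
apply: le_trans (Hs w ws) _; rewrite lerD2r lez_nat.
apply: subset_leq_card; apply/fintype.subsetP => d; rewrite !inE => /andP[-> ds] /=.
rewrite (idx _ ws) idx // -index_mem; apply: leq_trans ds _.
by rewrite ltnW // index_mem.
Qed.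

End Burning.
End Orientation.

(** * The Riemann-Roch theorem on an arbitrary model *)

Section RiemannRoch.
Variable R : realType.

Lemma moderator_transport (G H : tropical_curve R) (phi : point H -> point G) psi nu :
  refinement phi psi -> moderator nu -> moderator (transport phi nu).
Proof.
move=> [iso gG _] [dnu w1 w2]; split.
- by rewrite deg_transport dnu gG.
- move=> /(winnable_transport iso).
  by rewrite (transportK (isometry_sym iso)).
- move=> /(winnable_transport iso).
  rewrite (transportD iso) (transportN iso) (transportK (isometry_sym iso)).
  by rewrite (transport_canonical iso).
Qed.

Lemma dichotomy (G : tropical_curve R) (D : divisor G) :
  winnable D \/ exists2 nu, moderator nu & winnable (nu - D).
Proof.
have [v0 _] := vertex_inhabited G.
have [D1 DD1 red1] := reduced_exists (inl v0) D.
suff : winnable D1 \/ exists2 nu, moderator nu & winnable (nu - D1).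
  case=> [w1|[nu mnu w1]]; [left|right; exists nu => //].
    exact: winnable_equiv (linear_equiv_sym DD1) w1.
  apply: winnable_equiv w1; apply: linear_equivD; first exact: linear_equiv_refl.
  exact/linear_equivN/linear_equiv_sym.
(* The support of the reduced divisor, and so the model it requires, is known only now; reducedness
   is carried over to that model. *)
have [H [phi [psi [r ll sD]]]] := vertex_model D1 [:: inl v0].
move=> /(_ (inl v0)); rewrite inE eqxx => /(_ isT)[q qw].
have [iso _ _] := r; have iso' := isometry_sym iso.
have := reduced_transport iso red1; rewrite qw => red.
suff : winnable (transport psi D1) \/
    exists2 nu, moderator nu & winnable (nu - transport psi D1).
  case=> [|[nu mnu]] /(winnable_transport iso'); first by rewrite (transportK iso); left.
  rewrite (transportD iso') (transportN iso') (transportK iso) => w1; right.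
  by exists (transport phi nu) => //; exact: moderator_transport r mnu.
move: (transport psi D1) sD red => {D D1 DD1 red1 r iso iso' qw} D sD red.
have [Dq|Dq] := ltP (coeff (inl q) D) 0; last first.
  left; apply: effective_winnable => p; have [->|pq] := eqVneq p (inl q) => //.
  by case: red => red1 _; exact: red1.
have [rk ri Hr] := burning_order sD red Dq.
right; exists (orientation_divisor rk); first exact: orientation_moderator.
apply: effective_winnable => p; rewrite coeffB subr_ge0.
have [[v ->]|[d [s [Hs _ ->]]]] := point_arc p; first by rewrite coeff_orientation.
by rewrite !vertex_supported_arc //; exact: orientation_vertex_supported.
Qed.

Theorem riemann_roch (G : tropical_curve R) (D : divisor G) :
  rank D = rank (canonical_divisor G - D) + deg D - (genus G)%:Z + 1.
Proof. exact/riemann_roch_of_dichotomy/dichotomy. Qed.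

End RiemannRoch.

(** * Curves joined by a bridge *)

Section Bridge.
Variables (R : realType) (G : bool -> tropical_curve R) (v : forall b, vertex (G b)).

Local Notation bvertex := {b : bool & vertex (G b)}.
Local Notation bedge := (option {b : bool & edge (G b)}).

Definition bridge_src (e : bedge) : bvertex :=
  if e is Some e then existT _ (tag e) (src (tagged e)) else existT _ false (v false).
Definition bridge_tgt (e : bedge) : bvertex :=
  if e is Some e then existT _ (tag e) (tgt (tagged e)) else existT _ true (v true).
Definition bridge_len (e : bedge) : R := if e is Some e then len (tagged e) else 1.

Lemma bridge_len_gt0 e : 0 < bridge_len e.
Proof. by case: e => [e|] //=; exact: len_gt0. Qed.

Lemma bridge_edge_neq0 : (0 < #|{: bedge}|)%N.
Proof. by rewrite card_option. Qed.

Lemma bridge_connected x y :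
  connect (fun a b => [exists e, ((bridge_src e == a) && (bridge_tgt e == b))
                              || ((bridge_src e == b) && (bridge_tgt e == a))]) x y.
Proof.
set r := (X in connect X).
have rsym : connect_sym r.
  apply: sym_connect_sym => a b; apply: eq_existsb => e; exact: orbC.
have c1 e : connect r (bridge_src e) (bridge_tgt e).
  by apply: connect1; apply/existsP; exists e; rewrite !eqxx.
have HS b (a c : vertex (G b)) : connect r (existT _ b a) (existT _ b c).
  apply: (@curve_ind _ _ (fun c => connect r (existT _ b a) (existT _ b c)) a) => [|d ad].
    exact: connect0.
  apply: connect_trans ad _; have := c1 (Some (existT _ b d.1)).
  by case: d => e []; rewrite /origin //= rsym.
have HN b (a : vertex (G b)) : connect r (existT _ false (v false)) (existT _ b a).
  by case: b a => a; [exact: connect_trans (c1 None) (HS _ _ _)|exact: HS].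
by case: x y => b a [c w]; apply: connect_trans (HN c w); rewrite rsym.
Qed.

Definition bridge : tropical_curve R :=
  TropicalCurve bridge_len_gt0 bridge_edge_neq0 bridge_connected.

Lemma genus_bridge : genus bridge = (genus (G false) + genus (G true))%N.
Proof.
have eB : enum {: bool} = [:: true; false] by rewrite enumT unlock.
have cV : #|vertex bridge| = (#|vertex (G false)| + #|vertex (G true)|)%N.
  by rewrite card_tagged eB /= addn0 addnC.
have cE : #|edge bridge| = (#|edge (G false)| + #|edge (G true)|).+1%N.
  by rewrite card_option card_tagged eB /= addn0 addnC.
have := genusE bridge; rewrite cV cE.
by have := genusE (G false); have := genusE (G true); lia.
Qed.

Definition bridge_edge : direction bridge := (None, false).

Section Side.
Variable b : bool.

Definition side_edge (e : edge (G b)) : edge bridge := Some (existT _ b e).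
Definition side_direction (d : direction (G b)) : direction bridge := (side_edge d.1, d.2).

Definition side (p : point (G b)) : point bridge :=
  match p with
  | inl w => inl (existT _ b w)
  | inr x => edge_point (side_edge (val x).1) (val x).2
  end.

Lemma side_edge_point (e : edge (G b)) t : 0 <= t <= len e ->
  side (edge_point e t) = edge_point (side_edge e) t.
Proof.
move=> /andP[]; rewrite le_eqVlt => /orP[/eqP <- _|t1].
  by rewrite !edge_point0.
rewrite le_eqVlt => /orP[/eqP ->|t2].
  by rewrite edge_point_len; have := edge_point_len (side_edge e); rewrite /= => ->.
have [|x [Ex E1 E2]] := @arc_interior _ _ (e, false) t; first by rewrite t1.
by move: Ex E1 E2; rewrite /arc /= => -> /= -> ->.
Qed.

Lemma side_arc (d : direction (G b)) s : 0 <= s <= len d.1 ->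
  side (arc d s) = arc (side_direction d) s.
Proof.
move=> /andP[s0 sl]; rewrite /arc side_edge_point //.
by case: ifP => _; apply/andP; split; lra.
Qed.

Lemma side_direction_inj : injective side_direction.
Proof. by move=> [e1 b1] [e2 b2] [/eqP]; rewrite eq_Tagged /= => /eqP -> ->. Qed.

Lemma origin_side d : origin (side_direction d) = existT _ b (origin d).
Proof. by case: d => e []. Qed.

Lemma travel_side x d : d \in tangent x -> exists2 eps, 0 < eps & forall s, 0 < s < eps ->
  side (travel x d s) = travel (side x) (side_direction d) s.
Proof.
move=> /tangentP[s /andP[s0 sl] ->]; exists (len d.1 - s); first by rewrite subr_gt0.
move=> u /andP[u0 ul]; rewrite travel_arc ?s0 // !side_arc; last 2 first.
- by apply/andP; split; lra.
- by apply/andP; split; lra.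
by rewrite travel_arc //= s0.
Qed.

Lemma slope_side (f : point bridge -> R) x d k : d \in tangent x ->
  slope f (side x) (side_direction d) k <-> slope (f \o side) x d k.
Proof.
move=> /travel_side[e e0 He]; split=> -[u u0 Hu]; exists (Num.min u e); rewrite ?lt_min ?u0 //;
  move=> s; rewrite lt_min => /and3P[s0 su se].
  by rewrite /= He ?s0 // Hu ?s0.
by rewrite -He ?s0 // -Hu ?s0.
Qed.

Definition bridge_direction : direction bridge := (None, b).

Lemma origin_bridge : origin bridge_direction = existT _ b (v b).
Proof. by rewrite /bridge_direction /origin /=; case: (b). Qed.

Lemma tangent_side x : tangent (side x) =
  (side_direction @: tangent x :|: [set d | (d == bridge_direction) && (x == inl (v b))])%SET.
Proof.
apply/setP => d; rewrite !inE.
have [[w ->]|[d' [s [Hs _ ->]]]] := point_arc x.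
  rewrite [side _]/= tangent_vertex (inj_eq (@inl_inj _ _)).
  case: d => -[[c e]|] c'.
    rewrite [(_ == bridge_direction)](_ : _ = false) // orbF.
    apply/eqP/imsetP => [E|[d + ->]]; last by rewrite tangent_vertex origin_side => /eqP ->.
    have cb : c = b by move: E; rewrite /origin /=; case: c' => /= -[].
    subst c; exists (e, c') => //; rewrite tangent_vertex.
    by move/eqP: E; rewrite -[(_, _)]/(side_direction (e, c')) origin_side eq_Tagged.
  rewrite [X in X || _](_ : _ = false) /=; last by apply/negbTE/imsetP => -[].
  rewrite xpair_eqE eqxx /=; have [->|cb] := eqVneq c' b.
    by case: (b) w => w; rewrite /origin /= eq_Tagged /= eq_sym.
  apply/eqP => E; move: cb => /eqP; apply.
  by case: c' E; rewrite /origin /= => -[].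
rewrite side_arc; last by case/andP: Hs => *; rewrite !ltW.
rewrite !tangent_arc // [X in _ = _ || _ && X](_ : _ = false); last first.
  by have [y [-> _ _]] := arc_interior Hs.
by rewrite andbF orbF imsetU1 imset_set1 !inE.
Qed.

(** At the attaching vertex the bridge is the one tangent direction that the side does not see. *)
Lemma div_coeff_side (f : point bridge -> R) x : tame f -> tame (f \o side) ->
  div_coeff f (side x) = div_coeff (f \o side) x -
    (x == inl (v b))%:Z * initial_slope f bridge_direction.
Proof.
move=> tf tfs; rewrite /(div_coeff f) tangent_side.
have nb : bridge_direction \notin (side_direction @: tangent x)%SET by apply/imsetP => -[].
have sE : \sum_(d in (side_direction @: tangent x)%SET) outgoing_slope f (side x) d =
    - div_coeff (f \o side) x.
  rewrite big_imset /=; last by move=> ? ? _ _; exact: side_direction_inj.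
  rewrite opprK; apply: eq_bigr => d dx; apply: outgoing_slopeE.
  by apply/slope_side => //; exact: tame_slope.
have [xE|xv] := eqVneq x (inl (v b)).
  rewrite (_ : [set d | _]%SET = [set bridge_direction]%SET); last first.
    by apply/setP => d; rewrite !inE andbT.
  rewrite finset.setUC big_setU1 //= sE opprD opprK addrC mul1r.
  by rewrite /initial_slope origin_bridge xE.
rewrite (_ : [set d | _]%SET = finset.set0); last by apply/setP => d; rewrite !inE andbF.
by rewrite finset.setU0 sE opprK mul0r subr0.
Qed.

Lemma tame_side (f : point bridge -> R) : tame f -> tame (f \o side).
Proof.
move=> tf; apply: slope_tame => x d dx; eexists; apply/slope_side => //.
by apply: tame_slope => //; rewrite tangent_side inE imset_f.
Qed.

Lemma side_interior (e : edge (G b)) t : 0 < t < len e ->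
  exists2 z, side (edge_point e t) = inr z & val z = (side_edge e, t).
Proof.
move=> Ht; rewrite side_edge_point; last by case/andP: Ht => *; rewrite !ltW.
have [x [E E1 E2]] := @arc_interior _ bridge (side_edge e, false) t Ht.
by exists x => //; move: E1 E2; case: (\val x) => ? ? /= -> ->.
Qed.

Lemma side_inj : injective side.
Proof.
move=> x y; have [[w ->]|[e [t [Ht ->]]]] := edge_pointP x;
  have [[w' ->]|[e' [t' [Ht' ->]]]] := edge_pointP y.
- by case=> /eqP; rewrite eq_Tagged /= => /eqP ->.
- by have [z -> _] := side_interior Ht'.
- by have [z -> _] := side_interior Ht.
have [z -> Ez] := side_interior Ht; have [z' -> Ez'] := side_interior Ht'.
move=> [zz']; have : (side_edge e, t) = (side_edge e', t') by rewrite -Ez -Ez' zz'.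
by move=> [/eqP]; rewrite eq_Tagged /= => /eqP -> ->.
Qed.

End Side.

Definition region (p : point bridge) : option bool :=
  match p with
  | inl w => Some (tag w)
  | inr x => omap (@tag _ _) (val x).1
  end.

Lemma region_side b x : region (@side b x) = Some b.
Proof.
have [[w ->]|[e [t [Ht ->]]]] := edge_pointP x => //.
by have [z -> Ez] := side_interior Ht; rewrite /= Ez.
Qed.

Lemma region_bridge s : 0 < s < 1 -> region (arc bridge_edge s) = None.
Proof. by move=> Hs; have [x [-> /= -> _]] := @arc_interior _ _ bridge_edge s Hs. Qed.

Lemma bridge_point p : (exists b (x : point (G b)), p = side x) \/
  exists2 s, 0 < s < 1 & p = arc bridge_edge s.
Proof.
have [[[b w] ->]|[[[b e]|] [t [Ht ->]]]] := edge_pointP p.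
- by left; exists b, (inl w).
- left; exists b, (edge_point e t); rewrite side_edge_point //.
  by case/andP: Ht => *; rewrite !ltW.
- by right; exists t.
Qed.

Lemma arc_bridge0 : arc bridge_edge 0 = side (inl (v false)).
Proof. by rewrite arc0. Qed.

Lemma arc_bridge1 : arc bridge_edge 1 = side (inl (v true)).
Proof. exact: (arc_len bridge_edge). Qed.

Lemma pl_on_eq (L : R) g1 g2 : (forall s, 0 <= s <= L -> g1 s = g2 s) ->
  pl_on L g1 -> pl_on L g2.
Proof.
move=> E H t b Ht; have [k hk] := H t b Ht; exists k.
apply: (@eq_germ _ g1 _ _ _ _ (if b then t else L - t)) hk.
  by case: b Ht => /andP[? ?]; rewrite ?subr_gt0.
move=> s Hs; rewrite E //.
by case: b Ht Hs => /andP[? ?] /andP[? ?]; rewrite ?expr1 ?expr0; apply/andP; split; lra.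
Qed.

Lemma bridge_gluing (f_ : forall b, point (G b) -> R) (g : R -> R) :
  (forall b, tame (f_ b)) -> piecewise_linear g ->
  g 0 = f_ false (inl (v false)) -> g 1 = f_ true (inl (v true)) ->
  exists f : point bridge -> R, [/\ tame f, forall b, f \o @side b = f_ b &
    forall s, 0 <= s <= 1 -> f (arc bridge_edge s) = g s].
Proof.
move=> tf gpl g0 g1.
pose f (p : point bridge) := match p with
  | inl w => f_ (tag w) (inl (tagged w))
  | inr x => if (val x).1 is Some e then f_ (tag e) (edge_point (tagged e) (val x).2)
             else g (val x).2
  end.
have fs b : f \o @side b = f_ b.
  apply/funext => x /=; have [[w ->]|[e [t [Ht ->]]]] := edge_pointP x => //.
  by have [z -> Ez] := side_interior Ht; rewrite /f Ez.
have fg s : 0 <= s <= 1 -> f (arc bridge_edge s) = g s.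
  move=> /andP[]; rewrite le_eqVlt => /orP[/eqP <- _|s0]; first by rewrite arc_bridge0.
  rewrite le_eqVlt => /orP[/eqP ->|s1]; first by rewrite arc_bridge1.
  have [|x [-> E1 E2]] := @arc_interior _ _ bridge_edge s; first by rewrite s0.
  by rewrite /f E1 E2.
exists f; split=> //; apply: arcN_tame => -[[b e]|] /=; last first.
  by apply: (@pl_on_eq _ g) => [s /fg //|t b _]; exact: gpl.
apply: (@pl_on_eq _ ((f \o @side b) \o arc (e, false))).
  by move=> s Hs; rewrite /= side_arc.
by rewrite fs; exact: (tf b (e, false)).
Qed.

Definition push b (D : divisor (G b)) : divisor bridge :=
  \sum_(x <- dom D) << coeff x D *g side x >>.

Lemma coeff_push b (D : divisor (G b)) x : coeff (side x) (push D) = coeff x D.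
Proof.
rewrite /push raddf_sum /=; under eq_bigr => y _ do rewrite coeffU (inj_eq (@side_inj b)).
have [xD|xD] := boolP (x \in dom D); last first.
  rewrite (coeff_outdom xD) big_seq big1 // => y yD; case: eqP => [E|_]; last by rewrite mulr0.
  by rewrite -E yD in xD.
rewrite (bigD1_seq x) ?uniq_dom //= eqxx mulr1 big1 ?addr0 // => y /negPf ->.
by rewrite mulr0.
Qed.

Lemma coeff_push_out b (D : divisor (G b)) p : region p != Some b -> coeff p (push D) = 0.
Proof.
move=> pb; rewrite /push raddf_sum /= big1 // => x _; rewrite coeffU.
by case: eqP => [E|_]; rewrite ?mulr0 //; rewrite -E region_side eqxx in pb.
Qed.

Lemma push_eq b (D : divisor (G b)) F : (forall x, coeff (side x) F = coeff x D) ->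
  (forall p, region p != Some b -> coeff p F = 0) -> F = push D.
Proof.
move=> H1 H2; apply: eq_divisor => p; have [pb|pb] := eqVneq (region p) (Some b); last first.
  by rewrite coeff_push_out // H2.
have [[c [x px]]|[s Hs ps]] := bridge_point p; last by rewrite ps region_bridge in pb.
move: pb; rewrite px region_side => -[cb]; subst c; by rewrite coeff_push H1.
Qed.

Lemma push0 b : push (0 : divisor (G b)) = 0.
Proof. by rewrite /push dom0 big_nil. Qed.

Lemma pushD b (D E : divisor (G b)) : push (D + E) = push D + push E.
Proof.
by apply/esym/push_eq => [x|p pb]; rewrite coeffD ?coeff_push ?coeffD // !coeff_push_out ?addr0.
Qed.

Lemma pushN b (D : divisor (G b)) : push (- D) = - push D.
Proof.
by apply/esym/push_eq => [x|p pb]; rewrite coeffN ?coeff_push ?coeffN // !coeff_push_out ?oppr0.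
Qed.

Lemma push_point b (x : point (G b)) : push << x >> = << side x >>.
Proof.
apply/esym/push_eq => [y|p pb]; rewrite !coeff_point ?(inj_eq (@side_inj b)) //.
by case: eqP => // E; rewrite -E region_side eqxx in pb.
Qed.

Lemma push_effective b (D : divisor (G b)) : effective D -> effective (push D).
Proof.
move=> D0 p; rewrite /push raddf_sum /=; apply: sumr_ge0 => x _.
by rewrite coeffU mulr_ge0.
Qed.

End Bridge.

Section BridgeDivisors.
Variables (R : realType) (G : bool -> tropical_curve R) (v : forall b, vertex (G b)).
Local Notation H := (bridge v).
Local Notation side := (side v).
Local Notation push := (push v).

Lemma arc_bridge_direction b s :
  arc (bridge_direction v b) s = arc (bridge_edge v) (if b then 1 - s else s).
Proof. by case: b. Qed.

Section Profile.
Variables (f : point H -> R) (g : R -> R).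
Hypothesis fg : forall s, 0 <= s <= 1 -> f (arc (bridge_edge v) s) = g s.

Lemma bridge_initial_slope b k : germ g (if b then 1 else 0) b k ->
  initial_slope f (bridge_direction v b) = k.
Proof.
move=> hk; apply: initial_slopeE.
apply: (@eq_germ _ (fun u => g ((if b then 1 else 0) + (-1) ^+ b * u)) _ _ _ _ 1) => //.
  move=> s /andP[s0 s1]; rewrite /= arc_bridge_direction expr0 mul1r add0r fg.
    by congr g; case: (b); rewrite ?expr1 ?expr0; ring.
  by case: (b); apply/andP; split; lra.
by apply/germ_shift; rewrite mulr0 addr0 addbF.
Qed.

Lemma bridge_div s kl kr : 0 < s < 1 -> germ g s true kl -> germ g s false kr ->
  div_coeff f (arc (bridge_edge v) s) = - (kl + kr).
Proof.
move=> Hs hl hr; have /andP[s0 s1] := Hs.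
apply: div_coeff_arc => //.
  apply: eq_germ hl; [exact: s0|move=> u /andP[u0 u1]; rewrite /= fg // expr1].
  by apply/andP; split; lra.
apply: (@eq_germ _ _ _ _ _ _ (1 - s)) hr; first by rewrite subr_gt0.
by move=> u /andP[u0 u1]; rewrite /= fg // expr0; apply/andP; split; lra.
Qed.

End Profile.

Lemma extend_constant b (f : point (G b) -> R) :
  exists f_ : forall c, point (G c) -> R, f_ b = f /\
    forall c, c <> b -> f_ c = fun=> f (inl (v b)).
Proof.
case: b f => f.
  exists (fun c => if c as c' return point (G c') -> R then f else fun=> f (inl (v true))).
  by split=> // -[].
exists (fun c => if c as c' return point (G c') -> R then fun=> f (inl (v false)) else f).
by split=> // -[].
Qed.

(** The function extends over the bridge and the other side by its value at the attaching vertex. *)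
Lemma push_equiv b (D E : divisor (G b)) :
  linearly_equivalent D E -> linearly_equivalent (push D) (push E).
Proof.
move=> /linear_equivP[f tf HE].
have [f_ [fb fc]] := extend_constant f.
have tf_ c : tame (f_ c).
  by have [->|/eqP cb] := eqVneq c b; [rewrite fb|rewrite fc //; exact: tame_cst].
have f_v c : f_ c (inl (v c)) = f (inl (v b)).
  by have [->|/eqP cb] := eqVneq c b; [rewrite fb|rewrite fc].
pose g (_ : R) := f (inl (v b)).
have gpl : piecewise_linear g by have [] := pl_convex_cst (f (inl (v b))).
have [F [tF Fs Fg]] := bridge_gluing tf_ gpl (esym (f_v _)) (esym (f_v _)).
have g0 t c : germ g t c 0 by exists 1 => // s _; rewrite mul0r addr0.
apply/linear_equivP; exists F => // p.
have [[c [x ->]]|[s Hs ->]] := bridge_point p; last first.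
  rewrite !coeff_push_out ?region_bridge // (bridge_div Fg Hs (g0 _ _) (g0 _ _)).
  by rewrite !(addr0, oppr0, subr0).
rewrite div_coeff_side // Fs // (bridge_initial_slope Fg (g0 _ _)) mulr0 subr0.
have [cb|/eqP cb] := eqVneq c b; first by subst c; rewrite !coeff_push HE fb.
by rewrite fc // div_coeff_cst subr0 !coeff_push_out // region_side; apply/eqP => -[].
Qed.

Lemma push_winnable b (D : divisor (G b)) : winnable D -> winnable (push D).
Proof.
by move=> [E hE DE]; exists (push E); [exact: push_effective|exact: push_equiv].
Qed.

(** The chip is moved by a function of slope -1 on the bridge up to [s0], constant beyond it and on
    each side. *)
Lemma bridge_arc_equiv s0 : 0 < s0 <= 1 ->
  linearly_equivalent (<< side (inl (v false)) >> : divisor H) << arc (bridge_edge v) s0 >>.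
Proof.
move=> /andP[s00 s01].
pose g (s : R) := Num.max ((-1)%:~R * s + 0) (0%:~R * s + - s0).
have gE s : g s = Num.max (- s) (- s0) by rewrite /g intrN mul0r add0r addr0 mulN1r.
have g_lt s : s <= s0 -> g s = - s by move=> h; rewrite gE (max_idPl _) // lerN2.
have g_ge s : s0 <= s -> g s = - s0 by move=> h; rewrite gE (max_idPr _) // lerN2.
have gpl : piecewise_linear g.
  by have [] := pl_convex_max (pl_convex_affine (-1) (0:R)) (pl_convex_affine 0 (- s0)).
pose f_ b (_ : point (G b)) : R := if b then - s0 else 0.
have [F [tF Fs Fg]] : exists f : point H -> R, [/\ tame f, forall b, f \o side (b := b) = f_ b &
    forall s, 0 <= s <= 1 -> f (arc (bridge_edge v) s) = g s].
  apply: bridge_gluing => //; first by move=> b; exact: tame_cst.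
    by rewrite g_lt ?oppr0 // ltW.
  by rewrite g_ge.
have gdec t b : 0 <= t <= s0 -> (if b then 0 < t else t < s0) -> germ g t b ((-1) ^+ b * -1).
  move=> /andP[t0 ts] tb.
  apply: (@eq_germ _ (fun s => (-1)%:~R * s + 0) _ _ _ _ (if b then t else s0 - t)).
  - by case: b tb => //; rewrite subr_gt0.
  - move=> s Hs; rewrite intrN mulN1r addr0 g_lt //.
    by case: b tb Hs => tb /andP[? ?]; rewrite ?expr1 ?expr0; lra.
  - exact: germ_affine.
have gcst t b : s0 <= t -> (if b then s0 < t else true) -> germ g t b 0.
  move=> ts tb.
  apply: (@eq_germ _ (fun s => 0%:~R * s + - s0) _ _ _ _ (if b then t - s0 else 1)).
  - by case: b tb => //; rewrite subr_gt0.
  - move=> s Hs; rewrite mul0r add0r g_ge //.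
    by case: b tb Hs => tb /andP[? ?]; rewrite ?expr1 ?expr0; lra.
  - by have := germ_affine (0 : int) (- s0) t b; rewrite mulr0.
have gl0 : germ g 0 false (-1) by apply: (gdec 0 false) => //; rewrite lexx ltW.
have gls0 : germ g s0 true 1 by apply: (gdec s0 true) => //; rewrite lexx ltW.
exists F; first exact/rational_functionP.
move=> p; rewrite coeffB !coeff_point.
have [[c [x ->]]|[s Hs ->]] := bridge_point p; last first.
  rewrite (_ : (_ == arc _ s) = false) ?sub0r; last first.
    by apply/negP => /eqP/(congr1 (@region _ _ _)); rewrite region_side region_bridge.
  have /andP[s1 s2] := Hs; have [sE|sE] := eqVneq s s0.
    rewrite sE eqxx in Hs *; rewrite (bridge_div Fg Hs (kl := 1) (kr := 0)) //.
    exact: (gcst s0 false).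
  rewrite (_ : (_ == _) = false) ?oppr0; last first.
    apply/negP => /eqP; move: s01; rewrite le_eqVlt => /orP[/eqP ->|s01].
      by move=> /(congr1 (@region _ _ _)); rewrite arc_bridge1 region_side region_bridge.
    have [|y [-> _ /= E1]] := @arc_interior _ _ (bridge_edge v) s0; first by rewrite s00.
    have [y' [-> _ /= E2]] := @arc_interior _ _ (bridge_edge v) s Hs.
    by move=> [yy]; move: sE; rewrite -E1 -E2 yy eqxx.
  have [lt|gt] := ltP s s0.
    rewrite (bridge_div Fg Hs (kl := 1) (kr := -1)) ?subrr ?oppr0 //.
      by apply: (gdec s true) => //; rewrite !ltW.
    by apply: (gdec s false) => //; rewrite !ltW.
  have gt' : s0 < s by rewrite lt_neqAle eq_sym sE.
  rewrite (bridge_div Fg Hs (kl := 0) (kr := 0)) //; first exact: (gcst s true).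
  exact: (gcst s false).
have f_0 : div_coeff (f_ c) x = 0 by exact: div_coeff_cst.
rewrite div_coeff_side // Fs ?f_0 ?sub0r; last exact: tame_cst.
case: c x {f_0} => x; last first.
  rewrite (inj_eq (@side_inj _ _ _ false)) (bridge_initial_slope Fg (b := false) gl0).
  rewrite mulrN1 opprK eq_sym.
  rewrite (_ : (arc _ s0 == _) = false) ?subr0 ?natz //.
  apply/negP => /eqP; move: s01; rewrite le_eqVlt => /orP[/eqP ->|s01].
    by move=> /(congr1 (@region _ _ _)); rewrite arc_bridge1 !region_side.
  by move=> /(congr1 (@region _ _ _)); rewrite region_side region_bridge ?s00.
rewrite (_ : (side _ == _) = false) ?sub0r; last first.
  by apply/negP => /eqP/(congr1 (@region _ _ _)); rewrite !region_side.
congr (- _); rewrite natz; move: s01; rewrite le_eqVlt => /orP[/eqP sE|s01].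
  rewrite sE arc_bridge1 (inj_eq (@side_inj _ _ _ true)) eq_sym.
  by rewrite (bridge_initial_slope Fg (b := true) (k := 1)) ?mulr1 // -[X in germ _ X]sE.
rewrite (bridge_initial_slope Fg (b := true) (k := 0)) ?mulr0; last exact: (gcst 1 true (ltW _)).
rewrite (_ : (_ == _) = false) //.
by apply/negP => /eqP/(congr1 (@region _ _ _)); rewrite region_side region_bridge ?s00.
Qed.

Lemma bridge_ends_equiv :
  linearly_equivalent (<< side (inl (v false)) >> : divisor H) << side (inl (v true)) >>.
Proof. by rewrite -arc_bridge1; apply: bridge_arc_equiv; rewrite ltr01 lexx. Qed.

Lemma bridge_point_equiv (p : point H) : exists b (x : point (G b)),
  linearly_equivalent (<< p >> : divisor H) (push << x >>).
Proof.
have [[b [x ->]]|[s /andP[s0 s1] ->]] := bridge_point p.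
  by exists b, x; rewrite push_point; exact: linear_equiv_refl.
exists false, (inl (v false)); rewrite push_point.
by apply/linear_equiv_sym/bridge_arc_equiv; rewrite s0 ltW.
Qed.

(** Here [a] is the slope of the function where the bridge leaves the [false] side. The bridge
    carries no chips of [push D + push D'], so the function is convex on it and its outgoing slopes
    at the two ends have nonpositive sum. *)
Lemma winnable_split (D : divisor (G false)) (D' : divisor (G true)) :
  winnable (push D + push D') -> exists a : int,
  winnable (D + << a *g inl (v false) >>) /\ winnable (D' - << a *g inl (v true) >>).
Proof.
move=> [E E0 /linear_equivP[f tf HE]].
pose c b := initial_slope f (bridge_direction v b).
have Hs b (D1 : divisor (G b)) :
    (forall x, coeff (side x) (push D + push D') = coeff x D1) ->
    winnable (D1 + << c b *g inl (v b) >>).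
  move=> H1; have tfs := tame_side (b := b) tf; have [F HF] := div_coeff_finite tfs.
  exists (D1 + << c b *g inl (v b) >> - F); last first.
    by apply/linear_equivP; exists (f \o side (b := b)) => // x; rewrite coeffB HF.
  move=> x; have := E0 (side x); rewrite HE H1 div_coeff_side // coeffB coeffD HF coeffU eq_sym.
  by rewrite -/(c b) mulrC; lra.
have bi s : 0 < s < len (bridge_edge v).1 -> div_coeff f (arc (bridge_edge v) s) <= 0.
  move=> Hs'; have := E0 (arc (bridge_edge v) s).
  by rewrite HE coeffD !coeff_push_out ?region_bridge // addr0 sub0r oppr_ge0.
have bi' s : 0 < s < len (bridge_direction v true).1 ->
    div_coeff f (arc (bridge_direction v true) s) <= 0.
  move=> /andP[s0 /= s1]; rewrite arc_bridge_direction; apply: bi => /=.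
  by apply/andP; split; lra.
have c_le : c false + c true <= 0.
  have h1 := edge_tangent tf bi (s := 1); have h2 := edge_tangent tf bi' (s := 1).
  rewrite arc_bridge_direction subrr ler01 lexx in h2.
  rewrite ler01 lexx arc_bridge1 in h1.
  move: (h1 isT) (h2 isT); rewrite arc_bridge0 /= -!/(c _) -(ler_int R) intrD => h3 h4.
  by rewrite /c; move: h3 h4; rewrite /bridge_edge -/(bridge_direction v false); lra.
exists (c false); split.
  by apply: Hs => x; rewrite coeffD coeff_push coeff_push_out ?addr0 // region_side.
have -> : D' - << c false *g inl (v true) >> =
    (D' + << c true *g inl (v true) >>) + << - (c false + c true) *g inl (v true) >>.
  by apply/eq_divisor => x; rewrite !(coeffD, coeffN, coeffU); ring.
apply: winnableD.
  by apply: Hs => x; rewrite coeffD coeff_push coeff_push_out ?add0r // region_side.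
apply: effective_winnable => x; rewrite coeffU; case: eqP => _; rewrite ?mulr0 // mulr1.
by rewrite oppr_ge0.
Qed.

Lemma deg_push b (D : divisor (G b)) : deg (push D) = deg D.
Proof.
rewrite /push -[in RHS](freeg_sumE D) !raddf_sum /=.
by apply: eq_bigr => x _; rewrite !degU.
Qed.

(** A chip inside the bridge slides to an end of it, and then every chip lies on one of the two
    sides. *)
Lemma effective_equiv_push (E : divisor H) k : effective E -> deg E = k%:Z ->
  exists (E1 : divisor (G false)) (E2 : divisor (G true)) i j,
  [/\ effective E1 /\ deg E1 = i%:Z, effective E2 /\ deg E2 = j%:Z, (i + j)%N = k &
      linearly_equivalent E (push E1 + push E2)].
Proof.
elim: k E => [|k IH] E E0 dE.
  exists 0, 0, 0%N, 0%N; split; rewrite ?deg0 //; try by split=> //; exact: effective0.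
  have -> : E = 0 by apply: fgpos_eq0P => //; apply/fgposP.
  by rewrite !push0 addr0; exact: linear_equiv_refl.
have [p [E' [E0' dE' ->]]] := effective_split E0 dE.
have [E1 [E2 [i [j [[h1 d1] [h2 d2] ij EE]]]]] := IH _ E0' dE'.
have [b [x px]] := bridge_point_equiv p; have := linear_equivD px EE.
have ex := effective_point x.
case: b x px ex => x px ex.
  rewrite addrCA -pushD => ?; exists E1, (<< x >> + E2), i, j.+1.
  split=> //; last by rewrite addnS ij.
  by split; [exact: effectiveD|rewrite degD degU d2; lia].
rewrite addrA -pushD => ?; exists (<< x >> + E1), E2, i.+1, j.
split=> //; last by rewrite addSn ij.
by split; [exact: effectiveD|rewrite degD degU d1; lia].
Qed.

End BridgeDivisors.

(** * Chains of circles *)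

Section Segment.
Variable R : realType.

Lemma segment_connected (x y : bool) : connect (fun a b =>
  [exists e : unit, ((false == a) && (true == b)) || ((false == b) && (true == a))]) x y.
Proof.
case: x y => [] [] //; apply: connect1; apply/existsP; exists tt; by rewrite ?eqxx ?orbT.
Qed.

Lemma unit_neq0 : (0 < #|{: unit}|)%N.
Proof. by rewrite card_unit. Qed.

Definition segment : tropical_curve R :=
  @TropicalCurve R bool unit (fun=> false) (fun=> true) (fun=> 1) (fun=> ltr01)
    unit_neq0 segment_connected.

Lemma genus_segment : genus segment = 0%N.
Proof.
by have := genusE segment; rewrite /= card_bool card_unit; lia.
Qed.

End Segment.

Section Circle.
Variables (R : realType) (t : nat).

Definition circle_len (e : bool) : R := if e then t.+1%:R else 1.

Lemma circle_len_gt0 e : 0 < circle_len e.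
Proof. by case: e => //=; rewrite ltr0n. Qed.

Lemma circle_edge_neq0 : (0 < #|{: bool}|)%N.
Proof. by rewrite card_bool. Qed.

Lemma circle_connected (x y : bool) : connect (fun a b =>
  [exists e : bool, ((false == a) && (true == b)) || ((false == b) && (true == a))]) x y.
Proof.
case: x y => [] [] //; apply: connect1; apply/existsP; exists true; by rewrite ?eqxx ?orbT.
Qed.

(* The edge lengths are chosen so that the difference of the two vertices has
   order [t + 2] in the Jacobian. *)
Definition circle : tropical_curve R :=
  @TropicalCurve R bool bool (fun=> false) (fun=> true) circle_len circle_len_gt0
    circle_edge_neq0 circle_connected.

Lemma genus_circle : genus circle = 1%N.
Proof.
by have := genusE circle; rewrite /= card_bool; lia.
Qed.

Lemma rank_circle (D : divisor circle) : 0 < deg D -> rank D = deg D - 1.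
Proof.
move=> D0; rewrite riemann_roch genus_circle rank_deg_lt0; first by lia.
by rewrite degB deg_canonical genus_circle; lia.
Qed.

Lemma circle_winnable (D : divisor circle) : 0 < deg D -> winnable D.
Proof. by move=> D0; apply/rank_ge0; rewrite rank_circle //; lia. Qed.

Lemma circle_unwinnable (D : divisor circle) : deg D = 1 ->
  exists E, [/\ effective E, deg E = 1 & ~ winnable (D - E)].
Proof.
move=> D1; have [|E [h1 h2 h3]] := @rank_at_leastPn _ _ D 1.
  by move=> /rankP; rewrite rank_circle D1.
by exists E.
Qed.

Local Notation p := (inl true : point circle).
Local Notation w := (inl false : point circle).

Lemma circle_vertex_sum (F : direction circle -> int) b :
  \sum_(d | origin d == b) F d = F (false, b) + F (true, b).
Proof.
have edge_sum (f : edge circle -> int) : \sum_e f e = f true + f false.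
  exact: (big_bool +%R f).
rewrite big_mkcond (@sum_direction _ circle) edge_sum.
by rewrite /origin /=; case: b => /=; ring.
Qed.

(** Slope 1 on the edge of length [t + 1] and slope [t + 1] on the edge of length 1 climb equally
    from [w] to [p], and the slopes at either vertex add up to [t + 2] in absolute value. *)
Lemma circle_torsion_equiv : linearly_equivalent (<< p >> *+ t.+2) (<< w >> *+ t.+2).
Proof.
pose k (e : bool) : int := if e then 1 else t.+1%:Z.
pose a (x : bool) : R := if x then t.+1%:R else 0.
pose g (d : direction circle) (s : R) : R :=
  if d.2 then (- k d.1)%:~R * s + t.+1%:R else (k d.1)%:~R * s + 0.
have kl e : (k e)%:~R * len (e : edge circle) = t.+1%:R :> R.
  by case: e; rewrite /k /= ?mul1r ?mulr1.
have [||f [fv fg]] := @gluing _ circle a g.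
- by move=> [e []] s; rewrite /g /= -!(kl e) intrN /=; ring.
- by move=> [e []]; rewrite /g /a /origin /= mulr0 add0r.
have gc d : pl_convex (g d).
  by case: d => e []; rewrite /g /=; exact: pl_convex_affine.
have tf : tame f by apply: (glued_tame fg) => d; case: (gc d).
have gs d : germ (g d) 0 false (if d.2 then - k d.1 else k d.1).
  case: d => e []; rewrite /g /=.
    by have := germ_affine (- k e) (t.+1%:R : R) 0 false; rewrite expr0 mul1r.
  by have := germ_affine (k e) (0 : R) 0 false; rewrite expr0 mul1r.
have sl d := glued_initial_slope fg (gs d).
exists f; first exact/rational_functionP.
move=> x; rewrite coeffB !coeffMn !coeff_point.
have [[[] ->]|[d [s [Hs _ ->]]]] := point_arc x.
- rewrite (@div_coeff_initial _ circle f true) circle_vertex_sum !sl /k /= ?eqxx.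
  by rewrite mul0rn natz; lia.
- rewrite (@div_coeff_initial _ circle f false) circle_vertex_sum !sl /k /= ?eqxx.
  by rewrite mul0rn natz; lia.
have [y [Ey _ _]] := arc_interior Hs; rewrite Ey /= !mul0rn subrr -Ey.
have [gl hl] : exists kl, germ (g d) s true kl /\ germ (g d) s false (- kl).
  case: (d) => e []; rewrite /g /=.
    have h1 := germ_affine (- k e) (t.+1%:R : R) s true.
    have h2 := germ_affine (- k e) (t.+1%:R : R) s false.
    by exists (k e); move: h1 h2; rewrite expr1 expr0 mulN1r opprK mul1r.
  have h1 := germ_affine (k e) (0 : R) s true; have h2 := germ_affine (k e) (0 : R) s false.
  by exists (- k e); move: h1 h2; rewrite expr1 expr0 mulN1r opprK mul1r.
case: hl => h1 h2; have /andP[s0 s1] := Hs.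
rewrite (div_coeff_arc Hs (kl := gl) (kr := - gl)) ?subrr ?oppr0 //.
  by apply: (glued_germ fg) => //; rewrite s0 ltW.
by apply: (glued_germ fg) => //; rewrite s1 ltW.
Qed.

(** Conversely, a function with this divisor is affine on both edges; equal rises force slopes
    [(t + 1) c] and [c], hence [m = (t + 2) c]. *)
Lemma circle_torsion m : winnable (<< p >> *+ m - << w >> *+ m) <-> (t.+2 %| m)%N.
Proof.
split=> [W|/dvdnP[c ->]]; last first.
  rewrite mulnC !mulrnA -mulrnBl; apply: winnableMn.
  apply: winnable_equiv (effective_winnable (@effective0 _ _)).
  by apply/linear_equiv_sym/(proj1 (linear_equiv_sub0 _ _)); exact: circle_torsion_equiv.
have /linear_equivP[f tf Hf] := winnable_deg0 W ltac:(by rewrite degB !degMn !degU subrr).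
have Df x : div_coeff f x = coeff x (<< p >> *+ m - << w >> *+ m).
  by apply/eqP; rewrite eq_sym -subr_eq0 -Hf coeff0.
have f0 d s : 0 < s < len d.1 -> div_coeff f (arc d s) = 0.
  move=> Hs; rewrite Df coeffB !coeffMn !coeff_point.
  by have [y [-> _ _]] := arc_interior Hs; rewrite /= !mul0rn subrr.
pose sl e := initial_slope f (e, false).
have fe e : f p = f w + (sl e)%:~R * len (e : edge circle).
  have := edge_affine tf (f0 (e, false)) (s := len e).
  by rewrite lexx ltW ?len_gt0 // -[len e]/(len (e, false).1) arc_len => /(_ isT).
have slE : sl false = sl true * t.+1%:Z.
  have := fe true; rewrite (fe false) /= mulr1 => /addrI.
  by rewrite -[t.+1%:R]/(t.+1%:Z%:~R) -intrM => /eqP; rewrite eqr_int => /eqP.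
have := Df w; rewrite div_coeff_initial circle_vertex_sum -/(sl _) -/(sl _) slE.
rewrite coeffB !coeffMn !coeff_point eqxx /= mul0rn sub0r => /oppr_inj mE.
have {}mE : m%:Z = sl true * t.+2%:Z.
  by move: mE; rewrite natz => <-; ring.
by have : (t.+2%:Z %| m%:Z)%Z by apply/dvdzP; exists (sl true).
Qed.

End Circle.

(** * How attaching a circle changes the ranks of multiples of a point *)

Section Profiles.
Variable R : realType.

Definition has_profile (G : tropical_curve R) (v : vertex G) (lambda : nat -> nat) :=
  forall m k, rank_at_least (<< inl v >> *+ m) k <-> (lambda k <= m)%N.

Lemma segment_profile : has_profile (true : vertex (segment R)) id.
Proof.
move=> m k; split=> [/rank_at_least_deg|km].
  by rewrite degMn degU; lia.
apply/rankP; rewrite riemann_roch genus_segment degMn degU natz.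
apply: (@le_trans _ _ (-1 + m%:Z - 0 + 1)); first by lia.
by rewrite !lerD2r; exact: rank_geN1.
Qed.

Section Facts.
Variables (G : tropical_curve R) (v : vertex G) (lambda : nat -> nat).
Hypothesis prof : has_profile v lambda.

Lemma profile_rank k : rank_at_least (<< inl v >> *+ lambda k) k.
Proof. exact/prof. Qed.

(** One of the points to be removed may be [v] itself, which uses up one multiple of [v]. *)
Lemma profile_succ k : (lambda k < lambda k.+1)%N.
Proof.
have H := @profile_rank k.+1.
have l0 : (0 < lambda k.+1)%N by have := rank_at_least_deg H; rewrite degMn degU; lia.
rewrite -(prednK l0) ltnS; apply/prof => E E0 dE.
have [||F F0 EF] := H (<< inl v >> + E).
- by apply: effectiveD => //; exact: effective_point.
- by rewrite degD degU dE; lia.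
exists F => //; move: EF; rewrite -{1}(prednK l0) mulrSr opprD addrA addrK.
by [].
Qed.

Lemma profile_add i j : (lambda i + j <= lambda (i + j))%N.
Proof.
elim: j => [|j IH]; first by rewrite !addn0.
by rewrite !addnS; apply: leq_ltn_trans IH (profile_succ _).
Qed.

(** One divisor realises the minimum: an [E] that [lambda k - 1] copies of [v] fail to cover. When
    [lambda k] is 0 the degree already gives the bound. *)
Lemma profile_witness k : exists E, [/\ effective E, deg E = k%:Z &
  forall a : int, winnable (<< a *g inl v >> - E) -> (lambda k)%:Z <= a].
Proof.
have [l0|[n ln]] : lambda k = 0%N \/ exists n, lambda k = n.+1.
  by case: (lambda k) => [|n]; [left|right; exists n].
  exists (<< inl v >> *+ k); split; first exact/effectiveMn/effective_point.
    by rewrite degMn degU; lia.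
  by move=> a /winnable_deg_ge0; rewrite degB degU degMn degU l0; lia.
have [|E [E0 dE nE]] := @rank_at_leastPn _ _ (<< inl v >> *+ n) k.
  by move=> /prof; rewrite ln ltnn.
exists E; split=> // a Wa; rewrite ln leNgt; apply/negP => an; apply: nE.
have -> : << inl v >> *+ n - E = (<< a *g inl v >> - E) + << n%:Z - a *g inl v >>.
  apply/eq_divisor => x; rewrite !(coeffD, coeffN, coeffMn, coeffU, coeff_point).
  by case: eqP => _; rewrite ?mulr1 ?mulr0 ?mul0rn ?natz; lia.
apply: winnableD => //; apply: effective_winnable => x; rewrite coeffU.
by case: eqP => _; rewrite ?mulr0 // mulr1 subr_ge0; lia.
Qed.

Variable t : nat.

(* Of the [k + 1] points to be removed from [m] times the far vertex, either all lie
   on the old curve, or at least one lies on the circle; see [next_profileP]. *)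
Definition next_profile k : nat :=
  if k is k'.+1 then
    let a := maxn (lambda k').+2 (lambda k) in
    if (lambda k == a) && ~~ (t.+2 %| a)%N then a.+1 else a
  else 0.

(** In the first condition a point lies on the circle; the 2 pays for it and for a remaining degree
    of at least 1, as degree 0 need not be winnable on a circle. In the second all points lie on the
    old curve: [m] chips at the far vertex become [m] chips at the bridge if [t + 2] divides [m],
    and otherwise one is lost. *)
Lemma next_profileP k m : (next_profile k.+1 <= m)%N <->
  ((lambda k).+2 <= m)%N /\ (lambda k.+1 + ~~ (t.+2 %| m)%N <= m)%N.
Proof.
rewrite /next_profile; set a := maxn _ _.
have [a1 a2] : ((lambda k).+2 <= a)%N /\ (lambda k.+1 <= a)%N by rewrite leq_maxl leq_maxr.
have a3 : a = (lambda k).+2 \/ a = lambda k.+1 by rewrite /a; lia.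
case: ifP => [/andP[/eqP aE dv]|/negbT].
  split=> [am|[h1 h2]]; first by split; [lia|case: (dvdn _ _); lia].
  case: (ltngtP a m) => // [|ma]; first by lia.
  by rewrite -ma dv in h2; lia.
rewrite negb_and negbK => cond; split=> [am|[h1 h2]]; last by case: a3; lia.
split; first by lia.
case: (ltngtP a m) am => // [am|ma] _; first by case: (dvdn _ _); lia.
move: cond; rewrite ma => /orP[h|->]; last by rewrite addn0; lia.
by have : lambda k.+1 != m by []; case: (dvdn _ _); lia.
Qed.

Definition sides (b : bool) : tropical_curve R := if b then circle R t else G.

Definition side_vertex (b : bool) : vertex (sides b) :=
  match b return vertex (sides b) with true => false | false => v end.

Definition attach_circle : tropical_curve R := bridge side_vertex.

Definition far_vertex : vertex attach_circle := existT _ true true.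

Lemma genus_attach : genus attach_circle = (genus G).+1.
Proof. by rewrite genus_bridge genus_circle addn1. Qed.

Local Notation pushG := (@push R sides side_vertex false).
Local Notation pushC := (@push R sides side_vertex true).
Local Notation p := (inl true : point (circle R t)).
Local Notation w := (inl false : point (circle R t)).

Lemma pushMn b (D : divisor (sides b)) n : push side_vertex (D *+ n) = push side_vertex D *+ n.
Proof. by elim: n => [|n IH]; rewrite ?mulr0n ?push0 // !mulrS pushD IH. Qed.

Lemma push_far : pushC << p >> = << inl far_vertex >>.
Proof. exact: push_point. Qed.

(** Across the bridge, [a] chips at [v] trade for [a] chips at the near vertex of the circle. *)
Lemma attach_join (E1 : divisor G) (E2 : divisor (circle R t)) m a :
  winnable (<< inl v >> *+ a - E1) -> winnable (<< p >> *+ m - E2 - << w >> *+ a) ->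
  winnable (<< inl far_vertex >> *+ m - (pushG E1 + pushC E2)).
Proof.
move=> /(@push_winnable _ _ side_vertex false) W1 /(@push_winnable _ _ side_vertex true) W2.
apply: winnable_equiv (winnableD W1 W2).
rewrite !pushD !pushN !pushMn push_far.
have -> : pushG << inl v >> *+ a - pushG E1 +
    (<< inl far_vertex >> *+ m - pushC E2 - pushC << w >> *+ a) =
  (pushG << inl v >> - pushC << w >>) *+ a + (<< inl far_vertex >> *+ m - (pushG E1 + pushC E2)).
  by apply/eq_divisor => x; rewrite !(coeffD, coeffN, coeffB, coeffMn) mulrnBl; ring.
rewrite -[X in linearly_equivalent _ X]add0r.
apply: linear_equivD; last exact: linear_equiv_refl.
rewrite -[X in linearly_equivalent _ X](mul0rn _ a); apply: linear_equivMn.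
by apply/(proj1 (linear_equiv_sub0 _ _)); rewrite !push_point; exact: bridge_ends_equiv.
Qed.

(** Necessity tests a [profile_witness] on the old curve, once together with an unfavourable point
    of the circle and once alone. For sufficiency, when some point lies on the circle, [lambda i]
    chips cross the bridge and [profile_add] leaves positive degree on the circle. *)
Lemma attach_profile : has_profile far_vertex next_profile.
Proof.
move=> m [|k].
  split=> // _ E E0 dE; have -> : E = 0 by apply: fgpos_eq0P => //; apply/fgposP.
  by rewrite subr0; apply: effective_winnable; exact/effectiveMn/effective_point.
have degp : deg (<< p >> *+ m) = m%:Z by rewrite degMn degU; lia.
split=> [H|/next_profileP[km dm] E E0 dE].
  have split_win (E1 : divisor G) (E2 : divisor (circle R t)) :
      effective E1 -> effective E2 -> deg E1 + deg E2 = k.+1%:Z ->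
      exists a : int, [/\ winnable (<< a *g inl v >> - E1),
        winnable (<< p >> *+ m - E2 - << a *g w >>) & a <= m%:Z - deg E2].
    move=> h1 h2 d12.
    have [||F F0 EF] := H (pushG E1 + pushC E2).
    - by apply: effectiveD; exact: push_effective.
    - by rewrite degD !deg_push.
    have : winnable (pushG (- E1) + pushC (<< p >> *+ m - E2)).
      exists F => //; move: EF; rewrite !pushD !pushN pushMn push_far.
      by rewrite opprD addrCA.
    move=> /winnable_split[a [W1 W2]]; exists a.
    split; [by rewrite addrC|exact: W2|].
    by move: (winnable_deg_ge0 W2); rewrite !degB degp degU subr_ge0.
  apply/next_profileP; split.
    have [E1 [h1 d1 W]] := profile_witness k.
    (* [E2] is chosen to exclude the split that sends exactly [m - 1] chips across the bridge. *)
    have [|E2 [h2 d2 nW]] := @circle_unwinnable R t (<< p >> *+ m - << m%:Z - 1 *g w >>).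
      by rewrite degB degp degU; lia.
    have [|a [W1 W2 am]] := split_win E1 E2 h1 h2; first by rewrite d1 d2; lia.
    have := W a W1; rewrite d2 in am.
    have [aE|] := eqVneq a (m%:Z - 1); last by lia.
    by case: nW; rewrite -aE addrAC.
  have [E1 [h1 d1 W]] := profile_witness k.+1.
  have [|a [W1 W2 am]] := split_win E1 0 h1 (@effective0 _ _); first by rewrite d1 deg0; lia.
  have := W a W1; rewrite deg0 subr0 in am.
  have [aE|] := eqVneq a m%:Z; last by case: (dvdn _ _); lia.
  suff -> : (t.+2 %| m)%N by lia.
  apply/(circle_torsion R); move: W2; rewrite aE subr0; congr winnable; congr (_ - _).
  by rewrite freegU_muln natz.
have [E1 [E2 [i [j [[h1 d1] [h2 d2] ij EE]]]]] := effective_equiv_push E0 dE.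
apply: winnable_equiv (_ : winnable (<< inl far_vertex >> *+ m - (pushG E1 + pushC E2))).
  apply: linear_equivD; first exact: linear_equiv_refl.
  exact/linear_equivN/linear_equiv_sym.
case: j d2 ij => [|j] d2 ij.
  have E20 : E2 = 0 by apply: fgpos_eq0P => //; apply/fgposP.
  rewrite addn0 in ij; rewrite ij {i ij} in d1; rewrite E20.
  apply: (attach_join (a := (m - ~~ (t.+2 %| m))%N)).
    by apply: (proj2 (prof _ k.+1) _ E1 h1 d1); lia.
  rewrite subr0; case: (boolP (t.+2 %| m)%N) => [dv|_] /=.
    by rewrite subn0; apply/circle_torsion.
  by apply: circle_winnable; rewrite degB degp degMn degU; lia.
apply: (attach_join (a := lambda i)); first exact: (@profile_rank i).
apply: circle_winnable; rewrite !degB degp degMn degU d2.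
have := profile_add i j; have -> : (i + j)%N = k by lia.
by lia.
Qed.

End Facts.
End Profiles.

(** * Gap sequences *)

Section Gaps.
Variable R : realType.

Section Point.
Variables (G : tropical_curve R) (p : point G).
Local Notation g := (genus G).
Local Notation K := (canonical_divisor G).
Local Notation rho m := (rank (<< p >> *+ m)).

Lemma deg_multiple m : deg (<< p >> *+ m) = m%:Z.
Proof. by rewrite degMn degU natz. Qed.

Lemma rank_residual m : rank (K - << p >> *+ m) = rho m - m%:Z + g%:Z - 1.
Proof. by rewrite (riemann_roch (<< p >> *+ m)) deg_multiple; ring. Qed.

Lemma rho0 : rho 0%N = 0.
Proof.
have h : 0 <= rho 0%N by apply/rank_ge0/effective_winnable; rewrite mulr0n; exact: effective0.
have := rank_le_deg (<< p >> *+ 0); rewrite deg_multiple.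
by move: h; case: leP; lia.
Qed.

Lemma rho_ge0 m : 0 <= rho m.
Proof. exact/rank_ge0/effective_winnable/effectiveMn/effective_point. Qed.

Lemma rho_step m : rho m <= rho m.+1 <= rho m + 1.
Proof.
have E : << p >> *+ m = << p >> *+ m.+1 - << p >> :> divisor G by rewrite mulrSr addrK.
have := rank_sub_point (<< p >> *+ m.+1) p; have := rank_sub_point_le (<< p >> *+ m.+1) p.
by rewrite -E; lia.
Qed.

Lemma rhoD a b : rho a + rho b <= rho (a + b)%N.
Proof. by rewrite mulrnDr; apply: rankD; exact: rho_ge0. Qed.

Lemma is_gapE m : is_gap p m.+1 <-> rho m.+1 = rho m.
Proof.
rewrite /is_gap [m.+1.-1]/= !rank_residual.
have := rho_step m; move: (rho m) (rho m.+1) => x y H.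
by split=> [[_]|]; [|split=> //]; lia.
Qed.

Lemma is_gap_bound m : is_gap p m -> (0 < m < 2 * g)%N.
Proof.
move=> [m0 H]; rewrite m0 /= ltnNge; apply/negP => gm.
move: H; rewrite !rank_deg_lt0 ?ltxx // degB deg_multiple deg_canonical; lia.
Qed.

(* A gap at [2g - 1] forces [K] to be linearly equivalent to [(2g - 2) p]. *)
Lemma rho_duality m : is_gap p (2 * g - 1) -> (m <= 2 * g - 2)%N ->
  rho m = rho (2 * g - 2 - m)%N + m%:Z - g%:Z + 1.
Proof.
move=> Hg mg; have := is_gap_bound Hg => /andP[g0 _].
have d0 : deg (K - << p >> *+ (2 * g - 2)) = 0 by rewrite degB deg_multiple deg_canonical; lia.
(* The rank drops at [2 g - 1], so it was nonnegative just before; a divisor of degree 0 and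
   nonnegative rank is equivalent to 0. *)
have K0 : linearly_equivalent K (<< p >> *+ (2 * g - 2)).
  apply/linear_equiv_sub0/winnable_deg0 => //; apply/rank_ge0.
  have [_] := Hg; rewrite (_ : (2 * g - 1).-1 = (2 * g - 2)%N); last by lia.
  by have := rank_geN1 (K - << p >> *+ (2 * g - 1)); lia.
rewrite riemann_roch deg_multiple; congr (_ + _ - _ + _); apply: rank_equiv.
have -> : << p >> *+ (2 * g - 2 - m) = << p >> *+ (2 * g - 2) - << p >> *+ m :> divisor G.
  by rewrite -mulrnBr.
apply: linear_equivD => //; exact: linear_equiv_refl.
Qed.

Definition gap_rank (s : seq nat) m := (m - count (fun i => i <= m)%N s)%N.

(** Each step from [m] to [m + 1] either meets a gap or raises the rank by 1. *)
Lemma rho_gaps (s : seq nat) m : uniq s -> gap_sequence p s ->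
  rho m + (count (fun i => i <= m)%N s)%:Z = m%:Z.
Proof.
move=> us [_ Hs]; elim: m => [|m IH].
  rewrite rho0 add0r; congr Posz; apply/eqP; rewrite -leqn0 leqNgt -has_count.
  by apply/hasPn => i /Hs[i0 _]; rewrite leqNgt i0.
have -> : count (fun i => i <= m.+1)%N s = (count (fun i => i <= m)%N s + (m.+1 \in s))%N.
  rewrite -count_uniq_mem // -count_predUI addnC [X in (X + _)%N](_ : _ = 0%N).
    by apply: eq_count => i /=; rewrite leq_eqVlt ltnS orbC.
  apply/eqP; rewrite -leqn0 leqNgt -has_count; apply/hasPn => i _ /=.
  by case: eqP => [->|]; rewrite ?andbF // ltnn.
have := rho_step m; have [ms|ms] := boolP (m.+1 \in s).
  by have /Hs/is_gapE -> := ms; lia.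
have : rho m.+1 <> rho m by move=> /is_gapE/Hs; apply/negP.
by move: IH; move: (rho m) (rho m.+1) => x y; lia.
Qed.

(* The necessary conditions on a gap sequence [s] of a curve of genus [g]:
   superadditivity of the rank of multiples of [p] and, when [2g - 1] is a gap,
   the Riemann-Roch duality [m <-> 2g - 2 - m]. *)
Definition admissible (g : nat) (s : seq nat) :=
  all (fun a => all (fun b => gap_rank s a + gap_rank s b <= gap_rank s (a + b))%N
    (iota 0 (2 * g))) (iota 0 (2 * g)) &&
  ((2 * g - 1 \in s) ==>
     all (fun m => gap_rank s m + g == gap_rank s (2 * g - 2 - m) + m + 1)%N
       (iota 0 (2 * g - 1)))%N.

Lemma gap_sequence_admissible (s : seq nat) : uniq s -> gap_sequence p s -> admissible g s.
Proof.
move=> us Hs; have rE m : rho m = (gap_rank s m)%:Z.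
  by have := rho_gaps m us Hs; have := rho_ge0 m; rewrite /gap_rank; move: (rho m) => x; lia.
apply/andP; split.
  apply/allP => a _; apply/allP => b _; have := rhoD a b.
  by rewrite !rE -PoszD lez_nat.
apply/implyP => /(proj2 Hs) Hg; apply/allP => m; rewrite mem_iota => mg.
by have := rho_duality Hg (m := m) ltac:(lia); rewrite !rE; lia.
Qed.

End Point.

Lemma profile_gap (G : tropical_curve R) (v : vertex G) lambda m :
  has_profile v lambda -> is_gap (inl v) m <-> (0 < m)%N /\ forall k, lambda k <> m.
Proof.
move=> prof; case: m => [|m]; first by split=> -[].
have P j k : (k%:Z <= rank (<< inl v >> *+ j : divisor G)) <-> (lambda k <= j)%N.
  by rewrite rankP; exact: prof.
rewrite is_gapE; split=> [E|[_ nl]].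
  split=> // k kE; have := proj2 (P m.+1 k); rewrite E kE leqnn => /(_ isT)/P.
  by rewrite kE ltnn.
apply/eqP; rewrite eq_le; have /andP[-> _] := rho_step (inl v : point G) m.
rewrite andbT; have := rho_ge0 (inl v : point G) m.+1.
case rE : (rank _) => [k|//] _; apply/P.
have /P : k%:Z <= rank (<< inl v >> *+ m.+1 : divisor G) by rewrite rE.
by rewrite leq_eqVlt => /orP[/eqP/nl|].
Qed.

(** The head of the list is the circle attached last, which carries the marked point; the chain
    starts from a segment, of genus 0. *)
Fixpoint chain_profile (ts : seq nat) : nat -> nat :=
  if ts is t :: ts' then next_profile (chain_profile ts') t else id.

Lemma chain_exists (ts : seq nat) : exists (G : tropical_curve R) (v : vertex G),
  genus G = size ts /\ has_profile v (chain_profile ts).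
Proof.
elim: ts => [|t ts [G [v [gG prof]]]].
  by exists (segment R), true; split; [exact: genus_segment|exact: segment_profile].
exists (attach_circle v t), (far_vertex v t); split.
  by rewrite genus_attach gG.
exact: attach_profile.
Qed.

(** Testing [k <= m] is enough, since [chain_profile ts k] is at least [k]. *)
Definition realizes (ts s : seq nat) :=
  [&& sorted ltn s, all (fun m => 0 < m < 2 * size ts)%N s &
  all (fun m => (m \in s) == ~~ has (fun k => chain_profile ts k == m) (iota 0 m.+1))
    (iota 1 (2 * size ts - 1))].

Lemma chain_realizes (ts : seq nat) (n : (size ts).-tuple nat) :
  realizes ts n -> tropical_gap_sequences R (size ts) n.
Proof.
move=> /and3P[sn /allP bn /allP Hn]; split.
  by split=> // m /bn; lia.
have [G [v [gG prof]]] := chain_exists ts.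
exists G; split=> //; exists (inl v); split=> // m.
have kl k : (k <= chain_profile ts k)%N.
  by have := profile_add prof 0 k; rewrite add0n; lia.
have bool_gap : (0 < m < 2 * size ts)%N -> (m \in val n) <-> is_gap (inl v : point G) m.
  move=> Hm; rewrite (profile_gap m prof); have := Hn m.
  rewrite mem_iota => /(_ ltac:(lia)) /eqP ->.
  split=> [/hasPn H|[_ H]]; last first.
    by apply/hasPn => k _; apply/eqP; exact: H.
  split; first by lia.
  move=> k kE; have := H k; rewrite mem_iota kE eqxx => h.
  by have := kl k; rewrite kE => km; move: h; rewrite /= add0n ltnS km => /(_ isT).
split=> [mn|Hm]; apply/bool_gap => //; first exact: bn.
by have := is_gap_bound Hm; rewrite gG.
Qed.

Lemma sorted_mask (s : seq nat) N : sorted ltn s -> all (fun m => 0 < m < N.+1)%N s ->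
  s = mask [seq i \in s | i <- iota 1 N] (iota 1 N).
Proof.
move=> ss /allP bs; rewrite -filter_mask.
apply: (irr_sorted_eq ltn_trans ltnn ss).
  by apply: sorted_filter; [exact: ltn_trans|exact: iota_ltn_sorted].
move=> m; rewrite mem_filter mem_iota add1n; case: (boolP (m \in s)) => //= /bs.
by move=> ->.
Qed.

(** Testing up to [N] decides closure when all gaps are at most [N]: a larger summand gives a sum
    beyond every gap. *)
Definition closed_complement N (s : seq nat) := all (fun a => all (fun b =>
  [|| a \in s, b \in s | (a + b)%N \notin s]) (iota 1 N)) (iota 1 N).

Lemma numericalP g (n : g.-tuple nat) : numerical_gap_sequences g n <->
  candidate_sequences g n /\ closed_complement (2 * g - 1) n.
Proof.
rewrite /numerical_gap_sequences /=; split=> -[cn H]; split=> //.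
  apply/allP => a; rewrite mem_iota => Ha; apply/allP => b; rewrite mem_iota => Hb.
  have [//|an /=] := boolP (a \in val n); have [//|bn /=] := boolP (b \in val n).
  by apply: H => //; lia.
move=> a b a0 b0 an bn; apply/negP => abn.
have [_ /(_ _ abn) Hab] := cn.
have /allP/(_ a) := H; rewrite mem_iota => /(_ ltac:(lia)) /allP/(_ b).
by rewrite mem_iota (negPf an) (negPf bn) abn => /(_ ltac:(lia)).
Qed.

Lemma candidateP g (n : g.-tuple nat) : candidate_sequences g n <->
  sorted ltn n /\ all (fun m => 0 < m < (2 * g - 1).+1)%N n.
Proof.
split=> -[sn H]; split=> //; first by apply/allP => m /H; lia.
by move=> m mn; have /allP/(_ m mn) := H; lia.
Qed.

Lemma tropical_candidate g (n : g.-tuple nat) : tropical_gap_sequences R g n ->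
  candidate_sequences g n /\ admissible g n.
Proof.
move=> [cn [G [gG [p Hn]]]]; split=> //.
suff : admissible (genus G) n by rewrite gG.
apply: (gap_sequence_admissible (p := p)) => //.
by apply: sorted_uniq (proj1 cn); [exact: ltn_trans|exact: ltnn].
Qed.

(** Candidates are enumerated as masks of 1, ..., 2g - 1, so that the classification is decided by
    computation. *)
Fixpoint masks (N : nat) : seq bitseq :=
  if N is N'.+1 then [seq b :: m | b <- [:: true; false], m <- masks N'] else [:: [::]].

Lemma mem_masks (m : bitseq) : m \in masks (size m).
Proof.
elim: m => // b m IH.
by apply: (allpairs_f (fun b m => b :: m)) => //; case: b.
Qed.

Definition candidates g := [seq s <- [seq mask m (iota 1 (2 * g - 1)) | m <- masks (2 * g - 1)]
  | size s == g].

Lemma mem_candidates g (n : g.-tuple nat) : candidate_sequences g n -> val n \in candidates g.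
Proof.
move=> /candidateP[sn bn]; rewrite mem_filter size_tuple eqxx /=.
rewrite (sorted_mask sn bn); apply: map_f.
by have := mem_masks [seq i \in val n | i <- iota 1 (2 * g - 1)]; rewrite size_map size_iota.
Qed.

(* [L] lists the admissible sequences, each with the torsion orders of a chain
   of circles realizing it. *)
Definition classifies g (L : seq (seq nat * seq nat)) :=
  all (fun x => (size x.1 == g) && realizes x.1 x.2) L &&
  all (fun s => admissible g s ==> (s \in unzip2 L)) (candidates g).

Lemma tropical_classification g L (n : g.-tuple nat) : classifies g L ->
  tropical_gap_sequences R g n <-> val n \in unzip2 L.
Proof.
move=> /andP[/allP HL /allP Hc]; split=> [/tropical_candidate[cn an]|].
  by have /implyP := Hc _ (mem_candidates cn); apply.
move=> /mapP[[ts s] /HL /andP[/eqP /= gE rs] nE].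
by subst g; apply: chain_realizes; rewrite nE.
Qed.

Lemma numerical_classification g L (n : g.-tuple nat) :
  all (fun s => (sorted ltn s && all (fun m => 0 < m < (2 * g - 1).+1)%N s) &&
    closed_complement (2 * g - 1) s) L &&
  all (fun s => closed_complement (2 * g - 1) s ==> (s \in L)) (candidates g) ->
  numerical_gap_sequences g n <-> val n \in L.
Proof.
move=> /andP[/allP HL /allP Hc]; split=> [/numericalP[cn an]|].
  by have /implyP := Hc _ (mem_candidates cn); apply.
by move=> /HL/andP[/andP[h1 h2] h3]; apply/numericalP; split=> //; apply/candidateP.
Qed.

End Gaps.

(** * The classification in genus 2, 3 and 4 *)

Local Open Scope classical_set_scope.
Local Open Scope nat_scope.

Theorem theorem1p9 (R : realType) :
  [/\ tropical_gap_sequences R 2 = numerical_gap_sequences 2 /\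
      numerical_gap_sequences 2 = [set [tuple 1; 2]; [tuple 1; 3]],
      tropical_gap_sequences R 3 = numerical_gap_sequences 3 /\
      numerical_gap_sequences 3 =
        [set [tuple 1; 2; 3]; [tuple 1; 2; 4];
              [tuple 1; 2; 5]; [tuple 1; 3; 5]]
    & tropical_gap_sequences R 4 =
        numerical_gap_sequences 4 `|`
        [set [tuple 1; 2; 4; 6]; [tuple 1; 2; 5; 6]] /\
      tropical_gap_sequences R 4 =
        [set [tuple 1; 2; 3; 4]; [tuple 1; 2; 3; 5];
              [tuple 1; 2; 3; 6]; [tuple 1; 2; 3; 7];
              [tuple 1; 2; 4; 5]; [tuple 1; 2; 4; 6];
              [tuple 1; 2; 4; 7]; [tuple 1; 2; 5; 6];
              [tuple 1; 3; 5; 7]]].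
Proof.
(* A circle of parameter [7] has order [9], which no relevant multiple attains. *)
have T2 n : tropical_gap_sequences R 2 n <-> val n \in [:: [:: 1; 2]; [:: 1; 3]].
  by apply: (@tropical_classification R 2
    [:: ([:: 7; 0], [:: 1; 2]); ([:: 0; 0], [:: 1; 3])]); vm_compute.
have T3 n : tropical_gap_sequences R 3 n <->
    val n \in [:: [:: 1; 2; 3]; [:: 1; 2; 4]; [:: 1; 2; 5]; [:: 1; 3; 5]].
  by apply: (@tropical_classification R 3
    [:: ([:: 7; 7; 0], [:: 1; 2; 3]); ([:: 7; 0; 0], [:: 1; 2; 4]);
        ([:: 2; 0; 0], [:: 1; 2; 5]); ([:: 0; 0; 0], [:: 1; 3; 5])]); vm_compute.
have T4 n : tropical_gap_sequences R 4 n <-> val n \in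
    [:: [:: 1; 2; 3; 4]; [:: 1; 2; 3; 5]; [:: 1; 2; 3; 6]; [:: 1; 2; 3; 7];
        [:: 1; 2; 4; 5]; [:: 1; 2; 4; 6]; [:: 1; 2; 4; 7]; [:: 1; 2; 5; 6];
        [:: 1; 3; 5; 7]].
  by apply: (@tropical_classification R 4
    [:: ([:: 7; 7; 7; 0], [:: 1; 2; 3; 4]); ([:: 7; 7; 0; 0], [:: 1; 2; 3; 5]);
        ([:: 7; 2; 0; 0], [:: 1; 2; 3; 6]); ([:: 0; 2; 0; 0], [:: 1; 2; 3; 7]);
        ([:: 1; 7; 0; 0], [:: 1; 2; 4; 5]); ([:: 7; 0; 0; 0], [:: 1; 2; 4; 6]);
        ([:: 1; 0; 0; 0], [:: 1; 2; 4; 7]); ([:: 2; 0; 0; 0], [:: 1; 2; 5; 6]);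
        ([:: 0; 0; 0; 0], [:: 1; 3; 5; 7])]); vm_compute.
have N2 n : numerical_gap_sequences 2 n <-> val n \in [:: [:: 1; 2]; [:: 1; 3]].
  by apply: numerical_classification; vm_compute.
have N3 n : numerical_gap_sequences 3 n <->
    val n \in [:: [:: 1; 2; 3]; [:: 1; 2; 4]; [:: 1; 2; 5]; [:: 1; 3; 5]].
  by apply: numerical_classification; vm_compute.
have N4 n : numerical_gap_sequences 4 n <-> val n \in
    [:: [:: 1; 2; 3; 4]; [:: 1; 2; 3; 5]; [:: 1; 2; 3; 6]; [:: 1; 2; 3; 7];
        [:: 1; 2; 4; 5]; [:: 1; 2; 4; 7]; [:: 1; 3; 5; 7]].
  by apply: numerical_classification; vm_compute.
have tuple_eq g (n m : g.-tuple nat) : (n = m) = (val n == val m) :> Prop.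
  by apply/propext; split=> [->|/eqP/val_inj].
have orE (a b : bool) : (a \/ b) = (a || b) :> Prop by apply/propext/(rwP orP).
split; split; apply/funext => n; apply/propext => /=;
  rewrite ?T2 ?T3 ?T4 ?N2 ?N3 ?N4 ?tuple_eq ?orE //= !inE ?orbA //.
(* What remains is the union in genus 4, which lists the same nine tuples in another order. *)
by split=> ?; lia.
Qed.
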